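(* Let $d \geq 3$ and let $v \in L^1(\mathbb{R}^d) \cap L^\infty(\mathbb{R}^d)$ be an arbitrary non-negative potential. Then there are constants $\alpha, \beta > 0$ such that, for all $L>0$ large enough, $$\frac{\alpha}{L^2} \leq \Gamma_v(L) \leq \frac{\beta}{L^2}.$$
   Context: For $L>0$ let $\Lambda_L = \left(-\frac{L}{2}, \frac{L}{2}\right)^d \subset \mathbb{R}^d$. For a non-negative $v \in L^\infty(\mathbb{R}^d)$, let $h_L = -\Delta + v$ be the self-adjoint Schrödinger operator in $L^2(\Lambda_L)$ with Dirichlet boundary conditions on $\partial\Lambda_L$, with domain $H^1_0(\Lambda_L)\cap H^2(\Lambda_L)$. It has purely discrete spectrum; its eigenvalues, counted with multiplicity, are denoted $\lambda_0(L) < \lambda_1(L) \leq \dots$. The spectral gap is $\Gamma_v(L) := \lambda_1(L) - \lambda_0(L)$. *)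

(* Defs.v *)
From HB Require Import structures.
From mathcomp Require Import all_boot all_order all_algebra.
From mathcomp Require Import all_classical all_reals all_analysis.

Set Implicit Arguments.
Unset Strict Implicit.
Unset Printing Implicit Defensive.

Import Order.TTheory GRing.Theory Num.Theory.
Import numFieldNormedType.Exports.

Local Open Scope classical_set_scope.
Local Open Scope ring_scope.

(* Product sigma-algebra on row vectors, set up as the library does for
   n.-tuple T; on 'rV[R]_n it is the Borel sigma-algebra. *)
Definition rV_display : measure_display -> measure_display.
Proof. exact. Qed.

Section measurable_rV.
Context {d} {T : sigmaRingType d}.
Variable n : nat.

Let coord (i : 'I_n) (x : 'rV[T]_n) : T := x ord0 i.

Let rV_set0 : g_sigma_preimage coord set0.
Proof. exact: sigma_algebra0. Qed.

Let rV_setC A : g_sigma_preimage coord A -> g_sigma_preimage coord (~` A).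
Proof. exact: sigma_algebraC. Qed.

Let rV_bigcup (F : (set 'rV[T]_n)^nat) : (forall i, g_sigma_preimage coord (F i)) ->
  g_sigma_preimage coord (\bigcup_i (F i)).
Proof. exact: sigma_algebra_bigcup. Qed.

HB.instance Definition _ := @isMeasurable.Build (rV_display d)
  'rV[T]_n (g_sigma_preimage coord) rV_set0 rV_setC rV_bigcup.

End measurable_rV.

Lemma measurable_coord d (T : sigmaRingType d) n (i : 'I_n) :
  measurable_fun [set: 'rV[T]_n] (fun x => x ord0 i).
Proof.
move=> _ Y mY; rewrite setTI; apply: sub_sigma_algebra => /=.
rewrite -bigcup_seq/=; exists i => /=; first by rewrite mem_index_enum.
by exists Y => //; rewrite setTI.
Qed.

Lemma measurable_fun_coordP d1 d2 (T1 : measurableType d1)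
    (T2 : measurableType d2) n (f : T1 -> 'rV[T2]_n) :
  measurable_fun [set: T1] f <->
  forall i, measurable_fun [set: T1] (fun x => f x ord0 i).
Proof.
split=> [mf i|mf].
  exact: (measurableT_comp (measurable_coord i) mf).
move=> _ A; rewrite setTI.
pose F := [set A : set 'rV[T2]_n | measurable (f @^-1` A)].
suff : g_sigma_preimage (fun i (x : 'rV[T2]_n) => x ord0 i) `<=` F by exact.
apply: smallest_sub.
  split=> [|B FB|B FB]; rewrite /F /=.
  - by rewrite preimage_set0.
  - by rewrite setTD preimage_setC; exact: measurableC.
  - by rewrite preimage_bigcup; exact: bigcupT_measurable.
rewrite -bigcup_seq => B [i _ [C mC <-]]; rewrite /F /= setTI.
by have := mf i measurableT C mC; rewrite setTI.
Qed.

Definition consrV {T : Type} n (p : T * 'rV[T]_n) : 'rV[T]_n.+1 :=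
  \row_j oapp (p.2 ord0) p.1 (unlift ord0 j).

Lemma consrV0 {T : Type} n (p : T * 'rV[T]_n) : consrV p ord0 ord0 = p.1.
Proof. by rewrite mxE unlift_none. Qed.

Lemma consrVS {T : Type} n (p : T * 'rV[T]_n) (i : 'I_n) :
  consrV p ord0 (lift ord0 i) = p.2 ord0 i.
Proof. by rewrite mxE liftK. Qed.

Section lebesgue_rVS.
Context {R : realType} (n : nat).
Local Notation T := (measurableTypeR R).
Variable mu : {sigma_finite_measure set 'rV[R]_n -> \bar R}.

Let cons : T * 'rV[R]_n -> 'rV[R]_n.+1 := @consrV R n.

Let mcons : measurable_fun setT cons.
Proof.
apply/measurable_fun_coordP => i; case: (unliftP ord0 i) => [j ->|->].
  under eq_fun do rewrite consrVS.
  exact: (measurableT_comp (measurable_coord j) measurable_snd).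
by under eq_fun do rewrite consrV0; exact: measurable_fst.
Qed.

HB.instance Definition _ := @isMeasurableFun.Build _ _ _ _ cons mcons.

Definition lebesgue_rVS : set 'rV[R]_n.+1 -> \bar R :=
  pushforward (@lebesgue_measure R \x mu)%E cons.

Let lebesgue0 : lebesgue_rVS set0 = 0%E.
Proof. exact: measure0. Qed.

Let lebesgue_ge0 A : (0 <= lebesgue_rVS A)%E.
Proof. exact: measure_ge0. Qed.

Let lebesgue_sigma_additive : semi_sigma_additive lebesgue_rVS.
Proof. exact: measure_semi_sigma_additive. Qed.

HB.instance Definition _ := isMeasure.Build _ _ _ lebesgue_rVS
  lebesgue0 lebesgue_ge0 lebesgue_sigma_additive.

Let lebesgue_sigma_finite : sigma_finite setT lebesgue_rVS.
Proof.
have /sigma_finiteP[F [TF ndF Foo]] := sigma_finiteT (@lebesgue_measure R).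
have /sigma_finiteP[G [TG ndG Goo]] := sigma_finiteT mu.
pose uncons (x : 'rV[R]_n.+1) : T * 'rV[R]_n :=
  (x ord0 ord0, \row_j x ord0 (lift ord0 j)).
have consK : cancel cons uncons.
  move=> [a x]; rewrite /uncons consrV0; congr pair.
  by apply/rowP => j; rewrite mxE consrVS.
have muncons : measurable_fun [set: 'rV[R]_n.+1] uncons.
  apply/measurable_fun_pairP; split; first exact: measurable_coord.
  apply/measurable_fun_coordP => i; rewrite /uncons /=.
  by under eq_fun do rewrite mxE; exact: measurable_coord.
exists (fun k => uncons @^-1` (F k `*` G k)) => [|k].
  apply/esym; rewrite -subTset => x _.
  have [k _ Fk] : (\bigcup_k F k) (uncons x).1 by rewrite -TF.
  have [l _ Gl] : (\bigcup_k G k) (uncons x).2 by rewrite -TG.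
  exists (maxn k l) => //; split.
    by move: Fk; exact/subsetPset/ndF/leq_maxl.
  by move: Gl; exact/subsetPset/ndG/leq_maxr.
have [[mF Fk] [mG Gk]] := (Foo k, Goo k); split.
  by rewrite -[X in measurable X]setTI; apply: muncons => //; exact: measurableX.
rewrite /lebesgue_rVS /pushforward -comp_preimage.
rewrite (_ : uncons \o _ = id) ?preimage_id; last exact/funext.
by rewrite product_measure1E// lte_mul_pinfty// ge0_fin_numE.
Qed.

HB.instance Definition _ :=
  Measure_isSigmaFinite.Build _ _ _ lebesgue_rVS lebesgue_sigma_finite.

End lebesgue_rVS.

(* Lebesgue measure on R^n (see lebesgue_rV_prod for its value on products). *)
Fixpoint lebesgue_rV {R : realType} (n : nat) :
    {sigma_finite_measure set 'rV[R]_n -> \bar R} :=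
  match n with
  | 0 => [the {sigma_finite_measure set _ -> \bar R} of \d_(0 : 'rV[R]_0)]
  | n'.+1 => [the {sigma_finite_measure set _ -> \bar R} of
               lebesgue_rVS (lebesgue_rV n')]
  end.

Lemma lebesgue_rV_prod (R : realType) n (A : 'I_n -> set R) :
  (forall i, measurable (A i)) ->
  lebesgue_rV n [set x | forall i, A i (x ord0 i)] =
  (\prod_(i < n) @lebesgue_measure R (A i))%E.
Proof.
elim: n A => [|n IH] A mA.
  by rewrite big_ord0 /= diracE mem_set//= => -[].
rewrite big_ord_recl -IH; last by move=> i; exact: mA.
have mB : measurable [set x : 'rV[R]_n | forall i, A (lift ord0 i) (x ord0 i)].
  rewrite (_ : [set x | _] = \bigcap_(i in [set: 'I_n])
      ((fun x : 'rV[R]_n => x ord0 i) @^-1` A (lift ord0 i))).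
    apply: fin_bigcap_measurable => // i _; rewrite -[X in measurable X]setTI.
    exact: measurable_coord.
  by apply/seteqP; split=> [x xA i _|x xA i]; [exact: xA|exact: (xA i)].
rewrite -(product_measure1E (@lebesgue_measure R) (lebesgue_rV n) (mA ord0) mB).
rewrite /= /lebesgue_rVS /pushforward.
congr (_ \x _)%E; apply/seteqP; split=> [[a x]|[a x] [/= Aa xA] i] /=.
  move=> aA; split=> [|i]; first by have := aA ord0; rewrite consrV0.
  by have := aA (lift ord0 i); rewrite consrVS.
by case: (unliftP ord0 i) => [j ->|->]; rewrite ?consrVS ?consrV0.
Qed.

Section dirichlet_schroedinger.
Context {R : realType} {d : nat}.
Implicit Types (L E : R) (u v w phi : 'rV[R]_d -> R).

Definition box L : set 'rV[R]_d :=
  [set x | forall i, - (L / 2) < x ord0 i < L / 2].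

Lemma measurable_box L : measurable (box L).
Proof.
have -> : box L = \big[setI/setT]_(i < d)
    ((fun x : 'rV[R]_d => x ord0 i) @^-1` `]- (L / 2), (L / 2)[%classic).
  apply/seteqP; split=> [x xL|x].
    by rewrite -bigcap_seq => i _ /=; rewrite in_itv /= xL.
  by rewrite -bigcap_seq => xL i; have := xL i (mem_index_enum i); rewrite /= in_itv.
apply: bigsetI_measurable => i _; rewrite -[X in measurable X]setTI.
exact: measurable_coord.
Qed.

Definition box_measure L : {measure set 'rV[R]_d -> \bar R} :=
  [the {measure set _ -> \bar R} of mrestr (lebesgue_rV d) (measurable_box L)].

(* L^2(Lambda_L), through globally measurable representatives: their values
   outside the box are irrelevant. Functions are real-valued; the operator
   commutes with complex conjugation, so its eigenvalues and their
   multiplicities are the same as on the complex L^2 space. *)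
Definition L2box L u := u \in Lfun (box_measure L) 2%:E.

Definition inner L u w : R := (\int[box_measure L]_x (u x * w x))%R.

Definition partial (i : 'I_d) phi : 'rV[R]_d -> R :=
  fun x => 'D_(delta_mx 0 i) phi x.

(* C^infinity: all iterated partial derivatives exist and are continuous. *)
Definition smooth phi := forall s : seq 'I_d,
  continuous (foldr partial phi s) /\
  forall i x, derivable (foldr partial phi s) x (delta_mx 0 i).

Definition test_function L phi :=
  [/\ smooth phi, compact (closure [set x | phi x != 0]) &
      closure [set x | phi x != 0] `<=` box L].

Definition weak_partial L (i : 'I_d) u w :=
  [/\ L2box L u, L2box L w & forall phi, test_function L phi ->
      inner L u (partial i phi) = - inner L w phi].

Definition weak_gradient L u (g : 'I_d -> 'rV[R]_d -> R) :=
  forall i, weak_partial L i u (g i).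

(* H^1_0 is the closure of the test functions in the H^1 norm. *)
Definition H10 L u := L2box L u /\
  exists2 g, weak_gradient L u g &
  forall eps : R, 0 < eps -> exists2 phi, test_function L phi &
    inner L (u \- phi) (u \- phi) +
    \sum_(i < d) inner L (g i \- partial i phi) (g i \- partial i phi) < eps.

Definition H2_with_hessian L u (H : 'I_d -> 'I_d -> 'rV[R]_d -> R) := L2box L u /\
  exists2 g, weak_gradient L u g & forall i, weak_gradient L (g i) (H i).

(* Graph of h_L = - Delta + v: u is in the domain H^1_0 `&` H^2 and
   w = h_L u almost everywhere on the box. *)
Definition schroedinger v L u w :=
  H10 L u /\ exists2 H, H2_with_hessian L u H &
  {ae box_measure L, forall x, w x = - (\sum_(i < d) H i i x) + v x * u x}.

Definition eigenspace v L E : set ('rV[R]_d -> R) :=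
  [set u | schroedinger v L u (fun x => E * u x)].

Definition lin_indep L k (u : 'I_k -> 'rV[R]_d -> R) := forall c : 'I_k -> R,
  {ae box_measure L, forall x, \sum_(j < k) c j * u j x = 0} -> forall j, c j = 0.

(* lambda_k(L), the (k+1)-st smallest eigenvalue counted with multiplicity:
   the number of eigenvalues <= E, counted with multiplicity, is the maximal
   number of linearly independent eigenfunctions with eigenvalues <= E, and
   lambda_k is the least E for which this number is at least k.+1. *)
Definition eigenvalue v L (k : nat) : R :=
  inf [set E | exists e : 'I_k.+1 -> R, exists u : 'I_k.+1 -> 'rV[R]_d -> R,
    [/\ forall j, e j <= E, forall j, eigenspace v L (e j) (u j) &
        lin_indep L u]].

Definition spectral_gap v L : R := eigenvalue v L 1 - eigenvalue v L 0.

End dirichlet_schroedinger.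

(* Main.v *)
Require Import Defs.
From mathcomp Require Import all_boot all_order all_algebra.
From mathcomp Require Import all_classical all_reals all_analysis.
From mathcomp Require Import measurable_realfun ess_sup_inf ring lra.

Set Implicit Arguments.
Unset Strict Implicit.
Unset Printing Implicit Defensive.

Import Order.TTheory GRing.Theory Num.Theory.
Import numFieldNormedType.Exports.

Local Open Scope classical_set_scope.
Local Open Scope ring_scope.

(** The gap is computed by comparing [h_L] with the Dirichlet Laplacian of the
    box, whose eigenfunctions are products of sines ([wave]) with eigenvalues
    [(pi / L)^2 * \sum_i (k_i + 1)^2]. The lowest of these is [d (pi / L)^2] and
    all others are at least [(d + 3) (pi / L)^2].

    Since [v >= 0], the min-max principle gives
    [lambda_1(L) >= (d + 3) (pi / L)^2]. The normalised ground wave is bounded by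
    [(2 / L)^(d/2)], so as a trial function it gives
    [lambda_0(L) <= d (pi / L)^2 + (2 / L)^d |v|_1]. In dimension at least 3 the
    second term is [O(L^-3)] and the gap is at least
    [3 (pi / L)^2 - O(L^-3)]. In the other direction [lambda_0(L) >= 0], while the
    two lowest waves as trial functions give [lambda_1(L) = O(L^-2)].

    Applying min-max to the operator defined through weak derivatives rests on
    three results.

    - In a Hilbert space, a nonnegative perturbation of a diagonal operator with
      eigenvalues tending to infinity has two orthonormal eigenvectors below the
      levels predicted by trial vectors ([two_eigvec]), and no two independent
      eigenvectors below the second unperturbed level ([two_eigvec_ge]). The
      eigenvectors are minimisers of the energy, obtained one after the other.

    - The sine waves are total in [L^2] of the box ([wave_total]). Products of the
      ground wave with polynomials in the functions [sin (pi x_i / L)] are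
      combinations of waves, and such polynomials approximate indicator functions
      of orthants boundedly and pointwise.

    - A function [u] is in [H^1_0] and [H^2] with [- Laplacian u = z] if and only
      if every Dirichlet wave satisfies [<z, wave> = energy * <u, wave>]
      ([graph_H10_H2], [H10_H2_graph]). Both directions use that a Dirichlet wave
      is a limit of test functions in [H^1]: multiplied by smooth cutoffs near the
      boundary it still converges, because it vanishes there linearly.

    Finally [v] enters through its multiplication operator, which is bounded,
    symmetric and nonnegative ([eigenspaceP]). *)

(** * Semi-inner product spaces *)

Lemma increasing_seq_ge (f : nat -> nat) : increasing_seq f -> forall n, (n <= f n)%N.
Proof.
move=> fi; elim=> // n /leq_ltn_trans; apply.
have := fi n.+1 n; rewrite !leEnat => h.
by rewrite ltnNge h ltnn.
Qed.

Lemma increasing_seq_cvgy (f : nat -> nat) : increasing_seq f -> f @ \oo --> \oo.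
Proof.
move=> fi A [N _ NA]; exists N => // n /= Nn; apply: NA => /=.
exact: leq_trans (increasing_seq_ge fi n).
Qed.

Lemma normr_lt_sqr (R : realDomainType) (a e : R) :
  0 <= e -> a ^+ 2 < e ^+ 2 -> `|a| < e.
Proof. by move=> e0 ae; rewrite ltr_norml; apply/andP; split; nra. Qed.

Lemma normr_le_sqr (R : realDomainType) (a e : R) :
  0 <= e -> a ^+ 2 <= e ^+ 2 -> `|a| <= e.
Proof. by move=> e0 ae; rewrite ler_norml; apply/andP; split; nra. Qed.

(** Only semi-definite: vectors will be square integrable functions rather
    than classes of them, so [ip u u = 0] does not force [u = 0]. *)
Record semi_inner (R : realType) (V : lmodType R) := SemiInner {
  ip :> V -> V -> R;
  ipC : forall u w, ip u w = ip w u;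
  ipPl : forall a u1 u2 w, ip (a *: u1 + u2) w = a * ip u1 w + ip u2 w;
  ip_ge0 : forall u, 0 <= ip u u }.

Section semi_inner_theory.
Context {R : realType} {V : lmodType R} (B : semi_inner V).
Implicit Types u w : V.

Lemma ip0l w : B 0 w = 0.
Proof. by have := ipPl B (-1) 0 0 w; rewrite scaler0 addr0 => h; lra. Qed.

Lemma ipDl u1 u2 w : B (u1 + u2) w = B u1 w + B u2 w.
Proof. by rewrite -[u1 in LHS]scale1r ipPl mul1r. Qed.

Lemma ipZl a u w : B (a *: u) w = a * B u w.
Proof. by rewrite -[_ *: _]addr0 ipPl ip0l addr0. Qed.

Lemma ipNl u w : B (- u) w = - B u w.
Proof. by rewrite -scaleN1r ipZl mulN1r. Qed.

Lemma ipBl u1 u2 w : B (u1 - u2) w = B u1 w - B u2 w.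
Proof. by rewrite ipDl ipNl. Qed.

Lemma ipDr w u1 u2 : B w (u1 + u2) = B w u1 + B w u2.
Proof. by rewrite ipC ipDl !(ipC B w). Qed.

Lemma ipZr a u w : B w (a *: u) = a * B w u.
Proof. by rewrite ipC ipZl (ipC B w). Qed.

Lemma ipNr u w : B w (- u) = - B w u.
Proof. by rewrite ipC ipNl (ipC B w). Qed.

Lemma ipBr w u1 u2 : B w (u1 - u2) = B w u1 - B w u2.
Proof. by rewrite ipDr ipNr. Qed.

Lemma ip_suml (I : Type) (s : seq I) (F : I -> V) w :
  B (\sum_(i <- s) F i) w = \sum_(i <- s) B (F i) w.
Proof.
by elim: s => [|i s IH]; rewrite ?big_nil ?ip0l// !big_cons ipDl IH.
Qed.

Lemma ip_sumr (I : Type) (s : seq I) (F : I -> V) w :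
  B w (\sum_(i <- s) F i) = \sum_(i <- s) B w (F i).
Proof. by rewrite ipC ip_suml; apply: eq_bigr => i _; exact: ipC. Qed.

(** The squared norm. Estimates are kept in this form, with a factor 2 in the
    triangle inequality, rather than through square roots. *)
Definition nsq u := B u u.

Lemma nsq_ge0 u : 0 <= nsq u. Proof. exact: ip_ge0. Qed.

Lemma nsqB_sym u w : nsq (u - w) = nsq (w - u).
Proof. by rewrite -opprB /nsq ipNl ipNr opprK. Qed.

Lemma nsqZ a u : nsq (a *: u) = a ^+ 2 * nsq u.
Proof. by rewrite /nsq ipZl ipZr mulrA. Qed.

Lemma parallelogram u w : nsq (u - w) + nsq (u + w) = 2 * nsq u + 2 * nsq w.
Proof. by rewrite /nsq !(ipDl, ipDr, ipNl, ipNr); ring. Qed.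

Lemma nsqD_le u w : nsq (u + w) <= 2 * nsq u + 2 * nsq w.
Proof. by have := parallelogram u w; have := nsq_ge0 (u - w); lra. Qed.

Lemma nsq_triangle u w z : nsq (u - w) <= 2 * nsq (u - z) + 2 * nsq (z - w).
Proof. by have := nsqD_le (u - z) (z - w); rewrite addrA subrK. Qed.

Lemma cauchy_schwarz u w : (B u w) ^+ 2 <= nsq u * nsq w.
Proof.
have h t : 0 <= nsq u + 2 * t * B u w + t ^+ 2 * nsq w.
  have := nsq_ge0 (u + t *: w); rewrite /nsq !(ipDl, ipDr, ipZl, ipZr) (ipC B w u).
  by congr (_ <= _); ring.
have [w0|w0] := eqVneq (nsq w) 0.
  have [->|B0] := eqVneq (B u w) 0; first by rewrite w0 mulr0 expr0n.
  have := h (- (nsq u + 1) / (2 * B u w)); rewrite w0 mulr0 addr0.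
  rewrite (_ : _ + _ = -1); first by rewrite lerNr oppr0 ler10.
  by field.
have := h (- B u w / nsq w).
have -> : nsq u + 2 * (- B u w / nsq w) * B u w + (- B u w / nsq w) ^+ 2 * nsq w
   = (nsq u * nsq w - B u w ^+ 2) / nsq w by field.
by rewrite pmulr_lge0 ?subr_ge0// invr_gt0 lt_def w0 nsq_ge0.
Qed.

Definition converges (u : nat -> V) l := (fun n => nsq (u n - l)) @ \oo --> (0 : R).

Lemma convergesP (u : nat -> V) l : converges u l <->
  forall eps, 0 < eps -> \forall n \near \oo, nsq (u n - l) < eps.
Proof.
split.
  move=> /cvgrPdist_lt h eps e0; near=> n.
  have : `|0 - nsq (u n - l)| < eps by near: n; exact: h.
  by rewrite sub0r normrN ger0_norm ?nsq_ge0.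
move=> h; apply/cvgrPdist_lt => eps e0; near=> n.
rewrite sub0r normrN ger0_norm ?nsq_ge0//; near: n; exact: h.
Unshelve. all: by end_near. Qed.

Lemma converges_le (x : nat -> R) (u : nat -> V) l :
  (forall n, nsq (u n - l) <= x n) -> x @ \oo --> (0 : R) -> converges u l.
Proof.
move=> h x0; apply: (squeeze_cvgr _ (cvg_cst 0) x0).
by near=> n; rewrite nsq_ge0/= h.
Unshelve. all: by end_near. Qed.

(** Cauchy-Schwarz; adding 1 to [nsq w] covers the case [nsq w = 0]. *)
Lemma converges_ipl (u : nat -> V) l w : converges u l -> B (u n) w @[n --> \oo] --> B l w.
Proof.
move=> ul; apply/cvgrPdist_lt => eps e0.
have d0 : 0 < eps ^+ 2 / (nsq w + 1).
  by rewrite divr_gt0 ?exprn_gt0// ltr_wpDl ?nsq_ge0.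
near=> n; rewrite -ipBl; apply: normr_lt_sqr; first exact: ltW.
rewrite (le_lt_trans (cauchy_schwarz _ _))// nsqB_sym.
have h : nsq (u n - l) < eps ^+ 2 / (nsq w + 1).
  by near: n; move/convergesP : ul; exact.
have w1 : 0 < nsq w + 1 by rewrite ltr_wpDl ?nsq_ge0.
rewrite ltr_pdivlMr// in h; apply: le_lt_trans h.
by rewrite ler_wpM2l ?nsq_ge0// lerDl.
Unshelve. all: by end_near. Qed.

Lemma converges_ipr (u : nat -> V) l w : converges u l -> B w (u n) @[n --> \oo] --> B w l.
Proof.
by move=> /converges_ipl => /(_ w); rewrite (ipC B w) => h; under eq_fun do rewrite ipC.
Qed.

Lemma converges_ip (u w : nat -> V) l k : converges u l -> converges w k ->
  B (u n) (w n) @[n --> \oo] --> B l k.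
Proof.
move=> ul wk.
have -> : (fun n => B (u n) (w n)) =
  (fun n => B (u n - l) (w n - k) + B (u n) k + B l (w n) - B l k).
  by apply/funext => n; rewrite !(ipBl, ipBr); ring.
rewrite [X in _ --> X](_ : B l k = 0 + B l k + B l k - B l k); last by ring.
apply: cvgB; last exact: cvg_cst.
apply: cvgD; last exact: converges_ipr.
apply: cvgD; last exact: converges_ipl.
apply: norm_cvg0.
apply: (@squeeze_cvgr _ _ _ _ (fun=> 0) (fun n => nsq (u n - l) + nsq (w n - k))).
- near=> n; rewrite normr_ge0/=.
  have a0 := nsq_ge0 (u n - l); have b0 := nsq_ge0 (w n - k).
  apply: normr_le_sqr; first exact: addr_ge0.
  rewrite (le_trans (cauchy_schwarz _ _))//; nra.
- exact: cvg_cst.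
- by rewrite -[X in _ --> X]addr0; exact: cvgD.
Unshelve. all: by end_near. Qed.

Lemma converges_nsq (u : nat -> V) l : converges u l -> nsq (u n) @[n --> \oo] --> nsq l.
Proof. by move=> ul; exact: converges_ip. Qed.

Definition cauchy_seq (u : nat -> V) := forall eps, 0 < eps ->
  exists N, forall m n, (N <= m)%N -> (N <= n)%N -> nsq (u m - u n) < eps.

Definition hilbert := forall u : nat -> V, cauchy_seq u -> exists l, converges u l.

End semi_inner_theory.

(** * Orthonormal families *)

Section orthonormal.
Context {R : realType} {V : lmodType R} (B : semi_inner V).
Context {I : eqType} (e : I -> V) (s : nat -> seq I).

Definition orthonormal := forall k l, B (e k) (e l) = (k == l)%:R.

(** Lets series run over an index type without a chosen enumeration: [s N]
    plays the role of the first [N] indices. *)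
Definition exhaustion := [/\ forall N, uniq (s N),
  forall m n, (m <= n)%N -> {subset s m <= s n} & forall k, exists N, k \in s N].

Definition total := forall u, (forall k, B u (e k) = 0) -> nsq B u = 0.

Definition lincomb (r : seq I) (a : I -> R) := \sum_(k <- r) a k *: e k.

Hypotheses (eo : orthonormal) (se : exhaustion).

Lemma ip_lincomb_basis r a l : uniq r -> B (lincomb r a) (e l) = (l \in r)%:R * a l.
Proof.
elim: r => [|k r IH] /=; first by rewrite /lincomb big_nil ip0l mul0r.
case/andP=> kr ur; rewrite /lincomb big_cons ipPl eo -/(lincomb r a) IH// in_cons.
have [<-|kl] := eqVneq k l; last by rewrite mulr0 add0r.
by rewrite (negPf kr) mulr1 mul1r mul0r addr0.
Qed.

Lemma ip_lincomb r a w : B (lincomb r a) w = \sum_(k <- r) a k * B w (e k).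
Proof. by rewrite ip_suml; apply: eq_bigr => k _; rewrite ipZl ipC. Qed.

Lemma nsq_lincomb r a : uniq r -> nsq B (lincomb r a) = \sum_(k <- r) a k ^+ 2.
Proof.
move=> ur; rewrite /nsq ip_lincomb; apply: eq_big_seq => k kr.
by rewrite ip_lincomb_basis// kr mul1r.
Qed.

Lemma bessel r u : uniq r -> \sum_(k <- r) B u (e k) ^+ 2 <= nsq B u.
Proof.
move=> ur; have := nsq_ge0 B (u - lincomb r (fun k => B u (e k))).
have h : B (lincomb r (fun k => B u (e k))) u = \sum_(k <- r) B u (e k) ^+ 2.
  by rewrite ip_lincomb; apply: eq_bigr.
rewrite {1}/nsq ipBl !ipBr (ipC B u (lincomb _ _)) h.
by rewrite -!/(nsq B _) nsq_lincomb// subrr subr0 subr_ge0.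
Qed.

Lemma exhaustion_perm m n : (m <= n)%N ->
  perm_eq (s n) (s m ++ [seq k <- s n | k \notin s m]).
Proof.
case: se => us sub _ mn; apply: uniq_perm => //.
  rewrite cat_uniq us filter_uniq//= andbT.
  by apply/hasPn => k; rewrite mem_filter => /andP[].
move=> k; rewrite mem_cat mem_filter.
by have [/(sub _ _ mn)->|] := boolP (k \in s m).
Qed.

Lemma nsq_lincombB m n a : (m <= n)%N -> nsq B (lincomb (s n) a - lincomb (s m) a) =
  \sum_(k <- s n) a k ^+ 2 - \sum_(k <- s m) a k ^+ 2.
Proof.
move=> mn; rewrite /lincomb !(perm_big _ (exhaustion_perm mn))/= !big_cat/=.
rewrite addrAC subrr add0r addrAC subrr add0r -/(lincomb _ _) nsq_lincomb//.
by case: se => us _ _; rewrite filter_uniq.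
Qed.

Lemma sumr_exhaustion_le m n (a : I -> R) : (forall k, 0 <= a k) -> (m <= n)%N ->
  \sum_(k <- s m) a k <= \sum_(k <- s n) a k.
Proof.
move=> a0 mn; rewrite (perm_big _ (exhaustion_perm mn)) big_cat/= lerDl.
exact: sumr_ge0.
Qed.

(** The partial sums of the [a k ^+ 2] increase to a finite supremum, and
    their increments are the squared distances of the linear combinations. *)
Lemma lincomb_cauchy a C : (forall N, \sum_(k <- s N) a k ^+ 2 <= C) ->
  cauchy_seq B (fun N => lincomb (s N) a).
Proof.
move=> aC eps eps0; pose S N := \sum_(k <- s N) a k ^+ 2.
have hs : has_sup (range S).
  by split; [exists (S 0%N), 0%N|exists C => _ [N _ <-]; exact: aC].
have [_ [N _ <-] SN] := sup_adherent eps0 hs.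
have main m n : (N <= m)%N -> (m <= n)%N ->
    nsq B (lincomb (s n) a - lincomb (s m) a) < eps.
  move=> Nm mn; rewrite nsq_lincombB// -/(S n) -/(S m).
  have : S N <= S m by apply: sumr_exhaustion_le => // k; exact: sqr_ge0.
  have : S n <= sup (range S) by apply: ub_le_sup; [case: hs|exists n].
  by move: SN; lra.
exists N => m n Nm Nn; have [mn|/ltnW nm] := leqP m n; last exact: main.
by rewrite nsqB_sym main.
Qed.

Lemma lincomb_coef a u : converges B (fun N => lincomb (s N) a) u ->
  forall k, B u (e k) = a k.
Proof.
case: se => us sub cov => au k; have [N kN] := cov k.
have := @converges_ipl _ _ B _ _ (e k) au.
move/cvg_unique; apply => //.
apply: cvg_near_cst; exists N => // n /= Nn; rewrite ip_lincomb_basis//.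
by rewrite (sub _ _ Nn)// mul1r.
Qed.

Lemma riesz_fischer a C : hilbert B -> (forall N, \sum_(k <- s N) a k ^+ 2 <= C) ->
  exists u, converges B (fun N => lincomb (s N) a) u.
Proof. by move=> cB /lincomb_cauchy; exact: cB. Qed.

(** The partial sums converge by Bessel's inequality; their limit has the
    coefficients of [u], so totality identifies it with [u]. *)
Lemma expansion u : hilbert B -> total ->
  converges B (fun N => lincomb (s N) (fun k => B u (e k))) u.
Proof.
move=> cB tB; case: (se) => us _ _.
have [w uw] := riesz_fischer cB (fun N => bessel u (us N)).
have wu : nsq B (w - u) = 0.
  by apply: tB => k; rewrite ipBl (lincomb_coef uw) subrr.
apply: (@converges_le _ _ _ (fun N => 2 * nsq B (lincomb (s N) (fun k => B u (e k)) - w))).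
  by move=> N; have := nsq_triangle B (lincomb (s N) (fun k => B u (e k))) u w; rewrite wu mulr0 addr0.
by rewrite -(mulr0 2); apply: cvgM => //; exact: cvg_cst.
Qed.

Lemma parseval u w : hilbert B -> total ->
  \sum_(k <- s N) B u (e k) * B w (e k) @[N --> \oo] --> B u w.
Proof.
move=> cB tB; have := converges_ipl (w := w) (expansion u cB tB).
by under eq_fun do rewrite ip_lincomb.
Qed.

End orthonormal.

(** * Nonnegative perturbations of a diagonal operator *)

(** Bolzano-Weierstrass, extracting one sequence after the other. *)
Lemma joint_subsequence (R : realType) (I : eqType) (r : seq I) (x : I -> nat -> R) :
  (forall k n, `|x k n| <= 1) ->
  exists2 f : nat -> nat, increasing_seq f & {in r, forall k, cvgn (x k \o f)}.
Proof.
move=> x1; elim: r => [|k r [f fi fr]]; first by exists id.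
have [|g gi gc] := @bolzano_weierstrass _ (x k \o f).
  exists 1; split; first exact: num_real.
  by move=> M M1 n _ /=; rewrite (le_trans (x1 _ _))// ltW.
exists (f \o g) => [m n|l]; first by rewrite /= fi; exact: gi.
rewrite inE => /predU1P[->|/fr/cvg_ex[y fy]]; first exact: gc.
apply/cvg_ex; exists y.
exact: (cvg_comp g (x l \o f) (increasing_seq_cvgy gi) fy).
Qed.

Section diagonal_operator.
Context {R : realType} {V : lmodType R} (B : semi_inner V).
Context {I : eqType} (e : I -> V) (s : nat -> seq I) (mu : I -> R).
Hypotheses (eo : orthonormal B e) (se : exhaustion s).
Hypotheses (cB : hilbert B) (te : total B e).
Hypothesis mu_ge0 : forall k, 0 <= mu k.

(** The graph of the self-adjoint operator that maps [e k] to [mu k *: e k]: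
    being related to some [z] is the condition of belonging to its domain. *)
Definition graph u z := forall k, B z (e k) = mu k * B u (e k).

Lemma graph_lin a u z u' z' : graph u z -> graph u' z' -> graph (a *: u + u') (a *: z + z').
Proof. by move=> h h' k; rewrite !ipPl h h'; ring. Qed.

Lemma graph_basis k : graph (e k) (mu k *: e k).
Proof.
move=> l; rewrite ipZl !eo; have [->//|] := eqVneq k l.
by rewrite !mulr0.
Qed.

Lemma graph_sym u z u' z' : graph u z -> graph u' z' -> B z u' = B z' u.
Proof.
move=> h h'; have p := @parseval _ _ _ _ _ _ eo se z u' cB te.
have p' := @parseval _ _ _ _ _ _ eo se z' u cB te.
apply: (cvg_unique _ p) => //; rewrite (_ : (fun N => _) =
  fun N => \sum_(k <- s N) B z' (e k) * B u (e k))//.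
by apply/funext => N; apply: eq_bigr => k _; rewrite h h'; ring.
Qed.

(** A mode outside [s N] costs at least [M]; the finitely many others are
    corrected by hand. *)
Lemma graph_coercive N M u z : (forall k, k \notin s N -> M <= mu k) -> graph u z ->
  M * nsq B u <= B z u + \sum_(k <- s N) (M - mu k) * B u (e k) ^+ 2.
Proof.
move=> hM h.
have p := @parseval _ _ _ _ _ _ eo se z u cB te.
have p' := @parseval _ _ _ _ _ _ eo se u u cB te.
have q : (fun n => M * \sum_(k <- s n) B u (e k) * B u (e k)) @ \oo --> M * nsq B u.
  by apply: cvgM => //; exact: cvg_cst.
have q' : (fun n => \sum_(k <- s n) B z (e k) * B u (e k) +
    \sum_(k <- s N) (M - mu k) * B u (e k) ^+ 2) @ \oo -->
    (B z u + \sum_(k <- s N) (M - mu k) * B u (e k) ^+ 2).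
  by apply: cvgD => //; exact: cvg_cst.
apply: (ler_cvg_to q q'); exists N => // n /= Nn.
rewrite mulr_sumr -lerBlDl -sumrB (perm_big _ (exhaustion_perm se Nn)) big_cat/=.
rewrite [leLHS](_ : _ = \sum_(k <- s N) (M - mu k) * B u (e k) ^+ 2 +
   \sum_(k <- s n | k \notin s N) (M - mu k) * B u (e k) ^+ 2); last first.
  by rewrite big_filter; congr +%R; apply: eq_bigr => k _; rewrite h; ring.
rewrite gerDl; apply: sumr_le0 => k kN.
by rewrite mulr_le0_ge0 ?sqr_ge0// subr_le0 hM.
Qed.

Lemma graph_ge0 u z : graph u z -> 0 <= B z u.
Proof.
move=> h; have p := @parseval _ _ _ _ _ _ eo se z u cB te.
apply: (cvgr_to_ge p); apply: nearW => n; apply: sumr_ge0 => k _.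
by rewrite h -mulrA mulr_ge0// -expr2 sqr_ge0.
Qed.

Hypothesis mu_oo : forall M, exists N, forall k, k \notin s N -> M <= mu k.

Section ground_state.
Variable T : V -> V.
Hypotheses (T_lin : forall a u w, T (a *: u + w) = a *: T u + T w).
Hypotheses (T_sym : forall u w, B (T u) w = B u (T w)) (T_ge0 : forall u, 0 <= B (T u) u).

Let T_scale a u : T (a *: u) = a *: T u.
Proof.
have := T_lin (-1) 0 0; rewrite scaler0 addr0 scaleN1r addNr => T0.
by have := T_lin a u 0; rewrite T0 !addr0.
Qed.

(** The quadratic form of the diagonal operator plus [T], evaluated on a pair
    of the graph so that it needs no operator domain. *)
Definition energy (p : V * V) := B p.2 p.1 + B (T p.1) p.1.

Lemma energy_lin t u z u' z' : graph u z -> graph u' z' ->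
  energy (t *: u' + u, t *: z' + z) =
  energy (u, z) + 2 * t * (B u z' + B u (T u')) + t ^+ 2 * energy (u', z').
Proof.
move=> h h'; rewrite /energy /= T_lin !(ipDl, ipDr, ipZl, ipZr).
rewrite (graph_sym h h') (ipC B z' u) (T_sym u u') (T_sym u' u) (ipC B u' (T u)).
by rewrite (T_sym u u'); ring.
Qed.

(** The direct method of the calculus of variations. By the parallelogram
    identity the difference of two near-minimisers has almost no excess energy
    above the infimum [E]; coercivity at the level [E + 1] then bounds its norm
    by finitely many of its coefficients, and these converge along a
    subsequence. So a minimising sequence converges. The energy itself is not
    passed to the limit: it is the Euler-Lagrange equation tested against each
    [e k] that is, and this equation is the graph condition for the limit. *)
Lemma ground_state (k0 : I) : exists u E,
  [/\ nsq B u = 1, graph u (E *: u - T u), 0 <= E &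
   forall w z, graph w z -> E * nsq B w <= energy (w, z)].
Proof.
pose D := [set p : V * V | graph p.1 p.2 /\ nsq B p.1 = 1].
pose S := energy @` D.
have energy_ge0 w z : graph w z -> 0 <= energy (w, z).
  by move=> h; rewrite addr_ge0// graph_ge0.
have hS : has_inf S.
  split; last by exists 0 => _ [[w z] [/= h _] <-]; exact: energy_ge0.
  exists (energy (e k0, mu k0 *: e k0)), (e k0, mu k0 *: e k0) => //.
  by split; [exact: graph_basis|rewrite /nsq eo eqxx].
pose E := inf S.
have E0 : 0 <= E.
  by apply: lb_le_inf; [case: hS|move=> _ [[w z] [/= h _] <-]; exact: energy_ge0].
have Emin w z : graph w z -> E * nsq B w <= energy (w, z).
  move=> h; have [w0|w0] := eqVneq (nsq B w) 0.
    by rewrite w0 mulr0 energy_ge0.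
  have wgt0 : 0 < nsq B w by rewrite lt_def w0 nsq_ge0.
  pose c := (Num.sqrt (nsq B w))^-1.
  have c2 : c ^+ 2 = (nsq B w)^-1 by rewrite exprVn sqr_sqrtr// ltW.
  have : E <= energy (c *: w, c *: z).
    apply: ge_inf; first by case: hS.
    exists (c *: w, c *: z) => //; split; last by rewrite nsqZ c2 mulVf.
    by move=> k; rewrite !ipZl h; ring.
  rewrite [X in _ <= X](_ : _ = energy (w, z) / nsq B w); first by rewrite ler_pdivlMr.
  by rewrite /energy/= T_scale !(ipZl, ipZr) !mulrA -expr2 c2; ring.
have /choice[p pP] (n : nat) : exists p, D p /\ energy p < E + n.+1%:R^-1.
  have [_ [p Dp <-] ?] := @inf_adherent _ S n.+1%:R^-1 ltac:(by []) hS.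
  by exists p.
pose c n := (p n).1; pose d n := (p n).2.
have gr n : graph (c n) (d n) by have [[]] := pP n.
have c1 n : nsq B (c n) = 1 by have [[]] := pP n.
have cE n : energy (c n, d n) < E + n.+1%:R^-1.
  by have [_] := pP n; rewrite /c /d; case: (p n).
have ck1 k n : `|B (c n) (e k)| <= 1.
  apply: normr_le_sqr => //; rewrite (le_trans (cauchy_schwarz _ _ _))//.
  by rewrite c1 /nsq eo eqxx mulr1 expr1n.
have [N hN] := mu_oo (E + 1).
have [f fi fc] := joint_subsequence (s N) ck1.
have small eps : 0 < eps -> \forall n \near \oo, energy (c (f n), d (f n)) < E + eps.
  move=> e0; near=> n; apply: lt_trans (cE _) _; rewrite ltrD2l.
  rewrite (@le_lt_trans _ _ n.+1%:R^-1)//.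
    by rewrite lef_pV2 ?posrE// ler_nat ltnS increasing_seq_ge.
  by near: n; exact: near_infty_natSinv_lt (PosNum e0).
have cau : cauchy_seq B (c \o f).
  move=> /= eps e0.
  pose a k n := B (c (f n)) (e k).
  pose G n := \sum_(k <- s N) 2 * (E + 1) * (a k n - limn (a k)) ^+ 2.
  have G0 : G @ \oo --> (0 : R).
    rewrite (_ : 0 = \sum_(k <- s N) 2 * (E + 1) * (0 : R) ^+ 2); last first.
      by rewrite big1// => k _; rewrite expr0n mulr0.
    rewrite /G; elim: (s N) fc => [|k r IH] fc.
      by under eq_fun do rewrite big_nil; rewrite big_nil; exact: cvg_cst.
    under eq_fun do rewrite big_cons; rewrite big_cons; apply: cvgD; last first.
      by apply: IH => l lr; apply: fc; rewrite inE lr orbT.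
    apply: cvgM; first exact: cvg_cst.
    rewrite expr2; under eq_fun do rewrite expr2.
    suff : a k n - limn (a k) @[n --> \oo] --> (0 : R) by move=> h; exact: cvgM.
    rewrite -(subrr (limn (a k))); apply: cvgB; last exact: cvg_cst.
    by apply: fc; rewrite inE eqxx.
  have [N1 _ hN1] : \forall n \near \oo, energy (c (f n), d (f n)) < E + eps / 8 /\
      G n < eps / 4.
    apply: filterI; first by apply: small; lra.
    by apply: (cvgr_lt 0 G0); lra.
  exists N1 => i j /hN1[/= Ei Gi] /hN1[/= Ej Gj].
  have h := graph_coercive hN (graph_lin (-1) (gr (f j)) (gr (f i))).
  have h1 := energy_lin (-1) (gr (f i)) (gr (f j)).
  have h2 := energy_lin 1 (gr (f i)) (gr (f j)).
  have h3 := Emin _ _ (graph_lin 1 (gr (f j)) (gr (f i))).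
  have := parallelogram B (c (f i)) (c (f j)); rewrite !c1.
  move: h h1 h2 h3; rewrite !scaleN1r !scale1r !(addrC (- c (f j))) !(addrC (- d (f j))) !(addrC (c (f j))) !(addrC (d (f j))).
  set w := c (f i) - c (f j); set z := d (f i) - d (f j) => h h1 h2 h3 h4.
  have : energy (w, z) = B z w + B (T w) w by [].
  have := T_ge0 w.
  have h5 : E * nsq B w + E * nsq B (c (f i) + c (f j)) = E * 4.
    by rewrite -mulrDr h4; ring.
  suff : \sum_(k <- s N) (E + 1 - mu k) * B w (e k) ^+ 2 <= G i + G j by lra.
  rewrite /G -big_split/=; apply: ler_sum => k _.
  rewrite {1}/w ipBl -!/(a k _); set y := a k _; set x := a k _; set l := limn _.
  have h5' : (x - y) ^+ 2 <= 2 * (x - l) ^+ 2 + 2 * (y - l) ^+ 2.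
    by have := sqr_ge0 (x + y - 2 * l); nra.
  have h6 := mu_ge0 k; have h7 := sqr_ge0 (x - y).
  by nra.
have [u cu] := cB cau.
exists u, E; split => //.
- apply: (cvg_unique _ (converges_nsq cu)) => //.
  by apply: cvg_near_cst; apply: nearW => n; exact: c1.
- move=> k.
  (* [2 * t * X u + t ^+ 2 * Y] is the excess energy of [u + t *: e k], to be
     shown nonnegative for all [t]; this forces [X u = 0]. *)
  pose X v := B v (mu k *: e k) + B v (T (e k)) - E * B v (e k).
  pose Y := energy (e k, mu k *: e k) - E * 1.
  have Y0 : 0 <= Y.
    by rewrite subr_ge0; have := Emin _ _ (graph_basis k); rewrite {1}/nsq eo eqxx.
  have Xc : X (c (f n)) @[n --> \oo] --> X u.
    apply: cvgB; last by apply: cvgM; [exact: cvg_cst|exact: (converges_ipl cu)].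
    by apply: cvgD; exact: (converges_ipl cu).
  have XY t : 0 <= 2 * t * X u + t ^+ 2 * Y.
    rewrite -[leRHS]add0r.
    apply/ler_addgt0Pr => eps e0; rewrite addrC addrA addr0.
    apply: (@cvgr_to_ge _ \oo _ _ (fun n => eps + (2 * t * X (c (f n)) + t ^+ 2 * Y))).
      apply: cvgD; first exact: cvg_cst.
      by apply: cvgD; [apply: cvgM => //|]; exact: cvg_cst.
    have := small _ e0; apply: filterS => n hn.
    have := Emin _ _ (graph_lin t (graph_basis k) (gr (f n))).
    rewrite (energy_lin t (gr _) (graph_basis k)).
    rewrite /nsq !(ipDl, ipDr, ipZl, ipZr) eo eqxx -/(nsq B _) c1 (ipC B (e k)) mulr1.
    by rewrite /X /Y ipZr; move: hn; lra.
  (* [Y + 1] instead of the optimal [Y], which may be 0 *)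
  have := XY (- X u / (Y + 1)).
  have Y1 : 0 < Y + 1 by lra.
  rewrite (_ : _ + _ = - (X u ^+ 2 * (Y + 2)) / (Y + 1) ^+ 2); last first.
    by field; rewrite gt_eqF.
  rewrite pmulr_lge0 ?invr_gt0 ?exprn_gt0// oppr_ge0 => h.
  have Y2 : 0 < Y + 2 by lra.
  have : X u == 0 by rewrite -sqrf_eq0 eq_le sqr_ge0 andbT -(pmulr_lle0 _ Y2).
  by rewrite /X ipBl !ipZl !ipZr T_sym => /eqP; lra.
Unshelve. all: by end_near. Qed.

Definition eigvec E u := graph u (E *: u - T u).

Lemma eigvec_ge0 E u : eigvec E u -> nsq B u != 0 -> 0 <= E.
Proof.
move=> h u0; have := graph_ge0 h; rewrite ipBl ipZl -/(nsq B u) => h1.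
have h2 := T_ge0 u; have h3 : 0 <= E * nsq B u by lra.
by rewrite -(pmulr_lge0 _ (_ : 0 < nsq B u))// lt_def u0 nsq_ge0.
Qed.

Lemma eigvec_sym E u E' u' : eigvec E u -> eigvec E' u' -> (E - E') * B u u' = 0.
Proof.
move=> h h'; have := graph_sym h h'.
by rewrite !ipBl !ipZl T_sym (ipC B u' u) (ipC B (T u') u); lra.
Qed.

(** Min-max from below: the span of two eigenvectors contains a vector
    orthogonal to [e k0], and on such vectors the form is at least [M]. *)
Lemma two_eigvec_ge M k0 E e0 u0 e1 u1 :
  (forall k, k != k0 -> M <= mu k) -> e0 <= E -> e1 <= E ->
  eigvec e0 u0 -> eigvec e1 u1 ->
  (forall a b, nsq B (a *: u0 + b *: u1) = 0 -> a = 0 /\ b = 0) -> M <= E.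
Proof.
move=> hM le0 le1 h0 h1 indep.
have [a [b [ab0 wk]]] : exists a b, ~ (a = 0 /\ b = 0) /\ B (a *: u0 + b *: u1) (e k0) = 0.
  have [y0|y0] := eqVneq (B u0 (e k0)) 0.
    exists 1, 0; split; first by case=> /eqP; rewrite oner_eq0.
    by rewrite scale0r addr0 scale1r.
  exists (B u1 (e k0)), (- B u0 (e k0)); split.
    by case=> _ /eqP; rewrite oppr_eq0 (negPf y0).
  by rewrite ipDl !ipZl; ring.
pose w := a *: u0 + b *: u1; pose z := a *: (e0 *: u0 - T u0) + b *: (e1 *: u1 - T u1).
have gw : graph w z.
  by move=> k; have := h0 k; have := h1 k; rewrite !(ipDl, ipZl, ipNl) => i1 i0; nra.
have w0 : 0 < nsq B w.
  by rewrite lt_def nsq_ge0 andbT; apply/eqP => /indep.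
have [N1 kN1] : exists N, k0 \in s N by case: se => _ _; exact.
have hN k : k \notin s N1 -> M <= mu k.
  by move=> kN; apply: hM; apply: contraNneq kN => ->.
have := graph_coercive hN gw.
have : \sum_(k <- s N1) (M - mu k) * B w (e k) ^+ 2 <= 0.
  apply: sumr_le0 => k _; have [->|kk0] := eqVneq k k0; first by rewrite wk expr0n mulr0.
  by rewrite mulr_le0_ge0 ?sqr_ge0// subr_le0 hM.
have Tw : T w = a *: T u0 + b *: T u1 by rewrite T_lin T_scale.
have zw : B z w = e0 * (a ^+ 2 * nsq B u0) + e1 * (b ^+ 2 * nsq B u1) +
    a * b * (e0 + e1) * B u0 u1 - B (T w) w.
  rewrite Tw /z /w /nsq !(ipDl, ipDr, ipZl, ipZr, ipNl, ipNr) (ipC B u1 u0); ring.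
have nw : nsq B w = a ^+ 2 * nsq B u0 + b ^+ 2 * nsq B u1 + 2 * a * b * B u0 u1.
  by rewrite /nsq /w !(ipDl, ipDr, ipZl, ipZr) (ipC B u1 u0); ring.
have h := eigvec_sym h0 h1; have Tw0 := T_ge0 w.
have key : B z w <= E * nsq B w.
  have n0 : 0 <= a ^+ 2 * nsq B u0 by rewrite mulr_ge0 ?sqr_ge0 ?nsq_ge0.
  have n1 : 0 <= b ^+ 2 * nsq B u1 by rewrite mulr_ge0 ?sqr_ge0 ?nsq_ge0.
  have [e01|e01] := eqVneq e0 e1.
    have : e1 * nsq B w <= E * nsq B w by rewrite ler_wpM2r// ltW.
    by move: Tw0; rewrite zw nw e01; lra.
  have u01 : B u0 u1 = 0.
    by apply/eqP; move/eqP: h; rewrite mulf_eq0 subr_eq0 (negPf e01).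
  have i0 := ler_wpM2r n0 le0; have i1 := ler_wpM2r n1 le1.
  by move: Tw0; rewrite zw nw u01; lra.
by move=> i1 i2; rewrite -(ler_pM2r w0); lra.
Qed.

End ground_state.

Section two_lowest.
Variable T : V -> V.
Hypotheses (T_lin : forall a u w, T (a *: u + w) = a *: T u + T w).
Hypotheses (T_sym : forall u w, B (T u) w = B u (T w)) (T_ge0 : forall u, 0 <= B (T u) u).

(** The second eigenvector is the ground state of [T] plus a multiple of the
    projection onto [u0]. The multiple lifts [u0] above [beta], which bounds the
    new lowest level through a trial vector orthogonal to [u0]; the new ground
    state is therefore orthogonal to [u0], where both operators agree. *)
Lemma two_eigvec (k0 k1 : I) : k0 != k1 -> exists u0 E0 u1 E1,
  [/\ nsq B u0 = 1, nsq B u1 = 1 & B u0 u1 = 0] /\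
  [/\ eigvec T E0 u0, eigvec T E1 u1, E0 <= mu k0 + B (T (e k0)) (e k0) &
   E1 <= mu k0 + mu k1 + 2 * B (T (e k0)) (e k0) + 2 * B (T (e k1)) (e k1)].
Proof.
move=> k01; have [u0 [E0 [n0 h0 E00 min0]]] := ground_state T_lin T_sym T_ge0 k0.
pose beta := mu k0 + mu k1 + 2 * B (T (e k0)) (e k0) + 2 * B (T (e k1)) (e k1).
have m0 := mu_ge0 k0; have m1 := mu_ge0 k1.
have t0 := T_ge0 (e k0); have t1 := T_ge0 (e k1).
have beta0 : 0 <= beta by rewrite /beta; lra.
pose T' u := T u + ((beta + 1) * B u u0) *: u0.
have T'_lin a u w : T' (a *: u + w) = a *: T' u + T' w.
  rewrite /T' T_lin ipPl mulrDr scalerDl scalerDr scalerA mulrCA !addrA; congr (_ + _).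
  by rewrite addrAC.
have T'_sym u w : B (T' u) w = B u (T' w).
  by rewrite /T' ipDl ipDr T_sym ipZl ipZr (ipC B u0 w); ring.
have T'_ge0 u : 0 <= B (T' u) u.
  rewrite /T' ipDl ipZl addr_ge0// (ipC B u0) -mulrA -expr2 mulr_ge0 ?sqr_ge0//; lra.
have [u1 [E1 [n1 h1 E10 min1]]] := ground_state T'_lin T'_sym T'_ge0 k0.
have E1b : E1 <= beta.
  (* a nonzero trial vector in the span of [e k0] and [e k1], orthogonal to [u0] *)
  have [a [b [ab wu]]] : exists a b : R, 0 < a ^+ 2 + b ^+ 2 /\
      B (a *: e k0 + b *: e k1) u0 = 0.
    have [y0|y0] := eqVneq (B (e k0) u0) 0.
      exists 1, 0; split; first by rewrite expr1n expr0n addr0.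
      by rewrite scale0r addr0 scale1r.
    exists (B (e k1) u0), (- B (e k0) u0); split.
      by rewrite sqrrN ltr_wpDl ?sqr_ge0// lt_def sqr_ge0 sqrf_eq0 y0.
    by rewrite ipDl !ipZl; ring.
  have gw : graph (a *: e k0 + b *: e k1) (a *: (mu k0 *: e k0) + b *: (mu k1 *: e k1)).
    move=> k; have := graph_basis k0 k; have := graph_basis k1 k.
    by rewrite !(ipDl, ipZl) => -> ->; ring.
  have := min1 _ _ gw.
  rewrite /energy/= {1}/T' wu mulr0 scale0r addr0.
  have o00 : B (e k0) (e k0) = 1 by rewrite eo eqxx.
  have o11 : B (e k1) (e k1) = 1 by rewrite eo eqxx.
  have o01 : B (e k0) (e k1) = 0 by rewrite eo (negPf k01).
  have o10 : B (e k1) (e k0) = 0 by rewrite ipC.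
  have -> : nsq B (a *: e k0 + b *: e k1) = a ^+ 2 + b ^+ 2.
    by rewrite /nsq !(ipDl, ipDr, ipZl, ipZr) o00 o01 o10 o11; ring.
  have -> : B (a *: (mu k0 *: e k0) + b *: (mu k1 *: e k1)) (a *: e k0 + b *: e k1) =
      a ^+ 2 * mu k0 + b ^+ 2 * mu k1.
    by rewrite /nsq !(ipDl, ipDr, ipZl, ipZr) o00 o01 o10 o11; ring.
  have Tc c k : T (c *: e k) = c *: T (e k).
    have := T_lin (-1) 0 0; rewrite scaler0 addr0 scaleN1r addNr => T0.
    by have := T_lin c (e k) 0; rewrite T0 !addr0.
  have hT : B (T (a *: e k0 + b *: e k1)) (a *: e k0 + b *: e k1) <=
      2 * a ^+ 2 * B (T (e k0)) (e k0) + 2 * b ^+ 2 * B (T (e k1)) (e k1).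
    have := T_ge0 (a *: e k0 + (- b) *: e k1).
    rewrite !T_lin !Tc !(ipDl, ipDr, ipZl, ipZr); lra.
  move=> h; rewrite -(ler_pM2r ab).
  apply: (le_trans h); rewrite /beta.
  have := sqr_ge0 a; have := sqr_ge0 b; move: hT m0 m1 t0 t1.
  set A := a ^+ 2; set C := b ^+ 2; set x := B (T (e k0)) _; set y := B (T (e k1)) _.
  set X := B _ _ => hT m0 m1 t0 t1 A0 C0; nra.
have u01 : B u0 u1 = 0.
  have := graph_sym h0 h1; rewrite !ipBl !ipDl !ipZl T_sym -/(nsq B u0) n0.
  rewrite (ipC B u1 u0) (ipC B u0 (T u1)) => h.
  have : (E0 - E1 + (beta + 1)) * B u0 u1 = 0 by lra.
  by move/eqP; rewrite mulf_eq0 gt_eqF//=; [move/eqP|lra].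
exists u0, E0, u1, E1; split=> //; split => //.
- by move: h1; rewrite /T' (ipC B u1) u01 mulr0 scale0r addr0.
- have := min0 _ _ (graph_basis k0).
  by rewrite /energy/= ipZl /nsq !eo !eqxx !mulr1.
Qed.

End two_lowest.
End diagonal_operator.

(** * The space of square integrable functions *)

Lemma eq_cvgn (U : topologicalType) (f g : nat -> U) (l : U) :
  f =1 g -> f @ \oo --> l -> g @ \oo --> l.
Proof. by move/funext->. Qed.

Lemma measurable_limit d (T : measurableType d) (R : realType)
    (f : nat -> T -> R) (g : T -> R) :
  (forall n, measurable_fun setT (f n)) -> (forall x, f n x @[n --> \oo] --> g x) ->
  measurable_fun setT g.
Proof.
move=> mf fg; apply/measurable_EFinP.
apply: (@emeasurable_fun_cvg _ _ _ _ (fun n => EFin \o f n)).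
  by move=> n; apply/measurable_EFinP; exact: mf.
by move=> x _; apply: cvg_EFin; [exact: nearW|exact: fg].
Qed.

Section L2_inner.
Context d (T : measurableType d) (R : realType) (mu : {measure set T -> \bar R}).
Local Notation L2 := (LfunType mu (lee1n 2)).
Implicit Types u w : L2.

Lemma L2_integrableM (f g : T -> R) : f \in Lfun mu 2%:E -> g \in Lfun mu 2%:E ->
  mu.-integrable setT (EFin \o (fun x => f x * g x)).
Proof. by move=> fL gL; apply/Lfun1_integrable; exact: Lfun2_mul_Lfun1. Qed.

Definition L2_ip u w : R := \int[mu]_x (u x * w x).

Lemma L2_integrable u w : mu.-integrable setT (EFin \o (fun x => u x * w x)).
Proof. by apply: L2_integrableM; exact: LfunP. Qed.

Lemma L2_ipC u w : L2_ip u w = L2_ip w u.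
Proof. by apply: eq_Rintegral => x _; rewrite mulrC. Qed.

Lemma L2_ipPl a u1 u2 w : L2_ip (a *: u1 + u2) w = a * L2_ip u1 w + L2_ip u2 w.
Proof.
have i1 := L2_integrable u1 w; have i2 := L2_integrable u2 w.
rewrite /L2_ip -RintegralZl// -RintegralD//; last first.
  by have := integrableZl measurableT a i1.
by apply: eq_Rintegral => x _ /=; rewrite mulrDl mulrA.
Qed.

Lemma L2_ip_ge0 u : 0 <= L2_ip u u.
Proof. by apply: Rintegral_ge0 => x _; rewrite -expr2 sqr_ge0. Qed.

Definition L2_inner := SemiInner L2_ipC L2_ipPl L2_ip_ge0.

Lemma L2_measurable u : measurable_fun setT (u : T -> R).
Proof. by have := LfunP u; rewrite inE => /andP[]; rewrite inE. Qed.

Lemma L2_nsqE u : (nsq L2_inner u)%:E = (\int[mu]_x ((u x) ^+ 2)%:E)%E.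
Proof.
rewrite /nsq /= /L2_ip /Rintegral fineK; last first.
  exact: (integrable_fin_num measurableT (L2_integrable u u)).
by apply: eq_integral => x _; rewrite expr2.
Qed.

Lemma L2_nsq_eq0 u : nsq L2_inner u = 0 <-> {ae mu, forall x, u x = 0}.
Proof.
have mu2 : measurable_fun setT (EFin \o (fun x => u x ^+ 2)).
  by apply/measurable_EFinP; apply: measurable_funX; exact: L2_measurable.
have e : (\int[mu]_x `|(EFin \o (fun y : T => (u y ^+ 2)%R)) x|)%E = (nsq L2_inner u)%:E.
  by rewrite L2_nsqE; apply: eq_integral => x _ /=; rewrite ger0_norm ?sqr_ge0.
have [h1 h2] := ae_eq_integral_abs mu measurableT mu2.
split.
  move=> u0; rewrite e u0 in h1; have := h1 erefl.
  by apply: filterS => x /(_ I)/= [] /eqP; rewrite sqrf_eq0 => /eqP.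
move=> u0; apply: EFin_inj; rewrite -e; apply: h2.
by apply: filterS u0 => x u0 _ /=; rewrite u0 expr0n.
Qed.

Lemma Lfun2P (f : T -> R) : measurable_fun setT f ->
  (\int[mu]_x ((f x) ^+ 2)%:E < +oo)%E -> f \in Lfun mu 2%:E.
Proof.
move=> mf fi; rewrite inE; apply/andP; split; rewrite inE//=.
rewrite /finite_norm unlock /Lnorm poweR_lty//.
rewrite (eq_integral (fun x => ((f x) ^+ 2)%:E))// => x _ /=.
by rewrite powR_mulrn// real_normK ?num_real.
Qed.

(** Riesz-Fischer. Along a subsequence the increments [g k] satisfy
    [nsq (g k) < 8 ^- k], so the sum [G] of the [4 ^+ k * g k ^+ 2] is
    integrable, hence finite almost everywhere; where it is finite the [g k] are
    [O(2 ^- k)] and the subsequence converges. Fatou's lemma shows that the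
    pointwise limit is also the limit in norm. *)
Lemma L2_complete : hilbert L2_inner.
Proof.
move=> u cu.
have /choice[N hN] : forall k, exists Nk, forall m n, (Nk <= m)%N -> (Nk <= n)%N ->
    nsq L2_inner (u m - u n) < (8^-1) ^+ k.
  by move=> k; apply: cu; rewrite exprn_gt0.
pose f k := (k + \max_(i < k.+1) N i)%N.
have Nf i k : (i <= k)%N -> (N i <= f k)%N.
  by move=> ik; apply: leq_trans (leq_addl _ _); exact: (@leq_bigmax _ (fun i : 'I_k.+1 => N i) (Ordinal (ik : (i < k.+1)%N))).
pose g k : L2 := u (f k.+1) - u (f k).
have gk k : nsq L2_inner (g k) < (8^-1) ^+ k by apply: hN; exact: Nf.
pose G x : \bar R := (\sum_(0 <= k <oo) (4 ^+ k * (g k x) ^+ 2)%:E)%E.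
have mg k : measurable_fun setT (fun x => (4 ^+ k * (g k x) ^+ 2)%:E).
  apply/measurable_EFinP; apply: measurable_funM => //.
  by apply: measurable_funX; exact: L2_measurable.
have mG : measurable_fun setT G.
  apply: ge0_emeasurable_sum => [k x _ _|k _]; last exact: mg.
  by rewrite lee_fin mulr_ge0 ?sqr_ge0 ?exprn_ge0.
have iG : mu.-integrable setT G.
  apply/integrableP; split => //.
  rewrite (eq_integral G); last first.
    by move=> x _; rewrite gee0_abs// nneseries_ge0// => k _ _; rewrite lee_fin mulr_ge0 ?sqr_ge0 ?exprn_ge0.
  rewrite integral_nneseries//; last first.
    by move=> k x _; rewrite lee_fin mulr_ge0 ?sqr_ge0 ?exprn_ge0.
  apply: (@le_lt_trans _ _ (\sum_(0 <= k <oo) (1 / (2 ^ (k + 1))%:R * 2)%:E)%E).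
    apply: lee_nneseries => [k _ _|k _].
      by apply: integral_ge0 => x _; rewrite lee_fin mulr_ge0 ?sqr_ge0 ?exprn_ge0.
    under eq_integral do rewrite EFinM.
    rewrite ge0_integralZl//=; last 2 first.
    - apply/measurable_EFinP; apply: measurable_funX; exact: (L2_measurable (g k)).
    - by move=> x _; rewrite lee_fin sqr_ge0.
    rewrite (_ : (\int[mu]_x _)%E = (nsq L2_inner (g k))%:E); last by rewrite L2_nsqE.
    rewrite -EFinM lee_fin.
    rewrite (@le_trans _ _ (4 ^+ k * 8^-1 ^+ k))//.
      by rewrite ler_wpM2l ?exprn_ge0// ltW.
    rewrite -exprMn natrX addn1 exprS invfM mulrA div1r (mulrC 2^-1) -mulrA mulVf ?pnatr_eq0// mulr1.
    by rewrite -exprVn (_ : 4 * 8^-1 = 2^-1)//; field.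
  rewrite (_ : (\sum_(0 <= k <oo) _)%E = 2%:E); first exact: ltry.
  apply/cvg_lim => //.
  have := @cvg_geometric_eseries_half R 2 0; rewrite expr0 divr1.
  apply: cvg_trans; apply: near_eq_cvg; apply: nearW => n.
  rewrite /eseries/=; apply: eq_bigr => k _; congr EFin.
  by rewrite div1r mulrC.
have aeG := integrable_ae measurableT iG.
pose D := [set x | G x \is a fin_num].
have mD : measurable D.
  have -> : D = [set: T] `&` [set x | G x \is a fin_num] by rewrite setTI.
  exact: emeasurable_fin_num.
pose h k x : R := \1_D x * u (f k) x.
have mh k : measurable_fun setT (h k).
  apply: measurable_funM; first exact: measurable_indic.
  exact: L2_measurable.
have ch x : cvgn (h ^~ x).
  have [Dx|Dx] := pselect (D x); last first.
    have -> : h ^~ x = (fun=> 0) by apply/funext => k; rewrite /h indicE memNset// mul0r.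
    exact: is_cvg_cst.
  have -> : h ^~ x = (fun k => u (f k) x) by apply/funext => k; rewrite /h indicE mem_set// mul1r.
  have G0 : (0 <= G x)%E.
    by apply: nneseries_ge0 => k _ _; rewrite lee_fin mulr_ge0 ?sqr_ge0 ?exprn_ge0.
  have gG k : `|g k x| <= Num.sqrt (fine (G x)) * 2^-1 ^+ k.
    apply: normr_le_sqr; first by rewrite mulr_ge0 ?sqrtr_ge0 ?exprn_ge0.
    rewrite exprMn sqr_sqrtr ?fine_ge0// -exprM mulnC exprM.
    rewrite (_ : 2^-1 ^+ 2 = 4^-1 :> R); last by field.
    rewrite exprVn ler_pdivlMr ?exprn_gt0// mulrC.
    rewrite -lee_fin fineK// (le_trans _ (nneseries_lim_ge k.+1 _))//; last first.
      by move=> i _ _; rewrite lee_fin mulr_ge0 ?sqr_ge0 ?exprn_ge0.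
    rewrite big_nat_recr//= leeDr// sume_ge0// => i _.
    by rewrite lee_fin mulr_ge0 ?sqr_ge0 ?exprn_ge0.
  have ct : cvgn (series (telescope (fun k => u (f k) x))).
    apply: normed_cvg; apply: (@series_le_cvg _ _ (geometric (Num.sqrt (fine (G x))) 2^-1)).
    - by move=> k; exact: normr_ge0.
    - by move=> k; rewrite mulr_ge0 ?sqrtr_ge0 ?exprn_ge0.
    - by move=> k; exact: gG.
    - by apply: is_cvg_geometric_series; rewrite ger0_norm// invf_lt1 ?ltr1n.
  rewrite (_ : (fun k => _) = (fun k => u (f 0%N) x + series (telescope (fun k => u (f k) x)) k)).
    by apply: is_cvgD => //; exact: is_cvg_cst.
  by apply/funext => k; rewrite -eq_sum_telescope.
pose l x := limn (h ^~ x).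
have hl x : h ^~ x @ \oo --> l x by exact: ch.
have ml : measurable_fun setT l by exact: measurable_limit mh hl.
(* Fatou along the subsequence: the limit is as close to [u n] as its terms *)
have key n eps : 0 < eps -> (forall m, (n <= m)%N -> nsq L2_inner (u n - u m) < eps) ->
    (\int[mu]_x ((u n x - l x) ^+ 2)%:E <= eps%:E)%E.
  move=> eps0 hn.
  pose F k x := ((u n x - h (k + n)%N x) ^+ 2)%:E.
  have Fl x : F ^~ x @ \oo --> ((u n x - l x) ^+ 2)%:E.
    apply: cvg_EFin; first exact: nearW.
    have c : u n x - h (k + n)%N x @[k --> \oo] --> u n x - l x.
      by apply: cvgB; [exact: cvg_cst|rewrite (cvg_shiftn n (h ^~ x))].
    by rewrite expr2; apply: (eq_cvgn _ (cvgM c c)) => k; rewrite /F /= expr2.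
  have -> : (\int[mu]_x ((u n x - l x) ^+ 2)%:E = \int[mu]_x limn_einf (F ^~ x))%E.
    apply: eq_integral => x _; rewrite is_cvg_limn_einfE; last by apply/cvg_ex; eexists; exact: Fl.
    by rewrite (cvg_lim _ (Fl x)).
  apply: le_trans (fatou _ _ _ _) _ => //.
  - move=> k; apply/measurable_EFinP; apply: measurable_funX.
    by apply: measurable_funB; [exact: L2_measurable|exact: mh].
  - by move=> k x _; rewrite lee_fin sqr_ge0.
  rewrite limn_einf_lim; apply: lime_le; first exact: is_cvg_einfs.
  apply: nearW => k; apply: ereal_inf_le; exists (\int[mu]_x F k x)%E; first by exists k => /=.
  rewrite (ae_eq_integral (fun x => ((u n - u (f (k + n)%N)) x ^+ 2)%:E))//.
  - rewrite -L2_nsqE lee_fin ltW// hn// /f -addnA addnCA; exact: leq_addr.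
  - apply/measurable_EFinP; apply: measurable_funX.
    by apply: measurable_funB; [exact: L2_measurable|exact: mh].
  - by apply/measurable_EFinP; apply: measurable_funX; exact: (L2_measurable (u n - u (f (k + n)%N))).
  - apply: filterS aeG => x /(_ I) Dx _.
    by rewrite /F /h indicE mem_set// mul1r.
have key' eps : 0 < eps -> exists n0, forall n, (n0 <= n)%N ->
    (\int[mu]_x ((u n x - l x) ^+ 2)%:E <= eps%:E)%E.
  move=> eps0; have [n0 hn0] := cu _ eps0; exists n0 => n n0n.
  by apply: key => // m nm; apply: hn0 => //; exact: leq_trans nm.
have ldiff : exists n, (fun x => u n x - l x) \in Lfun mu 2%:E.
  have [n0 /(_ _ (leqnn _)) h1] := key' 1 ltr01.
  exists n0; apply: Lfun2P; last by rewrite (le_lt_trans h1)// ltry.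
  by apply: measurable_funB => //; exact: L2_measurable.
have lL : l \in Lfun mu 2%:E.
  have [n hn] := ldiff.
  have -> : l = (u n - Lfun_Sub (lee1n 2) hn : L2) :> (T -> R).
    by apply/funext => x /=; rewrite !fctE /= opprB addrCA subrr addr0.
  exact: LfunP.
exists (Lfun_Sub (lee1n 2) lL); apply/convergesP => eps eps0.
have e2 : 0 < eps / 2 by rewrite divr_gt0.
have [n0 hn0] := key' _ e2; exists n0 => // n /hn0 h1.
apply: (@le_lt_trans _ _ (eps / 2)); last by lra.
by rewrite -lee_fin L2_nsqE.
Qed.

End L2_inner.

(** * Integration over boxes *)

Section continuity_rV.
Context {R : realType} {n : nat}.

Lemma cvg_rV (T : Type) (F : set_system T) (FF : Filter F) (y : T -> 'rV[R]_n) (x : 'rV[R]_n) :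
  (forall i, y t ord0 i @[t --> F] --> x ord0 i) -> y @ F --> x.
Proof.
move=> h; apply/cvg_ballP => e e0.
have : \forall t \near F, forall i : 'I_n, ball (x ord0 i) e (y t ord0 i).
  by apply: filter_forall => i; have /cvg_ballP := h i; exact.
by apply: filterS => t ht; split => // i j; rewrite !ord1.
Qed.

(** The sigma-algebra on row vectors is generated by the coordinates, so this
    is not immediate. The value of [f] at the grid point of mesh [1/(k+1)] just
    below [x] depends measurably on [x], as the grid is countable, and tends to
    [f x]. *)
Lemma continuous_measurable (f : 'rV[R]_n -> R) :
  continuous f -> measurable_fun setT f.
Proof.
move=> cf; pose g (k : nat) (z : 'rV[int]_n) : 'rV[R]_n := \row_i ((z ord0 i)%:~R / k.+1%:R).
pose fl (k : nat) (x : 'rV[R]_n) : 'rV[int]_n := \row_i Num.floor (k.+1%:R * x ord0 i).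
apply: (@measurable_limit _ _ _ (fun k x => f (g k (fl k x)))) => [k _ Y mY|x].
  rewrite setTI; set A := (X in measurable X).
  have -> : A = \bigcup_(z in [set: 'rV[int]_n])
      (if `[< Y (f (g k z)) >] then [set x | fl k x = z] else set0).
    apply/seteqP; split=> [x Yx|x [z _]].
      by exists (fl k x) => //; rewrite asboolT.
    by case: asboolP => // Yz /= xz; rewrite /A /= xz.
  apply: countable_bigcupT_measurable => [|z]; first exact: countableP.
  case: asboolP => _ //.
  have -> : [set x | fl k x = z] = \bigcap_(i in [set: 'I_n])
      ((fun x : 'rV[R]_n => x ord0 i) @^-1`
        `[((z ord0 i)%:~R / k.+1%:R), ((z ord0 i + 1)%:~R / k.+1%:R)[%classic).
    have k0 : (0 : R) < k.+1%:R by [].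
    have e (x : 'rV[R]_n) i : ((z ord0 i)%:~R / k.+1%:R <= x ord0 i < (z ord0 i + 1)%:~R / k.+1%:R) =
        (Num.floor (k.+1%:R * x ord0 i) == z ord0 i).
      by rewrite ler_pdivrMr// ltr_pdivlMr// mulrC floor_eq// num_real.
    apply/seteqP; split => [x /= xz i _ /=|x h].
      by rewrite in_itv/= e -xz mxE.
    apply/rowP => i; rewrite mxE; apply/eqP; rewrite -e.
    by have := h i I; rewrite /= in_itv.
  apply: fin_bigcap_measurable => // i _; rewrite -[X in measurable X]setTI.
  exact: (@measurable_coord _ R n i).
have : g k (fl k x) @[k --> \oo] --> x.
  apply: cvg_rV => i.
  have inv0 : x ord0 i - k.+1%:R^-1 @[k --> \oo] --> x ord0 i.
    rewrite -[X in _ --> X]subr0; apply: cvgB; first exact: cvg_cst.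
    exact: cvg_harmonic.
  apply: (squeeze_cvgr _ inv0 (cvg_cst _)).
  apply: nearW => k; rewrite !mxE.
  have k0 : (0 : R) < k.+1%:R by [].
  have := floor_itv (k.+1%:R * x ord0 i); rewrite intrD => /andP[h1 h2].
  rewrite ler_pdivlMr// ler_pdivrMr// mulrBl mulVf// mulrC h1 andbT; lra.
by move=> h; apply: (cvg_comp (fun k => g k (fl k x)) f h); exact: cf.
Qed.
End continuity_rV.

(** The measure is the sum of its restrictions to [D] and to the complement
    of [D], and the latter does not see [D]. *)
Lemma integral_mrestr d (T : measurableType d) (R : realType)
    (mu : {measure set T -> \bar R}) (D : set T) (mD : measurable D) (f : T -> \bar R) :
  measurable_fun setT f ->
  (\int[mrestr mu mD]_x f x = \int[mu]_(x in D) f x)%E.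
Proof.
pose mD' := measurableC mD.
have ge0 (g : T -> \bar R) : measurable_fun setT g -> (forall x, 0 <= g x)%E ->
    (\int[mrestr mu mD]_x g x = \int[mu]_(x in D) g x)%E.
  move=> mg g0; rewrite [RHS]integral_mkcond.
  have mgD : measurable_fun setT (g \_ D).
    by apply/(measurable_restrictT _ mD); exact: measurable_funTS.
  have gD0 x : (0 <= (g \_ D) x)%E by rewrite patchE; case: ifP.
  rewrite (eq_measure_integral (measure_add (mrestr mu mD) (mrestr mu mD'))); last first.
    move=> A mA _; rewrite [RHS](measure_addE [the measure _ _ of mrestr mu mD]
      [the measure _ _ of mrestr mu mD'] A).
    transitivity (mu (A `&` D) + mu (A `&` ~` D))%E => //.
    by rewrite addeC -setDE -measureDI.
  rewrite ge0_integral_measure_add// [X in (_ + X)%E](_ : _ = 0%E) ?adde0.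
    apply: ge0_ae_eq_integral => //.
    exists (~` D); split => //; first by rewrite /= /mrestr setICl measure0.
    by move=> x /=; apply: contra_not => Dx _; rewrite patchE mem_set.
  transitivity (\int[mrestr mu mD']_x (cst 0%E x))%E; last by rewrite integral0.
  apply: ge0_ae_eq_integral => //.
  exists D; split => //; first by rewrite /= /mrestr setICr measure0.
  by move=> x /=; apply: contra_notP => nDx _; rewrite patchE memNset.
move=> mf; rewrite [LHS]integralE [RHS]integralE.
by rewrite !ge0//; [exact: measurable_funeneg|exact: measurable_funepos].
Qed.

Section box_integral.
Context {R : realType} (L : R).

Definition side : set R := `](- (L / 2)), (L / 2)[%classic.

Lemma box_measureT n : box_measure (d := n) L setT =
  (\prod_(i < n) @lebesgue_measure R side)%E.
Proof.
transitivity (lebesgue_rV n [set x : 'rV[R]_n | forall i, side (x ord0 i)]).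
  rewrite /box_measure /= /mrestr setTI; apply: (congr1 (lebesgue_rV n)).
  by apply/seteqP; split => x h i; have := h i; rewrite /side /= in_itv.
by apply: (lebesgue_rV_prod (A := fun=> side)) => i; exact: measurable_itv.
Qed.

Hypothesis L0 : 0 < L.

Lemma lebesgue_side : @lebesgue_measure R side = L%:E.
Proof.
have h : - (L / 2) < L / 2 by move: L0; lra.
rewrite /side lebesgue_measure_itv/= lte_fin h -EFinB; congr EFin; move: L0; lra.
Qed.

Lemma box_measure_lty n : (box_measure (d := n) L setT < +oo)%E.
Proof.
rewrite box_measureT lebesgue_side.
by rewrite prodEFin ltry.
Qed.

Lemma box_bounded_integrable n (f : 'rV[R]_n -> R) M : measurable_fun setT f ->
  (forall x, `|f x| <= M) -> (box_measure L).-integrable setT (EFin \o f).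
Proof.
move=> mf fM; apply: measurable_bounded_integrable => //; first exact: box_measure_lty.
by exists M; split; [exact: num_real|move=> x Mx y _ /=; rewrite (le_trans (fM y))// ltW].
Qed.

Lemma measurable_consrV n :
  measurable_fun [set: measurableTypeR R * 'rV[R]_n] (@consrV R n).
Proof.
apply/measurable_fun_coordP => i; case: (unliftP ord0 i) => [j ->|->].
  under eq_fun do rewrite consrVS.
  exact: (measurableT_comp (measurable_coord j) measurable_snd).
by under eq_fun do rewrite consrV0; exact: measurable_fst.
Qed.

Lemma measurable_slice n (t : R) :
  measurable_fun [set: 'rV[R]_n] (fun y => consrV (t, y)).
Proof.
apply/measurable_fun_coordP => i; case: (unliftP ord0 i) => [j ->|->].
  by under eq_fun do rewrite consrVS; exact: measurable_coord.
by under eq_fun do rewrite consrV0; exact: measurable_cst.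
Qed.

Lemma box_consrV n t (y : 'rV[R]_n) : box L (consrV (t, y)) <-> side t /\ box L y.
Proof.
split=> [h|[h1 h2] i].
  split; first by have := h ord0; rewrite consrV0 /side /= in_itv.
  by move=> i; have := h (lift ord0 i); rewrite consrVS.
case: (unliftP ord0 i) => [j ->|->]; first by rewrite consrVS; exact: h2.
by rewrite consrV0; move: h1; rewrite /side /= in_itv.
Qed.

Section box_fubini.
Context (n : nat) (f : 'rV[R]_n.+1 -> R) (M : R).
Hypotheses (mf : measurable_fun setT f) (fM : forall x, `|f x| <= M).

Let h := (EFin \o f) \_ (box L).

Let mh : measurable_fun setT h.
Proof.
apply/(measurable_restrictT _ (measurable_box _)).
by apply: measurable_funTS; exact/measurable_EFinP.
Qed.

Let mhc : measurable_fun [set: measurableTypeR R * 'rV[R]_n] (h \o @consrV R n).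
Proof. by apply: measurableT_comp => //; exact: measurable_consrV. Qed.

Let hE t y : h (consrV (t, y)) =
  ((fun t => ((EFin \o (fun y => f (consrV (t, y)))) \_ (box L)) y) \_ side) t.
Proof.
rewrite /h !patchE; case: ifPn => [/set_mem/box_consrV[h1 h2]|].
  by rewrite !mem_set.
move/negP => nb; case: ifPn => // /set_mem st; case: ifPn => // /set_mem yb.
by exfalso; apply: nb; apply/mem_set/box_consrV.
Qed.

Let ih : (@lebesgue_measure R \x lebesgue_rV n)%E.-integrable setT (h \o @consrV R n).
Proof.
apply/integrableP; split => //.
have := box_bounded_integrable mf fM => /integrableP[_].
rewrite integral_mrestr; last by do 2 apply: measurableT_comp => //.
rewrite integral_mkcond; apply: le_lt_trans.
have -> : (fun x : 'rV[R]_n.+1 => `|(EFin \o f) x|%E) \_ (box L) = abse \o h.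
  by rewrite /h restrict_abse.
rewrite /= (ge0_integral_pushforward (@measurable_consrV n))//.
by apply: measurableT_comp.
Qed.

Let boxE : (\int[box_measure L]_x (f x)%:E =
  \int[(@lebesgue_measure R \x lebesgue_rV n)]_z (h \o @consrV R n) z)%E.
Proof.
rewrite integral_mrestr; last exact/measurable_EFinP.
rewrite integral_mkcond -/h /= (integral_pushforward (@measurable_consrV n))//.
Qed.

Lemma box_fubini12 : (\int[box_measure L]_x (f x)%:E =
  \int[@lebesgue_measure R]_(t in side) \int[box_measure L]_y (f (consrV (t, y)))%:E)%E.
Proof.
rewrite boxE -(integral12_prod_meas1 ih) [RHS]integral_mkcond.
apply: eq_integral => t _; rewrite /fubini_F /= patchE.
under eq_integral do rewrite hE.
case: ifPn => st.
  under eq_integral do rewrite patchE st.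
  rewrite -integral_mkcond integral_mrestr//.
  apply/measurable_EFinP; apply: measurableT_comp => //.
  exact: measurable_slice.
by under eq_integral do rewrite patchE (negPf st); rewrite integral0.
Qed.

Lemma box_fubini21 : (\int[box_measure L]_x (f x)%:E =
  \int[lebesgue_rV n]_(y in box L)
    \int[@lebesgue_measure R]_(t in side) (f (consrV (t, y)))%:E)%E.
Proof.
rewrite boxE -(integral21_prod_meas1 ih) [RHS]integral_mkcond.
apply: eq_integral => y _; rewrite /fubini_G /= patchE.
under eq_integral do rewrite hE.
rewrite -integral_mkcond; case: ifPn => yb.
  by under eq_integral do rewrite patchE yb.
by under eq_integral do rewrite patchE (negPf yb); rewrite integral0.
Qed.

End box_fubini.

(** Fubini, peeling off the first coordinate. *)
Lemma box_integral_prod n (f : 'I_n -> R -> R) :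
  (forall i, measurable_fun setT (f i)) -> (forall i t, `|f i t| <= 1) ->
  (\int[box_measure L]_x (\prod_(i < n) f i (x ord0 i)) =
   \prod_(i < n) \int[@lebesgue_measure R]_(t in side) f i t)%R.
Proof.
elim: n f => [|n IH] f mf f1.
  rewrite big_ord0; under eq_Rintegral do rewrite big_ord0.
  rewrite Rintegral_cst// mul1r.
  have -> : box_measure L [set: 'rV[R]_0] = 1%E; last by [].
  by rewrite box_measureT big_ord0.
pose P (y : 'rV[R]_n) := \prod_(i < n) f (lift ord0 i) (y ord0 i).
have mP m (g : 'I_m -> R -> R) : (forall i, measurable_fun setT (g i)) ->
    measurable_fun [set: 'rV[R]_m] (fun y => \prod_(i < m) g i (y ord0 i)).
  move=> mg; apply: measurable_prod => i _.
  exact: (measurableT_comp (mg i) (measurable_coord i)).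
have P1 m (g : 'I_m -> R -> R) : (forall i t, `|g i t| <= 1) ->
    forall y : 'rV[R]_m, `|\prod_(i < m) g i (y ord0 i)| <= 1.
  move=> g1 y; rewrite normr_prod.
  suff /andP[] : 0 <= \prod_(i < m) `|g i (y ord0 i)| <= 1 by [].
  elim/big_ind : _ => [|a b /andP[a0 a1] /andP[b0 b1]|i _].
  - by rewrite ler01 lexx.
  - by rewrite mulr_ge0// mulr_ile1.
  - by rewrite normr_ge0 g1.
have iP := box_bounded_integrable (mP _ _ (fun i => mf (lift ord0 i))) (P1 _ _ (fun i => f1 (lift ord0 i))).
rewrite /Rintegral (box_fubini12 (mP _ _ mf) (P1 _ _ f1)) big_ord_recl -IH => [|i|i t]; last 2 first.
- exact: mf.
- exact: f1.
rewrite -/(Rintegral _ _ _).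
transitivity (\int[@lebesgue_measure R]_(t in side) (f ord0 t * \int[box_measure L]_y P y)).
  congr fine; apply: eq_integral => t _.
  transitivity (\int[box_measure L]_y ((f ord0 t)%:E * (EFin \o P) y))%E.
    apply: eq_integral => y _; rewrite big_ord_recl consrV0 EFinM /=.
    by congr (_ * EFin _)%E; apply: eq_bigr => i _; rewrite consrVS.
  rewrite integralZl// EFinM /Rintegral fineK//.
  exact: integrable_fin_num.
rewrite RintegralZr//; first exact: measurable_itv.
apply: measurable_bounded_integrable => //.
- exact: measurable_itv.
- by rewrite [X in (X < _)%E](_ : _ = L%:E); [exact: ltry|exact: lebesgue_side].
- by apply: measurable_funTS; exact: mf.
- exists 1; split; first exact: num_real.
  by move=> x x1 t _ /=; rewrite (le_trans (f1 _ _))// ltW.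
Qed.

End box_integral.

(** * Smooth functions on the line *)

Section smooth_1d.
Context {R : realType}.
Implicit Types f g h : R -> R.

Definition has_derivative f g := forall x : R, is_derive x 1 f (g x).

Fixpoint derivable_n (n : nat) f : Prop :=
  if n is m.+1 then exists2 g, has_derivative f g & derivable_n m g else True.

Definition smooth1 f := forall n, derivable_n n f.

Lemma has_derivative_continuous f g : has_derivative f g -> continuous f.
Proof.
by move=> fg x; apply: differentiable_continuous; apply/derivable1_diffP; case: (fg x).
Qed.

Lemma has_derivative_unique f g h : has_derivative f g -> has_derivative f h -> g = h.
Proof.
by move=> fg fh; apply/funext => x; have [_ <-] := fg x; have [_ <-] := fh x.
Qed.

Lemma smooth1_derivative f : smooth1 f -> exists2 g, has_derivative f g & smooth1 g.
Proof.
move=> sf; have [g fg _] := sf 1%N; exists g => // n.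
by have [h fh hn] := sf n.+1; rewrite (has_derivative_unique fg fh).
Qed.

Lemma smooth1_continuous f : smooth1 f -> continuous f.
Proof. by move=> /(_ 1%N)[g fg _]; exact: has_derivative_continuous fg. Qed.

Lemma has_derivativeD f f' g g' : has_derivative f f' -> has_derivative g g' ->
  has_derivative (fun x => f x + g x) (fun x => f' x + g' x).
Proof. by move=> hf hg x; have := hf x; have := hg x => ? ?; exact: is_deriveD. Qed.

Lemma has_derivativeM f f' g g' : has_derivative f f' -> has_derivative g g' ->
  has_derivative (fun x => f x * g x) (fun x => f' x * g x + f x * g' x).
Proof.
move=> hf hg x; apply: (is_derive_eq (is_deriveM (hf x) (hg x))).
by rewrite /GRing.scale/= addrC mulrC.
Qed.

Lemma has_derivative_comp f f' g g' : has_derivative f f' -> has_derivative g g' ->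
  has_derivative (fun x => f (g x)) (fun x => f' (g x) * g' x).
Proof. by move=> hf hg x; have := hf (g x); have := hg x => ? ?; exact: is_derive1_comp. Qed.

Lemma has_derivative_cst (c : R) : has_derivative (fun=> c) (fun=> 0).
Proof. by move=> x; exact: is_derive_cst. Qed.

Lemma has_derivative_id : has_derivative (fun x => x) (fun=> 1).
Proof. by move=> x; exact: is_derive_id. Qed.

Lemma has_derivative_affine (a b : R) : has_derivative (fun x => a * x + b) (fun=> a).
Proof.
move=> x; apply: (is_derive_eq (has_derivativeD
  (has_derivativeM (has_derivative_cst a) has_derivative_id) (has_derivative_cst b) x)).
by rewrite mul0r mulr1 add0r addr0.
Qed.

Lemma derivable_n_cst n (c : R) : derivable_n n (fun=> c).
Proof. by elim: n c => //= n IH c; exists (fun=> 0); [exact: has_derivative_cst|]. Qed.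

Lemma derivable_nD n f g : derivable_n n f -> derivable_n n g ->
  derivable_n n (fun x => f x + g x).
Proof.
elim: n f g => //= n IH f g [f' hf nf] [g' hg ng].
by exists (fun x => f' x + g' x); [exact: has_derivativeD|exact: IH].
Qed.

Lemma derivable_nS n f : derivable_n n.+1 f -> derivable_n n f.
Proof.
elim: n f => //= n IH f [g fg [h gh hn]]; exists g => //.
by apply: IH; exists h.
Qed.

Lemma derivable_nM n f g : derivable_n n f -> derivable_n n g ->
  derivable_n n (fun x => f x * g x).
Proof.
elim: n f g => //= n IH f g [f' hf nf] [g' hg ng].
exists (fun x => f' x * g x + f x * g' x); first exact: has_derivativeM.
apply: derivable_nD; apply: IH => //; apply: derivable_nS; first by exists g'.
by exists f'.
Qed.

Lemma derivable_n_comp n f g : derivable_n n f -> derivable_n n g ->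
  derivable_n n (fun x => f (g x)).
Proof.
elim: n f g => //= n IH f g [f' hf nf] [g' hg ng].
exists (fun x => f' (g x) * g' x); first exact: has_derivative_comp.
by apply: derivable_nM => //; apply: IH => //; apply: derivable_nS; exists g'.
Qed.

Lemma smooth1D f g : smooth1 f -> smooth1 g -> smooth1 (fun x => f x + g x).
Proof. by move=> sf sg n; exact: derivable_nD. Qed.

Lemma smooth1M f g : smooth1 f -> smooth1 g -> smooth1 (fun x => f x * g x).
Proof. by move=> sf sg n; exact: derivable_nM. Qed.

Lemma smooth1_comp f g : smooth1 f -> smooth1 g -> smooth1 (fun x => f (g x)).
Proof. by move=> sf sg n; exact: derivable_n_comp. Qed.

Lemma smooth1_cst (c : R) : smooth1 (fun=> c).
Proof. by move=> n; exact: derivable_n_cst. Qed.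

Lemma smooth1_id : smooth1 (fun x => x).
Proof. by case=> //= n; exists (fun=> 1); [exact: has_derivative_id|exact: derivable_n_cst]. Qed.

Lemma has_derivative_sin (a b : R) : has_derivative (fun x => sin (a * x + b))
  (fun x => a * sin (a * x + (b + pi / 2))).
Proof.
move=> x; have hs : has_derivative sin cos by move=> y; exact: is_derive_sin.
apply: (is_derive_eq (has_derivative_comp hs (has_derivative_affine a b) x)).
by rewrite mulrC addrA sinDpihalf.
Qed.

Lemma smooth1_sin (a b : R) : smooth1 (fun x => sin (a * x + b)).
Proof.
move=> n; elim: n b => //= n IH b; eexists; first exact: has_derivative_sin.
by apply: derivable_nM; [exact: derivable_n_cst|exact: IH].
Qed.

(** The functions [t ^- p * exp (- 1 / t)], extended by 0 to [t <= 0]. Their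
    derivatives are combinations of functions of the same family, so that one
    computation at 0 gives smoothness by induction. *)
Definition flat (p : nat) (t : R) : R := if 0 < t then t^-1 ^+ p * expR (- t^-1) else 0.

Lemma expRN_le (p : nat) (y : R) : 0 < y -> y ^+ p.+1 * expR (- y) <= (p.+1)`!%:R.
Proof.
move=> y0; rewrite expRN ler_pdivrMr ?expR_gt0//.
have f0 : (0 : R) < (p.+1)`!%:R by rewrite ltr0n fact_gt0.
rewrite mulrC -ler_pdivrMr//.
by have := expR_ge1Dxn p (ltW y0); lra.
Qed.

Lemma flat_ge0 p t : 0 <= flat p t.
Proof.
by rewrite /flat; case: ifP => // t0; rewrite mulr_ge0 ?expR_ge0// exprn_ge0// invr_ge0 ltW.
Qed.

Lemma flat_derivative p :
  has_derivative (flat p) (fun t => flat p.+2 t - p%:R * flat p.+1 t).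
Proof.
move=> t; have [t0|t0|->] := ltrgtP t 0.
- rewrite /flat !ltNge (ltW t0)/= mulr0 subr0.
  have h := is_derive_cst (0 : R) t 1; apply: near_eq_is_derive h.
  near=> y; have y0 : y < 0 by near: y; exact: lt_nbhsl.
  by rewrite /= ltNge (ltW y0).
- rewrite /flat t0.
  have tn0 : t != 0 by rewrite gt_eqF.
  have hV : is_derive t 1 (fun y : R => y^-1) (- t ^- 2).
    by apply: (is_derive_eq (is_deriveV tn0 (has_derivative_id t))); rewrite /GRing.scale/= mulr1.
  have hVp : is_derive t 1 (fun y : R => y^-1 ^+ p) (- (p%:R * t^-1 ^+ p.+1)).
    elim: p => [|p IH].
      by rewrite mul0r oppr0; exact: is_derive_cst.
    have -> : (fun y : R => y^-1 ^+ p.+1) = (fun y => y^-1 * y^-1 ^+ p).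
      by apply/funext => y; rewrite exprS.
    apply: (is_derive_eq (is_deriveM hV IH)).
    by rewrite /GRing.scale/= -exprVn !exprS -natr1; ring.
  have hN : is_derive t 1 (fun y : R => - y^-1) (t^-1 ^+ 2).
    by apply: (is_derive_eq (is_deriveN hV)); rewrite opprK exprVn.
  have hE : is_derive t 1 (fun y : R => expR (- y^-1)) (expR (- t^-1) * t^-1 ^+ 2).
    exact: (@is_derive1_comp R expR (fun y => - y^-1) t _ _ (is_derive_expR _) hN).
  have h : is_derive t 1 (fun y : R => y^-1 ^+ p * expR (- y^-1))
      (t^-1 ^+ p.+2 * expR (- t^-1) - p%:R * (t^-1 ^+ p.+1 * expR (- t^-1))).
    apply: (is_derive_eq (is_deriveM hVp hE)).
    by rewrite /GRing.scale/= !exprS; ring.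
  apply: near_eq_is_derive h.
  near=> y; have y0 : 0 < y by near: y; exact: lt_nbhsr.
  by rewrite y0.
(* at 0 the difference quotient is [h ^- (p+1) * exp (- 1 / h)], which is [O(h)] *)
- rewrite /flat ltxx mulr0 subr0.
  have key : h^-1 *: (((fun y => if 0 < y then y^-1 ^+ p * expR (- y^-1) else 0) \o shift 0)
      (h *: (1 : R)) - (if (0 : R) < 0 then 0^-1 ^+ p * expR (- 0^-1) else 0)) @[h --> 0^'] --> (0 : R).
    have C0 : (0 : R) < (p.+2)`!%:R by rewrite ltr0n fact_gt0.
    apply/cvgrPdist_lt => e e0; near=> h.
    have hn0 : h != 0 by near: h; exact: nbhs_dnbhs_neq.
    rewrite ltxx subr0 sub0r normrN /= /shift addr0 /GRing.scale/= mulr1.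
    case: ifPn => [h0|_]; last by rewrite mulr0 normr0.
    rewrite ger0_norm ?mulr_ge0 ?invr_ge0 ?exprn_ge0 ?expR_ge0 ?invr_ge0 ?ltW//.
    have := expRN_le p.+1 (y := h^-1); rewrite invr_gt0 => /(_ h0) hle.
    have -> : h^-1 * (h^-1 ^+ p * expR (- h^-1)) = h * (h^-1 ^+ p.+2 * expR (- h^-1)).
      by rewrite !exprS; field.
    apply: (@le_lt_trans _ _ (h * (p.+2)`!%:R)); first by rewrite ler_pM2l.
    rewrite -ltr_pdivlMr//.
    have : `|h| < e / (p.+2)`!%:R.
      near: h; apply: dnbhs0_lt; exact: divr_gt0.
    by rewrite gtr0_norm.
  split; first by apply/cvg_ex; exists 0.
  exact: cvg_lim key.
Unshelve. all: by end_near. Qed.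

Lemma smooth1_flat p : smooth1 (flat p).
Proof.
move=> n; elim: n p => //= n IH p; eexists; first exact: flat_derivative.
apply: (derivable_nD (g := fun t => - (p%:R * flat p.+1 t))); first exact: IH.
have := derivable_nM (derivable_n_cst n (- p%:R)) (IH p.+1).
by congr derivable_n; apply/funext => t; rewrite mulNr.
Qed.

End smooth_1d.

(** * Partial derivatives and test functions *)

Section coordinate_derivatives.
Context {R : realType} {d : nat}.
Implicit Types (phi psi : 'rV[R]_d -> R) (x : 'rV[R]_d) (j : 'I_d).
Local Notation dir j := (delta_mx 0 j : 'rV[R]_d).

Definition set_coord x j (t : R) : 'rV[R]_d := \row_i (if i == j then t else x ord0 i).

(** A partial derivative at [x] only depends on the restriction to the line
    through [x] along the axis, so one-dimensional calculus applies. *)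
Lemma is_derive_line phi x j (df : R) :
  is_derive (x ord0 j) 1 (fun t => phi (set_coord x j t)) df <->
  is_derive x (dir j) phi df.
Proof.
have e : (fun h : R => h^-1 *: ((phi \o shift x) (h *: dir j) - phi x)) =
    (fun h : R => h^-1 *: (((fun t => phi (set_coord x j t)) \o shift (x ord0 j)) (h *: (1 : R)) -
      phi (set_coord x j (x ord0 j)))).
  apply/funext => h; congr (_ *: (_ - _)); rewrite /=; congr phi; apply/rowP => i.
    by rewrite !mxE eqxx /= /GRing.scale/=; case: eqVneq => [->|]; rewrite ?mulr0 ?add0r.
  by rewrite !mxE; case: eqVneq => [->|].
split=> -[h1 h2].
  by split; [rewrite /derivable e; exact: h1|rewrite /derive e; exact: h2].
by split; [rewrite /derivable -e; exact: h1|rewrite /derive -e; exact: h2].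
Qed.

Lemma partialE phi x j (df : R) : is_derive x (dir j) phi df -> partial j phi x = df.
Proof. by case. Qed.

Lemma derivable_partial phi x j : derivable phi x (dir j) ->
  is_derive x (dir j) phi (partial j phi x).
Proof. by move=> h; split. Qed.

Definition tens (f : 'I_d -> R -> R) x : R := \prod_i f i (x ord0 i).

Definition upd (f : 'I_d -> R -> R) j g : 'I_d -> R -> R :=
  fun i => if i == j then g else f i.

Lemma tens_upd f j g x : tens (upd f j g) x =
  g (x ord0 j) * \prod_(i | i != j) f i (x ord0 i).
Proof.
rewrite /tens (bigD1 j)//= /upd eqxx; congr (_ * _).
by apply: eq_bigr => i /negPf ->.
Qed.

Lemma tensD1 f j x : tens f x = f j (x ord0 j) * \prod_(i | i != j) f i (x ord0 i).
Proof. by rewrite /tens (bigD1 j). Qed.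

Lemma is_derive_tens f j g x : has_derivative (f j) g ->
  is_derive x (dir j) (tens f) (tens (upd f j g) x).
Proof.
move=> fg; apply/is_derive_line; rewrite tens_upd.
set c := \prod_(i | _) _.
have -> : (fun t => tens f (set_coord x j t)) = (fun t => f j t * c).
  apply/funext => t; rewrite (tensD1 f j) mxE eqxx; congr (_ * _).
  by apply: eq_bigr => i /negPf ij; rewrite mxE ij.
apply: (is_derive_eq (has_derivativeM fg (has_derivative_cst c) _)).
by rewrite mulr0 addr0.
Qed.

Lemma partial_tens f j g : has_derivative (f j) g -> partial j (tens f) = tens (upd f j g).
Proof. by move=> fg; apply/funext => x; exact/partialE/is_derive_tens. Qed.

Lemma continuous_tens f : (forall i, continuous (f i)) -> continuous (tens f).
Proof.
move=> cf x; rewrite /tens; elim: (index_enum _) => [|i r IH].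
  by under eq_fun do rewrite big_nil; exact: cst_continuous.
under eq_fun do rewrite big_cons; apply: (continuousM _ IH).
apply: (cvg_comp (fun x : 'rV[R]_d => x ord0 i) (f i)); last exact: cf.
exact: coord_continuous.
Qed.

(** Products of one-variable functions are stable under partial
    derivatives. *)
Lemma foldr_partial_tens f s : (forall i, smooth1 (f i)) ->
  exists2 f', foldr partial (tens f) s = tens f' & forall i, smooth1 (f' i).
Proof.
move=> sf; elim: s => [|j s [f' /= -> sf']]; first by exists f.
have [g fg sg] := smooth1_derivative (sf' j).
exists (upd f' j g); first exact: partial_tens.
by move=> i; rewrite /upd; case: eqP.
Qed.

Lemma smooth_tens f : (forall i, smooth1 (f i)) -> smooth (tens f).
Proof.
move=> sf s; have [f' -> sf'] := foldr_partial_tens s sf; split.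
  by apply: continuous_tens => i; exact: smooth1_continuous.
move=> i x; have [g fg _] := smooth1_derivative (sf' i).
by case: (is_derive_tens x fg).
Qed.

Lemma smooth_partial phi j : smooth phi -> smooth (partial j phi).
Proof. by move=> sp s; have := sp (rcons s j); rewrite foldr_rcons. Qed.

Lemma smooth_derivable phi j x : smooth phi -> derivable phi x (dir j).
Proof. by move=> /(_ [::])[_]; exact. Qed.

Lemma smooth_continuous phi : smooth phi -> continuous phi.
Proof. by move=> /(_ [::])[]. Qed.

Lemma partial_lin a phi psi j : smooth phi -> smooth psi ->
  partial j (fun x => a * phi x + psi x) = (fun x => a * partial j phi x + partial j psi x).
Proof.
move=> sp sq; apply/funext => x; apply: partialE.
have h1 := derivable_partial (smooth_derivable (j := j) (x := x) sp).
have h2 := derivable_partial (smooth_derivable (j := j) (x := x) sq).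
exact: (is_deriveD (is_deriveZ a h1) h2).
Qed.

Lemma smooth_lin a phi psi : smooth phi -> smooth psi ->
  smooth (fun x => a * phi x + psi x).
Proof.
move=> sp sq s.
have e : foldr partial (fun x => a * phi x + psi x) s =
    (fun x => a * foldr partial phi s x + foldr partial psi s x).
  elim/last_ind: s phi psi sp sq => [//|s j IH] phi psi sp sq.
  by rewrite !foldr_rcons partial_lin//; apply: IH; exact: smooth_partial.
rewrite e; have [c1 d1] := sp s; have [c2 d2] := sq s; split.
  by move=> x; exact: (cvgD (cvgM (cvg_cst a) (c1 x)) (c2 x)).
move=> i x; have h1 := derivable_partial (d1 i x); have h2 := derivable_partial (d2 i x).
by case: (is_deriveD (is_deriveZ a h1) h2).
Qed.

End coordinate_derivatives.

Section test_functions.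
Context {R : realType} {d : nat} (L : R).
Implicit Types (phi psi : 'rV[R]_d -> R) (x : 'rV[R]_d) (j : 'I_d).

(** The hypothesis puts the support in a compact cube inside the open box. *)
Lemma test_functionP phi (a : R) : a < L / 2 -> smooth phi ->
  (forall x, phi x != 0 -> forall i, `|x ord0 i| <= a) -> test_function L phi.
Proof.
move=> aL sp sup; pose K := [set x : 'rV[R]_d | forall i, `[- a, a]%classic (x ord0 i)].
have cK : compact K by apply: (@rV_compact _ _ (fun=> `[- a, a]%classic)) => i; exact: segment_compact.
have clK : closed K := compact_closed (@norm_hausdorff _ _) cK.
have sub : closure [set x | phi x != 0] `<=` K.
  rewrite [X in _ `<=` X]((closure_id K).1 clK); apply: closure_subset => x /= px i.
  by rewrite /= in_itv/= -ler_norml; exact: sup.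
split => //.
  by apply: subclosed_compact sub => //; exact: closed_closure.
by move=> x /sub Kx i; have := Kx i; rewrite /= in_itv/=; lra.
Qed.

Lemma test_function_lin a phi psi : test_function L phi -> test_function L psi ->
  test_function L (fun x => a * phi x + psi x).
Proof.
move=> [s1 c1 b1] [s2 c2 b2].
have sub : closure [set x | a * phi x + psi x != 0] `<=`
    closure [set x | phi x != 0] `|` closure [set x | psi x != 0].
  rewrite -closureU; apply: closure_subset => x /=.
  have [->|] := eqVneq (phi x) 0; last by left.
  by rewrite mulr0 add0r; right.
split; first exact: smooth_lin.
- apply: (subclosed_compact _ _ sub); first exact: closed_closure.
  exact: compactU.
- by move=> x /sub [/b1|/b2].
Qed.

Lemma test_function0 : test_function L (fun _ : 'rV[R]_d => 0).
Proof.
have p0 s : foldr partial (fun _ : 'rV[R]_d => 0 : R) s = (fun=> 0).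
  elim: s => //= j s ->; apply/funext => x; apply: partialE; exact: is_derive_cst.
have e : [set x : 'rV[R]_d | (0 : R) != 0] = set0 by apply/seteqP; split => x //=; rewrite eqxx.
split; rewrite ?e ?closure0//; last exact: compact0.
by move=> s; rewrite p0; split => [x|i x]; [exact: cst_continuous|case: (is_derive_cst (0 : R) x (delta_mx 0 i : 'rV[R]_d))].
Qed.

Lemma test_function_partial phi j : test_function L phi -> test_function L (partial j phi).
Proof.
move=> [s1 c1 b1].
have sub : closure [set x | partial j phi x != 0] `<=` closure [set x | phi x != 0].
  have e := (closure_id _).1 (@closed_closure _ [set x | phi x != 0]).
  rewrite [X in _ `<=` X]e {e}.
  apply: closure_subset => x /=; apply: contraNP => nx; apply/eqP/partialE.
  have h := is_derive_cst (0 : R) x (delta_mx 0 j : 'rV[R]_d).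
  apply: near_eq_is_derive h; rewrite /=.
  have : open (~` closure [set x | phi x != 0]) by apply: closed_openC; exact: closed_closure.
  rewrite openE => /(_ x nx); apply: filterS => y ny; apply/esym/eqP.
  by apply: contra_notT ny => py; exact: subset_closure.
split; first exact: smooth_partial.
- by apply: (subclosed_compact _ _ sub) => //; exact: closed_closure.
- exact: subset_trans sub b1.
Qed.

Lemma test_function_bounded phi : test_function L phi -> exists M, forall x, `|phi x| <= M.
Proof.
move=> [s1 c1 b1].
have cp : {within closure [set x | phi x != 0], continuous phi}.
  by apply: continuous_subspaceT; exact: smooth_continuous.
have [M [_ hM]] := compact_bounded (continuous_compact cp c1).
exists (`|M| + 1) => x; have [->|px] := eqVneq (phi x) 0.
  by rewrite normr0 addr_ge0.
apply: (hM (`|M| + 1)); last by exists x => //; exact: subset_closure.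
by rewrite (le_lt_trans (ler_norm M))// ltrDl.
Qed.

Lemma test_function_outside phi x : test_function L phi -> ~ box L x -> phi x = 0.
Proof.
move=> [_ _ b] nx; apply/eqP; apply: contra_notT nx => px.
by apply: b; exact: subset_closure.
Qed.

End test_functions.

(** * Integration by parts on the box *)

Section integration_by_parts.
Context {R : realType} (L : R).
Hypothesis L0 : 0 < L.

Lemma continuous_consrV_l n (y : 'rV[R]_n) : continuous (fun t : R => consrV (t, y)).
Proof.
move=> t; apply: (@cvg_rV R _ _ (nbhs t) _) => i; case: (unliftP ord0 i) => [j ->|->].
  by under eq_fun do rewrite consrVS; rewrite consrVS; exact: cvg_cst.
by under eq_fun do rewrite consrV0; rewrite consrV0; exact: cvg_id.
Qed.

Lemma continuous_consrV_r n (t : R) : continuous (fun y : 'rV[R]_n => consrV (t, y)).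
Proof.
move=> y; apply: (@cvg_rV R _ _ (nbhs y) _) => i; case: (unliftP ord0 i) => [j ->|->].
  by under eq_fun do rewrite consrVS; rewrite consrVS; exact: coord_continuous.
by under eq_fun do rewrite consrV0; rewrite consrV0; exact: cvg_cst.
Qed.

Lemma set_coord_consrV0 n t s (y : 'rV[R]_n) :
  set_coord (consrV (t, y)) ord0 s = consrV (s, y).
Proof.
apply/rowP => i; rewrite !mxE; case: (unliftP ord0 i) => [j ->|->].
  by rewrite eq_sym (negPf (neq_lift _ _)).
by rewrite eqxx.
Qed.

Lemma set_coord_consrVS n t s (y : 'rV[R]_n) j :
  set_coord (consrV (t, y)) (lift ord0 j) s = consrV (t, set_coord y j s).
Proof.
apply/rowP => i; rewrite !mxE; case: (unliftP ord0 i) => [k ->|->].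
  by rewrite (inj_eq lift_inj) /= mxE.
by rewrite (negPf (neq_lift _ _)).
Qed.

Lemma integral_side_derivative (F f : R -> R) : has_derivative F f -> continuous f ->
  F (- (L / 2)) = 0 -> F (L / 2) = 0 ->
  (\int[@lebesgue_measure R]_(t in side L) (f t)%:E = 0)%E.
Proof.
move=> Ff cf F0 F1; have ab : - (L / 2) < L / 2 by move: L0; lra.
have mf : measurable_fun setT f by exact: continuous_measurable_fun.
pose cl : set R := `[- (L / 2), L / 2]%classic.
transitivity (\int[@lebesgue_measure R]_(t in cl) (f t)%:E)%E.
  rewrite /side /cl integral_itv_obnd_cbnd; last first.
    by apply: measurable_funTS; apply/measurable_EFinP.
  rewrite integral_itv_bndo_bndc//.
  by apply: measurable_funTS; apply/measurable_EFinP.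
rewrite /cl (continuous_FTC2 (F := F) ab).
- by rewrite F0 F1 subee.
- exact: continuous_subspaceT.
- have cF := has_derivative_continuous Ff.
  split; last 2 first.
  + by apply: cvg_at_right_filter; exact: cF.
  + by apply: cvg_at_left_filter; exact: cF.
  by move=> x _; case: (Ff x).
- by move=> x _; rewrite derive1E; case: (Ff x).
Qed.

(** Integrating along the axis [i] first gives the difference of the values of
    [f] at two boundary points of the box, both 0. The recursive structure of
    the measure only allows the first coordinate to be integrated innermost; for
    the others the claim is the one for the slices, in one dimension less. *)
Lemma box_integral_partial n (f : 'rV[R]_n -> R) i (M : R) :
  (forall x, derivable f x (delta_mx 0 i)) -> continuous (partial i f) ->
  (forall x, `|partial i f x| <= M) -> (forall x, ~ box L x -> f x = 0) ->
  (\int[box_measure L]_x (partial i f x)%:E = 0)%E.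
Proof.
elim: n f i => [|n IH] f i; first by case: i.
case: (unliftP ord0 i) => [j|] -> df cf fM f0; have mf := continuous_measurable cf.
  rewrite (box_fubini12 L0 mf fM).
  rewrite (eq_integral (cst 0%E)) ?integral0// => t /set_mem ts.
  pose g y := f (consrV (t, y)).
  have dg y : is_derive y (delta_mx 0 j) g (partial (lift ord0 j) f (consrV (t, y))).
    apply/is_derive_line.
    have := derivable_partial (df (consrV (t, y))); move=> /is_derive_line.
    rewrite consrVS; under eq_fun do rewrite set_coord_consrVS.
    by [].
  have pg : partial j g = fun y => partial (lift ord0 j) f (consrV (t, y)).
    by apply/funext => y; exact/partialE.
  have := IH g j; rewrite pg; apply.
  - by move=> y; case: (dg y).
  - move=> y; apply: (cvg_comp (fun y => consrV (t, y)) (partial (lift ord0 j) f)); last exact: cf.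
    exact: continuous_consrV_r.
  - by move=> y; exact: fM.
  - by move=> y ny; apply: f0 => /box_consrV[].
rewrite (box_fubini21 L0 mf fM).
rewrite (eq_integral (cst 0%E)) ?integral0// => y /set_mem yb.
apply: (@integral_side_derivative (fun t => f (consrV (t, y)))).
- move=> t; have := derivable_partial (df (consrV (t, y))); move=> /is_derive_line.
  by rewrite consrV0; under eq_fun do rewrite set_coord_consrV0.
- move=> t; apply: (cvg_comp (fun t => consrV (t, y)) (partial ord0 f)); last exact: cf.
  exact: continuous_consrV_l.
- by apply: f0 => /box_consrV[]; rewrite /side /= in_itv/= ltxx.
- by apply: f0 => /box_consrV[]; rewrite /side /= in_itv/= ltxx andbF.
Qed.

(** A class broad enough for both the test functions, which vanish near the
    boundary, and the sine waves, which do not. *)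
Record bounded_C1 n (i : 'I_n) (f : 'rV[R]_n -> R) : Prop := BoundedC1 {
  bC1_derivable : forall x, derivable f x (delta_mx 0 i);
  bC1_continuous : continuous f;
  bC1_partial : continuous (partial i f);
  bC1_bounded : exists M : R, forall x, `|f x| <= M;
  bC1_partial_bounded : exists M : R, forall x, `|partial i f x| <= M }.

Lemma bounded_mul_integrable n (f g : 'rV[R]_n -> R) : continuous f -> continuous g ->
  (exists M : R, forall x, `|f x| <= M) -> (exists M : R, forall x, `|g x| <= M) ->
  (box_measure L).-integrable setT (EFin \o (fun x => f x * g x)).
Proof.
move=> cf cg [M fM] [N gN]; apply: (@box_bounded_integrable _ _ L0 _ _ (M * N)).
  by apply: measurable_funM; exact: continuous_measurable.
by move=> x; rewrite normrM ler_pM.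
Qed.

Lemma integration_by_parts n (i : 'I_n) (f g : 'rV[R]_n -> R) :
  bounded_C1 i f -> bounded_C1 i g -> (forall x, ~ box L x -> f x = 0) ->
  inner L f (partial i g) = - inner L (partial i f) g.
Proof.
move=> [df cf pf bf bpf] [dg cg pg bg bpg] f0.
have dfg x : is_derive x (delta_mx 0 i) (fun x => f x * g x)
    (partial i f x * g x + f x * partial i g x).
  apply: (is_derive_eq (is_deriveM (derivable_partial (df x)) (derivable_partial (dg x)))).
  by rewrite /GRing.scale/= addrC mulrC.
have pfg : partial i (fun x => f x * g x) =
    fun x => partial i f x * g x + f x * partial i g x.
  by apply/funext => x; exact/partialE.
have i1 := bounded_mul_integrable pf cg bpf bg.
have i2 := bounded_mul_integrable cf pg bf bpg.
have [M1 fM] := bf; have [M2 pfM] := bpf; have [M3 gM] := bg; have [M4 pgM] := bpg.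
have := @box_integral_partial _ (fun x => f x * g x) i (M2 * M3 + M1 * M4).
rewrite pfg => h; apply/eqP; rewrite -addr_eq0 addrC -RintegralD//.
rewrite /Rintegral (eq_integral (fun x => (partial i f x * g x + f x * partial i g x)%:E))//.
suff -> : (\int[box_measure L]_x (partial i f x * g x + f x * partial i g x)%:E = 0)%E by [].
apply: h.
- by move=> x; case: (dfg x).
- by move=> x; exact: (cvgD (cvgM (pf x) (cg x)) (cvgM (cf x) (pg x))).
- move=> x; rewrite (le_trans (ler_normD _ _))// !normrM lerD// ler_pM//.
- by move=> x nx; rewrite f0// mul0r.
Qed.

End integration_by_parts.

(** * Sine modes and cutoffs in one dimension *)

Section sine_modes.
Context {R : realType} (L : R).
Hypothesis L0 : 0 < L.

Lemma sin_nat_pi (n : nat) : sin (n%:R * pi) = 0 :> R.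
Proof.
elim: n => [|n IH]; first by rewrite mul0r sin0.
by rewrite -natr1 mulrDl mul1r sinDpi IH oppr0.
Qed.

Lemma sin_le_id (x : R) : 0 <= x -> `|sin x| <= x.
Proof.
rewrite le_eqVlt => /orP[/eqP <-|x0]; first by rewrite sin0 normr0.
have hs (y : R) : is_derive y 1 sin (cos y) by exact: is_derive_sin.
have [|c _] := @MVT R sin cos 0 x x0 (fun y _ => hs y).
  by apply: continuous_subspaceT => y; exact: continuous_sin.
rewrite sin0 !subr0 => ->; rewrite normrM (gtr0_norm x0) ler_piMl ?cos_max ?(ltW x0)//.
Qed.

Lemma sin_mul_sin (x y : R) : sin x * sin y = 2^-1 * cos (x - y) + - 2^-1 * cos (x + y).
Proof. by rewrite cosB cosD; field. Qed.

Definition freq (m : nat) : R := m.+1%:R * pi / L.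

Lemma freq_gt0 m : 0 < freq m.
Proof. by rewrite divr_gt0// mulr_gt0// pi_gt0. Qed.

Lemma freq_inj m n : m != n -> freq m != freq n.
Proof.
apply: contraNneq; rewrite /freq => /(mulIf _); rewrite invr_eq0 gt_eqF// => /(_ isT).
move/mulIf; rewrite gt_eqF ?pi_gt0// => /(_ isT) /eqP.
by rewrite eqr_nat eqSS.
Qed.

(** The phase [c] counts quarter turns: [c = 0] is a Dirichlet sine, [c = 1] a
    cosine, and differentiating adds 1 to [c]. *)
Definition mode (m c : nat) (t : R) : R := sin (freq m * t + (freq m * (L / 2) + c%:R * (pi / 2))).

Lemma modeE m c t : mode m c t = sin (freq m * (t + L / 2) + c%:R * (pi / 2)).
Proof. by rewrite /mode mulrDr addrA. Qed.

Lemma mode_derivative m c : has_derivative (mode m c) (fun t => freq m * mode m c.+1 t).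
Proof.
move=> t; apply: (is_derive_eq (has_derivative_sin _ _ t)).
have e : c.+1%:R * (pi / 2) = c%:R * (pi / 2) + pi / 2 :> R.
  by rewrite -natr1; ring.
by rewrite /mode e !addrA.
Qed.

Lemma smooth1_mode m c : smooth1 (mode m c).
Proof. exact: smooth1_sin. Qed.

Lemma mode_le1 m c t : `|mode m c t| <= 1.
Proof. exact: sin_max. Qed.

Lemma mode_opp m c t : mode m c.+2 t = - mode m c t.
Proof.
rewrite /mode -sinDpi; congr sin; rewrite -[in LHS](addn2 c) natrD; lra.
Qed.

Lemma measurable_mode m c : measurable_fun setT (mode m c).
Proof. by apply: continuous_measurable_fun; apply: smooth1_continuous; exact: smooth1_mode. Qed.

Lemma side_endpoints (a : R) : a * (- (L / 2) + L / 2) = 0 /\ a * (L / 2 + L / 2) = a * L.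
Proof. by split; [rewrite addNr mulr0|congr (_ * _); lra]. Qed.

Lemma has_derivative_sin_shift (a b : R) : a != 0 ->
  has_derivative (fun t => sin (a * (t + L / 2) + b) / a) (fun t => cos (a * (t + L / 2) + b)).
Proof.
move=> a0 t; have h := has_derivativeM (has_derivative_sin a (a * (L / 2) + b)) (has_derivative_cst a^-1).
have -> : (fun t => sin (a * (t + L / 2) + b) / a) = (fun t => sin (a * t + (a * (L / 2) + b)) * a^-1).
  by apply/funext => s; rewrite mulrDr addrA.
apply: (is_derive_eq (h t)).
by rewrite mulr0 addr0 (addrA (a * t)) sinDpihalf mulrAC divff// mul1r mulrDr !addrA.
Qed.

(** The product of the sines is half the difference of a cosine of the
    difference and one of the sum of the angles; both integrate to 0 over the
    side except for the first when [m = n]. The phase only shifts the second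
    angle by a multiple of [pi]. *)
Lemma mode_ortho (m n c : nat) :
  \int[@lebesgue_measure R]_(t in side L) (mode m c t * mode n c t) = (m == n)%:R * (L / 2).
Proof.
have cs (a b : R) : continuous (fun t => cos (a * (t + L / 2) + b)).
  move=> t; apply: (cvg_comp (fun t => a * (t + L / 2) + b) cos); last exact: continuous_cos.
  apply: cvgD; last exact: cvg_cst; apply: cvgM; first exact: cvg_cst.
  by apply: cvgD; [exact: cvg_id|exact: cvg_cst].
have iside (f : R -> R) : continuous f -> (exists M, forall t, `|f t| <= M) ->
    (@lebesgue_measure R).-integrable (side L) (EFin \o f).
  move=> cf [M fM]; apply: measurable_bounded_integrable => //.
  - exact: measurable_itv.
  - by rewrite [X in (X < _)%E](_ : _ = L%:E); [exact: ltry|exact: lebesgue_side].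
  - by apply: measurable_funTS; exact: continuous_measurable_fun.
  - by exists M; split; [exact: num_real|move=> x Mx t _ /=; rewrite (le_trans (fM t))// ltW].
have int0 (a b : R) : a != 0 -> sin b = 0 -> sin (a * L + b) = 0 ->
    \int[@lebesgue_measure R]_(t in side L) cos (a * (t + L / 2) + b) = 0.
  move=> a0 b0 aL; rewrite /Rintegral.
  rewrite (integral_side_derivative L0 (has_derivative_sin_shift b a0))//.
  - by have [-> _] := side_endpoints a; rewrite add0r b0 mul0r.
  - by have [_ ->] := side_endpoints a; rewrite aL mul0r.
have ic (a b : R) : (@lebesgue_measure R).-integrable (side L) (EFin \o (fun t => cos (a * (t + L / 2) + b))).
  by apply: iside => //; exists 1 => t; exact: cos_max.
have msd : measurable (side L : set (measurableTypeR R)) by exact: measurable_itv.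
have fL j : freq j * L = j.+1%:R * pi by rewrite /freq mulfVK// gt_eqF.
have sinc2 : sin (c%:R * pi) = 0 :> R by exact: sin_nat_pi.
have plus0 : \int[@lebesgue_measure R]_(t in side L)
    cos ((freq m + freq n) * (t + L / 2) + c%:R * pi) = 0.
  apply: int0 => //.
    by rewrite gt_eqF// addr_gt0// freq_gt0.
  by rewrite mulrDl !fL -!mulrDl -!natrD sin_nat_pi.
have e t : mode m c t * mode n c t = 2^-1 * cos ((freq m - freq n) * (t + L / 2) + 0) +
    (- 2^-1) * cos ((freq m + freq n) * (t + L / 2) + c%:R * pi).
  rewrite !modeE; set A := _ + _; set B := _ + _.
  have -> : (freq m - freq n) * (t + L / 2) + 0 = A - B by rewrite /A /B; ring.
  have -> : (freq m + freq n) * (t + L / 2) + c%:R * pi = A + B by rewrite /A /B; field.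
  exact: sin_mul_sin.
transitivity (2^-1 * \int[@lebesgue_measure R]_(t in side L) cos ((freq m - freq n) * (t + L / 2) + 0)).
  under eq_Rintegral do rewrite e.
  rewrite RintegralD//; last 2 first.
  - by have := integrableZl msd 2^-1 (ic (freq m - freq n) 0).
  - by have := integrableZl msd (- 2^-1) (ic (freq m + freq n) (c%:R * pi)).
  by rewrite !RintegralZl// plus0 mulr0 addr0.
have [->|mn] := eqVneq m n.
  rewrite mul1r; under eq_Rintegral do rewrite subrr mul0r add0r cos0.
  rewrite Rintegral_cst// mul1r [X in fine X](_ : _ = L%:E); last exact: lebesgue_side.
  by rewrite mulrC.
rewrite mul0r int0 ?mulr0//.
- by rewrite subr_eq0 freq_inj.
- exact: sin0.
rewrite addr0 mulrBl !fL -mulrBl.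
by rewrite mulrBl sinB !sin_nat_pi mul0r mulr0 subrr.
Qed.

End sine_modes.

Section cutoff.
Context {R : realType} (L : R).
Hypothesis L0 : 0 < L.

(** Comparable to the distance to the two end points. *)
Definition well (t : R) : R := (L / 2) ^+ 2 - t ^+ 2.

Lemma well_gt0 t : side L t <-> 0 < well t.
Proof.
rewrite /side /well /= in_itv/=; split => [/andP[h1 h2]|h]; first by nra.
by apply/andP; split; move: L0 => L0'; nra.
Qed.

(** Smooth cutoffs that vanish where [well t <= (n+1)^-1] and tend to 1
    inside. *)
Definition cut (n : nat) (t : R) : R := flat 0 (n.+1%:R * well t - 1).

Definition cut' (n : nat) (t : R) : R :=
  flat 2 (n.+1%:R * well t - 1) * (n.+1%:R * (- (2 * t))).

Lemma well_derivative : has_derivative well (fun t => - (2 * t)).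
Proof.
have h := has_derivativeD (has_derivative_cst ((L / 2) ^+ 2))
  (has_derivativeM (has_derivative_cst (-1)) (has_derivativeM (@has_derivative_id R) (@has_derivative_id R))).
move=> t; have -> : well = fun t => (L / 2) ^+ 2 + -1 * (t * t).
  by apply/funext => s; rewrite /well; ring.
by apply: (is_derive_eq (h t)); ring.
Qed.

Lemma smooth1_well : smooth1 well.
Proof.
have -> : well = fun t => (L / 2) ^+ 2 + -1 * (t * t).
  by apply/funext => s; rewrite /well; ring.
apply: smooth1D; first exact: smooth1_cst.
by apply: smooth1M; [exact: smooth1_cst|apply: smooth1M; exact: smooth1_id].
Qed.

Lemma smooth1_cut n : smooth1 (cut n).
Proof.
apply: smooth1_comp; first exact: smooth1_flat.
apply: smooth1D; last exact: smooth1_cst.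
by apply: smooth1M; [exact: smooth1_cst|exact: smooth1_well].
Qed.

Lemma cut_derivative n : has_derivative (cut n) (cut' n).
Proof.
have h1 := has_derivativeD (has_derivativeM (has_derivative_cst n.+1%:R) well_derivative)
   (has_derivative_cst (- 1)).
have h := has_derivative_comp (@flat_derivative R 0) h1.
move=> t; apply: (is_derive_eq (h t)).
by rewrite /cut' mul0r subr0 mul0r add0r addr0.
Qed.

Lemma flat0_le1 (s : R) : flat 0 s <= 1.
Proof.
rewrite /flat; case: ifP => // s0; rewrite mul1r -expR0 ler_expR oppr_le0.
by rewrite invr_ge0 ltW.
Qed.

Lemma cut_le1 n t : `|cut n t| <= 1.
Proof. by rewrite ger0_norm ?flat_ge0// flat0_le1. Qed.

Lemma cut_support n : exists2 a : R, a < L / 2 & forall t, cut n t != 0 -> `|t| <= a.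
Proof.
pose b := (L / 2) ^+ 2 - n.+1%:R^-1; exists (Num.sqrt b).
  have L2 : 0 < L / 2 by move: L0; lra.
  rewrite -[ltRHS]gtr0_norm// -sqrtr_sqr ltr_sqrt ?exprn_gt0// /b.
  by rewrite ltrBlDr ltrDl invr_gt0.
move=> t; rewrite /cut /flat; case: ifP => [h _|]; last by rewrite eqxx.
have h1 : t ^+ 2 <= b.
  rewrite /b lerBrDr -lerBrDl; rewrite subr_gt0 in h.
  have n0 : (0 : R) < n.+1%:R by [].
  by rewrite -/(well t) -[leLHS]mul1r ler_pdivrMr// mulrC ltW.
by rewrite -sqrtr_sqr ler_wsqrtr.
Qed.

Lemma scale_gt0 (p : R) : 0 < p -> \forall n \near \oo, 0 < n.+1%:R * p - 1.
Proof.
move=> p0; near=> n.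
have h3 : p^-1 < n%:R by near: n; exact: nbhs_infty_gtr.
rewrite -natr1 mulrDl mul1r.
by move: h3; rewrite -(ltr_pM2r p0) mulVf ?gt_eqF//; move: p0; lra.
Unshelve. all: by end_near. Qed.

Lemma scale_cvgy (p : R) : 0 < p -> (n.+1%:R * p - 1)^-1 @[n --> \oo] --> (0 : R).
Proof.
move=> p0; apply/cvgrPdist_lt => e e0; near=> n.
have h : (e^-1 + 1) / p < n%:R by near: n; exact: nbhs_infty_gtr.
rewrite ltr_pdivrMr// in h.
have h2 : e^-1 < n.+1%:R * p - 1 by rewrite -natr1 mulrDl mul1r; move: h p0; lra.
have h3 : 0 < n.+1%:R * p - 1 by apply: lt_trans h2; rewrite invr_gt0.
rewrite sub0r normrN gtr0_norm ?invr_gt0//.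
by rewrite -[ltRHS]invrK ltf_pV2 ?posrE ?invr_gt0.
Unshelve. all: by end_near. Qed.

Lemma cut_cvg t : side L t -> cut n t @[n --> \oo] --> (1 : R).
Proof.
move=> /well_gt0 p0; have h := scale_cvgy p0.
have h1 : 1 - (n.+1%:R * well t - 1)^-1 @[n --> \oo] --> (1 : R).
  by rewrite -[X in _ --> X]subr0; apply: cvgB => //; exact: cvg_cst.
apply: (squeeze_cvgr _ h1 (cvg_cst (1 : R))); near=> n.
have h2 : 0 < n.+1%:R * well t - 1 by near: n; exact: scale_gt0.
rewrite /cut flat0_le1 andbT /flat h2 mul1r.
by have := expR_ge1Dx (- (n.+1%:R * well t - 1)^-1).
Unshelve. all: by end_near. Qed.

(** A Dirichlet sine vanishes linearly at both ends. This compensates the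
    growth of the derivatives of the cutoffs. *)
Lemma mode_well m t : side L t -> `|mode L m 0 t| <= 2 * freq L m / L * well t.
Proof.
move=> st; have p0 := (well_gt0 t).1 st; have f0 := freq_gt0 L0 m.
move: st; rewrite /side /= in_itv/= => /andP[t1 t2].
have h1 : `|mode L m 0 t| <= freq L m * (t + L / 2).
  rewrite modeE mul0r addr0; apply: sin_le_id; rewrite mulr_ge0 ?(ltW f0)//; lra.
have h2 : `|mode L m 0 t| <= freq L m * (L / 2 - t).
  have -> : `|mode L m 0 t| = `|sin (freq L m * (L / 2 - t))|.
    rewrite modeE mul0r addr0.
    have -> : freq L m * (t + L / 2) = m.+1%:R * pi - freq L m * (L / 2 - t).
      have <- : freq L m * L = m.+1%:R * pi by rewrite /freq mulfVK// gt_eqF.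
      by field.
    rewrite sinB sin_nat_pi mul0r sub0r normrN normrM.
    suff -> : `|cos (m.+1%:R * pi) : R| = 1 by rewrite mul1r.
    have := cos2Dsin2 (m.+1%:R * pi : R); rewrite sin_nat_pi expr0n addr0 => h.
    by apply/eqP; rewrite -sqr_norm_eq1 h.
  by apply: sin_le_id; rewrite mulr_ge0 ?(ltW f0)//; lra.
have wE : well t = (t + L / 2) * (L / 2 - t) by rewrite /well; ring.
have hL : 0 < freq L m / L by rewrite divr_gt0.
have [tn|tp] := leP t 0.
  apply: (le_trans h1).
  have -> : freq L m * (t + L / 2) = freq L m / L * (t + L / 2) * L by field; rewrite gt_eqF.
  rewrite wE (_ : 2 * _ / L * _ = freq L m / L * (t + L / 2) * (2 * (L / 2 - t))); last by field; rewrite gt_eqF.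
  rewrite ler_pM2l; first by lra.
  by rewrite mulr_gt0//; lra.
apply: (le_trans h2).
have -> : freq L m * (L / 2 - t) = freq L m / L * (L / 2 - t) * L by field; rewrite gt_eqF.
rewrite wE (_ : 2 * _ / L * _ = freq L m / L * (L / 2 - t) * (2 * (t + L / 2))); last by field; rewrite gt_eqF.
rewrite ler_pM2l; first by lra.
by rewrite mulr_gt0//; lra.
Qed.

Lemma cut'_mode_le m n t (y := n.+1%:R * well t - 1) :
  `|cut' n t * mode L m 0 t| <=
  if 0 < y then 2 * freq L m * (y^-1 ^+ 2 + y^-1) * expR (- y^-1) else 0.
Proof.
rewrite /cut' /flat -/y; case: ifPn => [y0|_]; last by rewrite !mul0r normr0.
have n0 : (0 : R) < n.+1%:R by [].
have p0 : 0 < well t.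
  rewrite -(pmulr_rgt0 _ n0); move: y0; rewrite /y; lra.
have st := (well_gt0 t).2 p0; have h := mode_well m st; have f0 := freq_gt0 L0 m.
have e0 := expR_gt0 (- y^-1); have yi : 0 < y^-1 by rewrite invr_gt0.
move: st; rewrite /side /= in_itv/= => /andP[t1 t2].
have tL : `|2 * t| <= L by rewrite ler_norml; apply/andP; split; lra.
have A0 : 0 <= y^-1 ^+ 2 by exact: exprn_ge0 (ltW yi).
have wy : n.+1%:R * well t = y + 1 by rewrite /y; ring.
have y2 : y^-1 ^+ 2 * (y + 1) = y^-1 ^+ 2 + y^-1 by field; rewrite gt_eqF.
rewrite -y2; move: (y^-1 ^+ 2) A0 (expR (- y^-1)) e0 (2 * t) tL => A A0 e e0 b bL.
rewrite !normrM normrN (ger0_norm A0) (gtr0_norm n0) (gtr0_norm e0).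
apply: (@le_trans _ _ (A * e * (n.+1%:R * L) * (2 * freq L m / L * well t))).
  apply: ler_pM => //.
    by apply: mulr_ge0; apply: mulr_ge0 => //; exact: ltW.
  by rewrite ler_wpM2l ?ler_pM2l//; apply: mulr_ge0 => //; exact: ltW.
rewrite -wy le_eqVlt; apply/orP; left; apply/eqP.
by field; rewrite gt_eqF.
Qed.

(** The bound does not depend on [n], which makes dominated convergence
    applicable: [y ^- 2 * exp (- 1 / y)] and [y ^- 1 * exp (- 1 / y)] are
    bounded by [2!] and [1!]. *)
Lemma cut'_mode_bounded m n t : `|cut' n t * mode L m 0 t| <= 2 * freq L m * 3.
Proof.
apply: (le_trans (cut'_mode_le m n t)); have f0 := freq_gt0 L0 m.
have F0 := ltW f0; case: ifPn => [y0|_]; last by apply: mulr_ge0 => //; exact: mulr_ge0.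
set y := _ - 1 in y0 *; have yi : 0 < y^-1 by rewrite invr_gt0.
have h2 := expRN_le 1 yi; have h1 := expRN_le 0 yi.
rewrite -(mulrA (2 * freq L m)) ler_pM2l; last by rewrite mulr_gt0.
by rewrite mulrDl; move: h1 h2; rewrite expr1 !factS fact0; lra.
Qed.

Lemma cut'_mode_cvg m t : side L t -> cut' n t * mode L m 0 t @[n --> \oo] --> (0 : R).
Proof.
move=> /well_gt0 p0; have h := scale_cvgy p0; have f0 := freq_gt0 L0 m.
apply: norm_cvg0.
have hb : 2 * freq L m * ((n.+1%:R * well t - 1)^-1 * (n.+1%:R * well t - 1)^-1 +
    (n.+1%:R * well t - 1)^-1) @[n --> \oo] --> (0 : R).
  rewrite -(mulr0 (2 * freq L m)); apply: cvgM; first exact: cvg_cst.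
  by rewrite -[X in _ --> X](addr0 (0 : R)); apply: cvgD => //; rewrite -(mulr0 0); exact: cvgM.
apply: (squeeze_cvgr _ (cvg_cst (0 : R)) hb); near=> n.
rewrite normr_ge0/=; apply: (le_trans (cut'_mode_le m n t)).
have y0 : 0 < n.+1%:R * well t - 1 by near: n; exact: scale_gt0.
set y := _ - 1 in y0 *; rewrite y0; have yi : 0 < y^-1 by rewrite invr_gt0.
rewrite -expr2 ler_piMr//; last by rewrite -expR0 ler_expR oppr_le0 ltW.
have F0 := ltW f0; have Y0 := ltW yi.
by apply: mulr_ge0; [exact: mulr_ge0|apply: addr_ge0 => //; exact: exprn_ge0].
Unshelve. all: by end_near. Qed.

End cutoff.

(** * Sine waves on the box *)

Section waves.
Context {R : realType} {d : nat} (L : R).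
Hypothesis L0 : 0 < L.
Local Notation mu_box := (@box_measure R d L).
Local Notation V := (LfunType (box_measure (d := d) L) (lee1n 2)).
Local Notation B := (L2_inner (box_measure (d := d) L)).
Local Notation idx := {ffun 'I_d -> nat}.
Implicit Types (f g : 'rV[R]_d -> R) (k l : idx) (c : 'I_d -> nat).

Definition toL2 f (h : L2box L f) : V := Lfun_Sub (lee1n 2) h.

Lemma bounded_L2box f (M : R) : measurable_fun setT f -> (forall x, `|f x| <= M) -> L2box L f.
Proof.
move=> mf fM; apply: Lfun2P => //.
have /integrableP[_] : (box_measure L).-integrable setT (EFin \o (fun x => f x ^+ 2)).
  apply: (@box_bounded_integrable _ _ L0 _ _ (M ^+ 2)); first exact: measurable_funX.
  by move=> x; rewrite normrX lerXn2r ?nnegrE// (le_trans _ (fM x)).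
apply: le_lt_trans; rewrite le_eqVlt; apply/orP; left; apply/eqP.
by apply: eq_integral => x _ /=; rewrite ger0_norm ?sqr_ge0.
Qed.

Lemma ae_boxP (P : 'rV[R]_d -> Prop) : (forall x, box L x -> P x) ->
  {ae box_measure L, forall x, P x}.
Proof.
move=> h; exists (~` box L); split.
- by apply: measurableC; exact: measurable_box.
- by rewrite /box_measure /= /mrestr setICl measure0.
- by move=> x /=; apply: contra_not => /h.
Qed.

Lemma bounded_cvg_L2 (f : nat -> 'rV[R]_d -> R) g (M : R) :
  (forall n, measurable_fun setT (f n)) -> measurable_fun setT g ->
  (forall n x, `|f n x| <= M) -> (forall x, `|g x| <= M) ->
  {ae mu_box, forall x, f n x @[n --> \oo] --> g x} ->
  inner L (f n \- g) (f n \- g) @[n --> \oo] --> (0 : R).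
Proof.
move=> mf mg fM gM fg.
pose h n x := ((f n x - g x) * (f n x - g x))%:E.
have mh n : measurable_fun setT (h n).
  by apply/measurable_EFinP; apply: measurable_funM; apply: measurable_funB.
have hcvg : {ae mu_box, forall x, setT x -> h n x @[n --> \oo] --> cst 0%E x}.
  apply: filterS fg => x fx _; rewrite /h /cst; apply: cvg_EFin; first exact: nearW.
  have h0 : f n x - g x @[n --> \oo] --> (0 : R).
    by rewrite -(subrr (g x)); apply: cvgB => //; exact: cvg_cst.
  by rewrite -(mulr0 (0 : R)); exact: cvgM.
have ih : (mu_box).-integrable setT (EFin \o cst ((2 * M) ^+ 2)).
  exact: (@box_bounded_integrable _ _ L0 _ _ `|(2 * M) ^+ 2|).
have hb : {ae mu_box, forall x, forall n, setT x -> (`|h n x| <= (EFin \o cst ((2 * M) ^+ 2)%R) x)%E}.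
  apply: aeW => x n _; rewrite /h /= lee_fin -expr2 normrX.
  rewrite lerXn2r ?nnegrE//.
    by rewrite mulr_ge0// (le_trans _ (gM x)).
  by rewrite (le_trans (ler_normB _ _))// mulr2n mulrDl mul1r lerD.
have [_ _ H] := dominated_convergence measurableT mh (measurable_cst _) hcvg ih hb.
by move: H; rewrite integral0 => /fine_cvg.
Qed.

Definition nmode (m c : nat) (t : R) : R := Num.sqrt (2 / L) * mode L m c t.

(** For [c = 0] these are the Dirichlet eigenfunctions of the Laplacian. Their
    mixed derivatives are multiples of waves with the same [k] and another [c],
    and for every fixed [c] the waves are orthonormal. *)
Definition wave k c : 'rV[R]_d -> R := tens (fun i => nmode (k i) (c i)).

(** How a partial derivative in direction [j] acts on the phases. *)
Definition turn c (j : 'I_d) : 'I_d -> nat := fun i => (c i + (i == j))%N.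

Lemma nmode_derivative m (c : nat) : has_derivative (nmode m c) (fun t => freq L m * nmode m c.+1 t).
Proof.
move=> t; apply: (is_derive_eq (has_derivativeM (has_derivative_cst (Num.sqrt (2 / L))) (mode_derivative L m c) t)).
by rewrite /nmode; ring.
Qed.

Lemma smooth1_nmode m (c : nat) : smooth1 (nmode m c).
Proof. by apply: smooth1M; [exact: smooth1_cst|exact: smooth1_mode]. Qed.

Lemma nmode_le m (c : nat) t : `|nmode m c t| <= Num.sqrt (2 / L).
Proof. by rewrite normrM ger0_norm ?sqrtr_ge0// ler_piMr ?sqrtr_ge0// mode_le1. Qed.

Lemma smooth_wave k c : smooth (wave k c).
Proof. by apply: smooth_tens => i; exact: smooth1_nmode. Qed.

Lemma tens_le (f : 'I_d -> R -> R) (C : 'I_d -> R) x :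
  (forall i t, `|f i t| <= C i) -> `|tens f x| <= \prod_i C i.
Proof. by move=> fC; rewrite normr_prod; apply: ler_prod => i _; rewrite normr_ge0 fC. Qed.

Lemma wave_le k c x : `|wave k c x| <= \prod_(i < d) Num.sqrt (2 / L).
Proof. by apply: tens_le => i t; exact: nmode_le. Qed.

Lemma measurable_wave k c : measurable_fun setT (wave k c).
Proof. by apply: continuous_measurable; apply: smooth_continuous; exact: smooth_wave. Qed.

Lemma wave_L2 k c : L2box L (wave k c).
Proof. exact: bounded_L2box (measurable_wave k c) (wave_le k c). Qed.

Lemma partial_wave k c j : partial j (wave k c) = fun x => freq L (k j) * wave k (turn c j) x.
Proof.
rewrite (partial_tens (nmode_derivative _ _)); apply/funext => x.
rewrite tens_upd /wave (tensD1 _ j) -mulrA /turn eqxx addn1; congr (_ * (_ * _)).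
by apply: eq_bigr => i /negPf ij; rewrite ij addn0.
Qed.

Lemma wave_turn2 k c j x : wave k (turn (turn c j) j) x = - wave k c x.
Proof.
rewrite /wave !(tensD1 _ j) /turn eqxx !addn1 -mulNr; congr (_ * _).
  by rewrite /nmode mode_opp mulrN.
by apply: eq_bigr => i /negPf ij; rewrite ij !addn0.
Qed.

Definition ewave k c : V := toL2 (wave_L2 k c).

Lemma wave_orthonormal c : orthonormal B (ewave ^~ c).
Proof.
move=> k l; rewrite /= /L2_ip /=.
transitivity (\int[mu_box]_x (\prod_(i < d) ((2 / L) *
    (mode L (k i) (c i) (x ord0 i) * mode L (l i) (c i) (x ord0 i))))).
  apply: eq_Rintegral => x _; rewrite -big_split/=; apply: eq_bigr => i _.
  rewrite /nmode mulrACA -expr2 sqr_sqrtr// divr_ge0// ltW//.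
have mm (i : 'I_d) : measurable_fun setT (fun t : R => mode L (k i) (c i) t * mode L (l i) (c i) t).
  by apply: measurable_funM; exact: measurable_mode.
have m1 (i : 'I_d) (t : R) : `|mode L (k i) (c i) t * mode L (l i) (c i) t| <= 1.
  by rewrite normrM mulr_ile1// ?normr_ge0 ?mode_le1.
under eq_Rintegral do rewrite big_split/=.
rewrite RintegralZl//; last first.
  apply: (@box_bounded_integrable _ _ L0 _ _ (\prod_(i < d) 1)).
    apply: continuous_measurable; apply: (@continuous_tens _ _ (fun i t => mode L (k i) (c i) t * mode L (l i) (c i) t)) => i t.
    by apply: (@continuousM _ _ (mode L (k i) (c i))); apply: smooth1_continuous; exact: smooth1_mode.
  by move=> x; exact: (@tens_le (fun i t => mode L (k i) (c i) t * mode L (l i) (c i) t)).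
rewrite (box_integral_prod L0 mm m1) -big_split/=.
transitivity (\prod_(i < d) (k i == l i)%:R : R).
  apply: eq_bigr => i _; rewrite (mode_ortho L0); field; rewrite gt_eqF//.
have [->|/eqP kl] := eqVneq k l; first by rewrite big1// => i _; rewrite eqxx.
have [i il] : exists i, k i != l i.
  by apply: contra_notP kl => h; apply/ffunP => i; apply: contrapT => /eqP ki; apply: h; exists i.
by rewrite (bigD1 i)//= (negPf il) mul0r.
Qed.

Definition wave_box (N : nat) : seq idx :=
  [seq [ffun i => nat_of_ord (h i)] | h : {ffun 'I_d -> 'I_N}].

Lemma mem_wave_box N k : (k \in wave_box N) = [forall i, k i < N]%N.
Proof.
apply/idP/forallP => [/mapP[h _ ->] i|h]; first by rewrite ffunE ltn_ord.
apply/mapP; exists [ffun i => Ordinal (h i)]; first by rewrite mem_enum.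
by apply/ffunP => i; rewrite !ffunE.
Qed.

Lemma wave_box_exhaustion : exhaustion wave_box.
Proof.
split.
- move=> N; rewrite map_inj_uniq ?enum_uniq// => h1 h2 /ffunP e.
  by apply/ffunP => i; apply/val_inj; have := e i; rewrite !ffunE.
- move=> m n mn k; rewrite !mem_wave_box => /forallP h; apply/forallP => i.
  exact: leq_trans (h i) mn.
- move=> k; exists (\max_i (k i)).+1; rewrite mem_wave_box; apply/forallP => i.
  by rewrite ltnS; exact: leq_bigmax.
Qed.

Definition wave_energy k : R := \sum_i freq L (k i) ^+ 2.

Lemma wave_energy_ge0 k : 0 <= wave_energy k.
Proof. by apply: sumr_ge0 => i _; exact: sqr_ge0. Qed.

Lemma wave_energy_oo (M : R) : exists N, forall k, k \notin wave_box N -> M <= wave_energy k.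
Proof.
have p0 : 0 < pi / L by rewrite divr_gt0// pi_gt0.
pose N := Num.truncn ((`|M| + 1) / (pi / L)); exists N => k.
rewrite mem_wave_box negb_forall => /existsP[i]; rewrite -leqNgt => Ni.
have h1 : `|M| + 1 <= freq L (k i).
  rewrite /freq -mulrA -ler_pdivrMr//.
  have := truncnS_gt ((`|M| + 1) / (pi / L)); rewrite -/N => /ltW h; apply: (le_trans h).
  by rewrite ler_nat ltnS.
apply: (@le_trans _ _ (freq L (k i) ^+ 2)); last first.
  by rewrite /wave_energy (bigD1 i)//= lerDl; apply: sumr_ge0 => j _; exact: sqr_ge0.
have := ler_norm M; have := normr_ge0 M; nra.
Qed.

End waves.

(** * Approximation of waves by test functions *)

Section cutoff_approximation.
Context {R : realType} {d : nat} (L : R).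
Hypothesis L0 : 0 < L.
Local Notation mu_box := (@box_measure R d L).
Local Notation V := (LfunType (box_measure (d := d) L) (lee1n 2)).
Local Notation B := (L2_inner (box_measure (d := d) L)).
Local Notation idx := {ffun 'I_d -> nat}.
Implicit Types (k l : idx) (c : 'I_d -> nat).

Lemma tens_cvg (f : nat -> 'I_d -> R -> R) (g : 'I_d -> R -> R) (x : 'rV[R]_d) :
  (forall i, f n i (x ord0 i) @[n --> \oo] --> g i (x ord0 i)) ->
  tens (f n) x @[n --> \oo] --> tens g x.
Proof.
move=> fg; rewrite /tens; elim: (index_enum _) => [|i r IH].
  by under eq_fun do rewrite big_nil; rewrite big_nil; exact: cvg_cst.
by under eq_fun do rewrite big_cons; rewrite big_cons; exact: cvgM (fg i) IH.
Qed.

Lemma tens_cvg_L2 (f : nat -> 'I_d -> R -> R) (g : 'I_d -> R -> R) (C : 'I_d -> R) :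
  (forall n i, measurable_fun setT (f n i)) -> (forall i, measurable_fun setT (g i)) ->
  (forall n i t, `|f n i t| <= C i) -> (forall i t, `|g i t| <= C i) ->
  (forall i t, side L t -> f n i t @[n --> \oo] --> g i t) ->
  inner L (tens (f n) \- tens g) (tens (f n) \- tens g) @[n --> \oo] --> (0 : R).
Proof.
move=> cf cg fC gC fg.
have mt (h : 'I_d -> R -> R) : (forall i, measurable_fun setT (h i)) ->
    measurable_fun [set: 'rV[R]_d] (tens h).
  move=> mh; apply: measurable_prod => i _.
  exact: (measurableT_comp (mh i) (measurable_coord i)).
apply: (bounded_cvg_L2 L0 (M := \prod_i C i)).
- by move=> n; apply: mt => i; exact: cf.
- exact: mt.
- by move=> n x; apply: tens_le; exact: fC.
- by move=> x; exact: tens_le.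
- apply: ae_boxP => x xb; apply: tens_cvg => i; apply: fg.
  by have := xb i; rewrite /side /= in_itv.
Qed.

Definition cut_tens n (f : 'I_d -> R -> R) : 'rV[R]_d -> R :=
  tens (fun i t => cut L n t * f i t).

Lemma test_function_cut n f : (forall i, smooth1 (f i)) -> test_function L (cut_tens n f).
Proof.
move=> sf; have [a aL ha] := cut_support L0 n.
apply: (test_functionP aL).
  by apply: smooth_tens => i; apply: smooth1M => //; exact: smooth1_cut.
move=> x; rewrite /cut_tens => + i; rewrite (tensD1 _ i).
by rewrite !mulf_eq0 !negb_or -andbA => /and3P[/ha].
Qed.

Definition cutwave n k c := cut_tens n (fun i => nmode L (k i) (c i)).

Lemma test_function_cutwave n k c : test_function L (cutwave n k c).
Proof. by apply: test_function_cut => i; exact: smooth1_nmode. Qed.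

Lemma measurable_smooth1 (f : R -> R) : smooth1 f -> measurable_fun setT f.
Proof. by move=> sf; apply: continuous_measurable_fun; exact: smooth1_continuous. Qed.

Lemma cut_nmode_le n m (c : nat) t : `|cut L n t * nmode L m c t| <= Num.sqrt (2 / L).
Proof.
rewrite normrM -[leRHS]mul1r; apply: ler_pM => //; first exact: cut_le1.
exact: nmode_le.
Qed.

Lemma cut_nmode_cvg m (c : nat) t : side L t ->
  cut L n t * nmode L m c t @[n --> \oo] --> nmode L m c t.
Proof.
by move=> st; rewrite -[X in _ --> X]mul1r; apply: cvgM; [exact: cut_cvg|exact: cvg_cst].
Qed.

Lemma cutwave_cvg k c :
  inner L (cutwave n k c \- wave L k c) (cutwave n k c \- wave L k c) @[n --> \oo] --> (0 : R).
Proof.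
apply: (@tens_cvg_L2 (fun n i t => cut L n t * nmode L (k i) (c i) t) _ (fun=> Num.sqrt (2 / L))).
- by move=> n i; apply: measurable_smooth1; apply: smooth1M; [exact: smooth1_cut|exact: smooth1_nmode].
- by move=> i; apply: measurable_smooth1; exact: smooth1_nmode.
- by move=> n i t; exact: cut_nmode_le.
- by move=> i t; exact: nmode_le.
- by move=> i t; exact: cut_nmode_cvg.
Qed.

(** With [cutwave_cvg], the Dirichlet waves are limits of test functions in the
    [H^1] norm: where the derivative falls on the cutoff, its product with the
    sine stays bounded and tends to 0 inside the box. *)
Lemma partial_cutwave_cvg k (j : 'I_d) (c0 := (fun=> 0%N) : 'I_d -> nat) :
  inner L (partial j (cutwave n k c0) \- partial j (wave L k c0))
          (partial j (cutwave n k c0) \- partial j (wave L k c0)) @[n --> \oo] --> (0 : R).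
Proof.
have s0 := sqrtr_ge0 (2 / L).
pose b : R := freq L (k j).
have b0 : 0 < b by exact: freq_gt0.
pose D n t := cut' L n t * nmode L (k j) 0 t + cut L n t * (b * nmode L (k j) 1 t).
have hD n : has_derivative (fun t => cut L n t * nmode L (k j) 0 t) (D n).
  move=> t; apply: (is_derive_eq (has_derivativeM (cut_derivative L n) (nmode_derivative L (k j) 0) t)).
  by [].
have e1 n : partial j (cutwave n k c0) =
    tens (upd (fun i t => cut L n t * nmode L (k i) 0 t) j (D n)).
  by rewrite /cutwave /cut_tens; exact: (partial_tens (hD n)).
have e2 : partial j (wave L k c0) =
    tens (upd (fun i => nmode L (k i) 0) j (fun t => b * nmode L (k j) 1 t)).
  by rewrite /wave; exact: (partial_tens (nmode_derivative _ _ _)).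
rewrite e2; under eq_fun do rewrite e1.
apply: (@tens_cvg_L2 (fun n => upd (fun i t => cut L n t * nmode L (k i) 0 t) j (D n)) _
  (fun i => Num.sqrt (2 / L) + (i == j)%:R * (Num.sqrt (2 / L) * (2 * b * 3) + b * Num.sqrt (2 / L)))).
- move=> n i; rewrite /upd; case: eqP => _; last first.
    by apply: measurable_smooth1; apply: smooth1M; [exact: smooth1_cut|exact: smooth1_nmode].
  have [D' hD' sD'] := smooth1_derivative (smooth1M (smooth1_cut L n) (smooth1_nmode L (k j) 0)).
  by rewrite (has_derivative_unique (hD n) hD'); exact: measurable_smooth1.
- move=> i; rewrite /upd; case: eqP => _; apply: measurable_smooth1.
    by apply: smooth1M; [exact: smooth1_cst|exact: smooth1_nmode].
  exact: smooth1_nmode.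
- move=> n i t; rewrite /upd; case: eqP => _.
    rewrite mul1r; apply: (le_trans (ler_normD _ _)); rewrite -[leLHS]add0r lerD//.
    apply: lerD.
      rewrite /nmode mulrCA normrM (ger0_norm s0) ler_wpM2l//.
      exact: cut'_mode_bounded.
    rewrite mulrCA normrM (gtr0_norm b0) ler_pM2l//; exact: cut_nmode_le.
  by rewrite mul0r addr0; exact: cut_nmode_le.
- move=> i t; rewrite /upd; case: eqP => _.
    rewrite mul1r normrM (gtr0_norm b0) -[leLHS]add0r lerD// -[leLHS]add0r lerD//.
      by apply: mulr_ge0 => //; apply: mulr_ge0 => //; apply: mulr_ge0 => //; exact: ltW.
    by rewrite ler_pM2l//; exact: nmode_le.
  by rewrite mul0r addr0; exact: nmode_le.
- move=> i t st; rewrite /upd; case: eqP => _; last exact: cut_nmode_cvg.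
  rewrite -[X in _ --> X]add0r; apply: cvgD.
    rewrite /nmode; under eq_fun do rewrite mulrCA.
    rewrite -(mulr0 (Num.sqrt (2 / L))); apply: cvgM; first exact: cvg_cst.
    exact: cut'_mode_cvg.
  under eq_fun do rewrite mulrCA.
  by apply: cvgM; [exact: cvg_cst|exact: cut_nmode_cvg].
Qed.

Lemma L2_sumE (I : Type) (r : seq I) (F : I -> V) x :
  (\sum_(i <- r) F i : V) x = \sum_(i <- r) F i x.
Proof. by elim: r => [|i r IH]; rewrite ?big_nil// !big_cons -IH. Qed.

End cutoff_approximation.

(** * Completeness of the sine waves *)

Section kuhn.
Context {R : realType}.
Implicit Types (b w x : R) (n : nat).

Lemma bernoulli_ineq x n : -1 <= x -> 1 + n%:R * x <= (1 + x) ^+ n.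
Proof.
move=> x1; have [p0|] := leP 0 (1 + n%:R * x); last first.
  by move=> h; apply: (le_trans (ltW h)); apply: exprn_ge0; lra.
elim: n p0 => [|n IH]; first by rewrite mul0r addr0 expr0.
rewrite exprS -natr1 => p0; have n0 : (0 : R) <= n%:R by [].
have x0 : 0 <= 1 + x by lra.
have q0 : 0 <= 1 + n%:R * x by have [|] := leP 0 x; nra.
by have := ler_wpM2l x0 (IH q0); have := sqr_ge0 x; nra.
Qed.

(** The slope 1/8 keeps the base between 0 and 1 for [w] and [b] in the range of
    the sine. *)
Definition kuhn_base n b w : R := 2^-1 + (w - b) / 8 - n.+1%:R^-1 / 4.

(** Kuhn's approximation of a step: [(1 - s ^+ N) ^+ 2 ^ N] tends to 1 for
    [s < 1/2] and to 0 for [s > 1/2]. The shift by [(n+1)^-1 / 4] in the base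
    puts the equality case [w = b] on the side of the limit 1, and [N] grows
    like the square of the inverse shift to outrun it. *)
Definition kuhn n b w : R := (1 - kuhn_base n b w ^+ (n.+1 ^ 2)) ^+ (2 ^ (n.+1 ^ 2)).

Lemma inv_natS n : 0 < (n.+1%:R^-1 : R) <= 1.
Proof. by rewrite invr_gt0 ltr0Sn invf_le1//= ler1n. Qed.

Section values.
Variables (b w : R).
Hypotheses (b1 : `|b| <= 1) (w1 : `|w| <= 1).

Lemma kuhn_base_itv n : 0 <= kuhn_base n b w <= 1.
Proof.
have /andP[] := inv_natS n; move: b1 w1; rewrite /kuhn_base !ler_norml.
by move: (n.+1%:R^-1) => e /andP[? ?] /andP[? ?] ? ?; apply/andP; split; lra.
Qed.

Lemma kuhn_itv n : 0 <= kuhn n b w <= 1.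
Proof.
have /andP[s0 s1] := kuhn_base_itv n.
have s2 : 0 <= kuhn_base n b w ^+ (n.+1 ^ 2) <= 1.
  by rewrite exprn_ge0//= exprn_ile1.
by move: s2 => /andP[? ?]; rewrite /kuhn exprn_ge0 ?exprn_ile1//; lra.
Qed.

(** Bernoulli's inequality for [(1 - s ^+ N) ^+ 2 ^ N] when [w <= b], and for
    [(1 + s ^+ N) ^+ 2 ^ N], whose product with the former is at most 1,
    otherwise. *)
Lemma kuhn_cvg : kuhn n b w @[n --> \oo] --> ((w <= b)%R%:R : R).
Proof.
have hc (C : R) : C * n.+1%:R^-1 @[n --> \oo] --> (0 : R).
  rewrite -(mulr0 C); apply: cvgM; first exact: cvg_cst.
  exact: cvg_harmonic.
pose N n := (n.+1 ^ 2)%N.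
have NE n : (N n)%:R = n.+1%:R ^+ 2 :> R by rewrite natrX.
have two n : (2 * kuhn_base n b w) ^+ (N n) = (2 ^ N n)%:R * kuhn_base n b w ^+ (N n).
  by rewrite exprMn natrX.
have sN n : 0 <= kuhn_base n b w ^+ (N n) <= 1.
  have /andP[s0 s1] := kuhn_base_itv n.
  by rewrite exprn_ge0//= exprn_ile1.
have [wb|bw] := leP w b.
  have h1 : 1 - 2 * n.+1%:R^-1 @[n --> \oo] --> (1 : R).
    by rewrite -[X in _ --> X]subr0; apply: cvgB; [exact: cvg_cst|exact: hc].
  apply: (squeeze_cvgr _ h1 (cvg_cst (1 : R))); apply: nearW => n.
  have /andP[_ ->] := kuhn_itv n; rewrite andbT.
  have /andP[s0 s1] := kuhn_base_itv n; have /andP[t0 t1] := sN n.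
  have /andP[e0 e1] := inv_natS n.
  have := @bernoulli_ineq (- kuhn_base n b w ^+ (N n)) (2 ^ N n)%N.
  rewrite mulrN -two => /(_ ltac:(lra)); apply: le_trans.
  rewrite lerD2l lerN2; set y := 2 * kuhn_base n b w.
  have y0 : 0 <= y by rewrite /y; lra.
  have hy : y * (1 + n.+1%:R^-1 / 2) <= 1.
    have : y <= 1 - n.+1%:R^-1 / 2 by rewrite /y /kuhn_base; move: wb; move: (n.+1%:R^-1) => e ?; lra.
    by move: y0 (n.+1%:R^-1) e0 => y0 e e0; nra.
  have em : -1 <= (n.+1%:R^-1 : R) / 2 by move: (n.+1%:R^-1) e0 => e e0; lra.
  have h2 := @bernoulli_ineq (n.+1%:R^-1 / 2) (N n) em.
  have h3 : y ^+ N n * (1 + (N n)%:R * (n.+1%:R^-1 / 2)) <= 1.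
    apply: (@le_trans _ _ (y ^+ N n * (1 + n.+1%:R^-1 / 2) ^+ N n)).
      by apply: ler_wpM2l => //; exact: exprn_ge0.
    by rewrite -exprMn exprn_ile1// mulr_ge0//; lra.
  have : y ^+ N n * (n.+1%:R / 2) <= 1.
    apply: le_trans h3; apply: ler_wpM2l; first exact: exprn_ge0.
    by rewrite NE expr2 mulrA mulfK// lerDr.
  by rewrite mulrA ler_pdivrMr// mul1r -ler_pdivlMr.
have dlt0 : 0 < w - b by lra.
apply: (squeeze_cvgr _ (cvg_cst (0 : R)) (hc (8 / (w - b)))); near=> n.
have /andP[-> _] := kuhn_itv n; rewrite /=.
have en : n.+1%:R^-1 < (w - b) / 4.
  by near: n; apply: (cvgr_lt 0 (@cvg_harmonic R)); lra.
have /andP[s0 s1] := kuhn_base_itv n; have /andP[t0 t1] := sN n.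
have /andP[e0 e1] := inv_natS n.
set y := 2 * kuhn_base n b w.
have hy : 1 + (w - b) / 8 <= y.
  by rewrite /y /kuhn_base; move: (n.+1%:R^-1) en => e en; lra.
have h1 : n.+1%:R * ((w - b) / 8) <= y ^+ N n.
  apply: (@le_trans _ _ (1 + (N n)%:R * ((w - b) / 8))).
    have n1 : (1 : R) <= n.+1%:R by rewrite ler1n.
    have n2 : n.+1%:R <= (N n)%:R :> R by rewrite NE; nra.
    by nra.
  apply: (le_trans (@bernoulli_ineq ((w - b) / 8) (N n) ltac:(lra))).
  by apply: lerXn2r => //; rewrite nnegrE; lra.
have h2 := @bernoulli_ineq (kuhn_base n b w ^+ N n) (2 ^ N n) ltac:(lra).
rewrite -two -/y in h2.
have h3 : kuhn n b w * (1 + kuhn_base n b w ^+ N n) ^+ (2 ^ N n) <= 1.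
  rewrite /kuhn -exprMn exprn_ile1//; last by nra.
  by rewrite mulr_ge0//; rewrite -/(N n); lra.
have /andP[k0 k1] := kuhn_itv n.
have h4 : kuhn n b w * (n.+1%:R * ((w - b) / 8)) <= 1.
  apply: le_trans h3; apply: ler_wpM2l => //; move: h2 h1; lra.
rewrite [leRHS](_ : _ = 1 / (n.+1%:R * ((w - b) / 8))); last first.
  by rewrite div1r invfM invf_div mulrC.
rewrite ler_pdivlMr//.
by rewrite mulr_gt0// divr_gt0.
Unshelve. all: by end_near. Qed.

End values.

Lemma kuhn_poly n b : exists p : {poly R}, forall w, p.[w] = kuhn n b w.
Proof.
exists ((1 - (8^-1 *: 'X + (2^-1 - b / 8 - n.+1%:R^-1 / 4)%:P) ^+ (n.+1 ^ 2)) ^+ (2 ^ (n.+1 ^ 2))).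
move=> w; rewrite horner_exp hornerD hornerN hornerC horner_exp hornerD hornerZ hornerX hornerC.
congr ((1 - _ ^+ _) ^+ _).
by rewrite /kuhn_base; move: (n.+1%:R^-1) => e; lra.
Qed.

End kuhn.

Section sine_algebra.
Context {R : realType} (L : R).
Hypothesis L0 : 0 < L.
Implicit Types (f g : R -> R).

Definition sine_span f := exists r : seq (R * nat),
  f = fun t => \sum_(p <- r) p.1 * nmode L p.2 0 t.

Lemma sine_span_lin a f g : sine_span f -> sine_span g -> sine_span (fun t => a * f t + g t).
Proof.
move=> [r ->] [s ->]; exists ([seq (a * p.1, p.2) | p <- r] ++ s).
apply/funext => t; rewrite big_cat big_map mulr_sumr/=; congr (_ + _).
by apply: eq_bigr => p _; rewrite mulrA.
Qed.

Lemma sine_span0 : sine_span (fun=> 0).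
Proof. by exists [::]; apply/funext => t; rewrite big_nil. Qed.

Lemma sine_span_mode m : sine_span (nmode L m 0).
Proof. by exists [:: (1, m)]; apply/funext => t; rewrite big_seq1 mul1r. Qed.

(** An increasing coordinate on the side. Multiplying a sine mode by it gives a
    combination of the two neighbouring modes. *)
Definition side_coord (t : R) : R := sin (pi / L * t).

Lemma mode_side_coord m t : side_coord t * mode L m 0 t =
  - 2^-1 * mode L m.+1 0 t + - 2^-1 * (if m is m'.+1 then mode L m' 0 t else 0).
Proof.
pose th : R := pi / L * (t + L / 2).
have -> : side_coord t = - cos th.
  rewrite /side_coord (_ : pi / L * t = th - pi / 2); last by rewrite /th; field; rewrite gt_eqF.
  by rewrite sinBpihalf.
have mE j : mode L j 0 t = sin (j.+1%:R * th).
  by rewrite modeE mul0r addr0 /freq /th !mulrA.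
rewrite (_ : (if m is m'.+1 then _ else _) = sin (m%:R * th)); last first.
  by case: m => [|m]; rewrite ?mE// mul0r sin0.
rewrite !mE.
have -> : m.+2%:R * th = m.+1%:R * th + th by rewrite -(natr1 m.+1); ring.
have -> : m%:R * th = m.+1%:R * th - th by rewrite -(natr1 m); ring.
by rewrite sinD sinB; field.
Qed.

Lemma sine_span_side_coord f : sine_span f -> sine_span (fun t => side_coord t * f t).
Proof.
case=> r ->; elim: r => [|[a m] r IH].
  by under eq_fun do rewrite big_nil mulr0; exact: sine_span0.
have -> : (fun t => side_coord t * \sum_(p <- (a, m) :: r) p.1 * nmode L p.2 0 t) =
    fun t => a * (side_coord t * nmode L m 0 t) + side_coord t * \sum_(p <- r) p.1 * nmode L p.2 0 t.
  by apply/funext => t; rewrite big_cons mulrDr mulrCA.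
apply: sine_span_lin IH => {a r}.
have -> : (fun t => side_coord t * nmode L m 0 t) = fun t => - 2^-1 * nmode L m.+1 0 t +
    (- 2^-1 * (if m is m'.+1 then nmode L m' 0 t else 0) + 0).
  apply/funext => t; rewrite /nmode mulrCA mode_side_coord.
  by case: m => [|m]; ring.
apply: sine_span_lin; first exact: sine_span_mode.
apply: (@sine_span_lin _ (fun t => if m is m'.+1 then nmode L m' 0 t else 0) (fun=> 0)).
  by case: m => [|m]; [exact: sine_span0|exact: sine_span_mode].
exact: sine_span0.
Qed.

Lemma sine_span_poly (p : {poly R}) : sine_span (fun t => nmode L 0 0 t * p.[side_coord t]).
Proof.
elim/poly_ind: p => [|p c IH].
  by under eq_fun do rewrite horner0 mulr0; exact: sine_span0.
have -> : (fun t => nmode L 0 0 t * (p * 'X + c%:P).[side_coord t]) =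
    fun t => c * nmode L 0 0 t + side_coord t * (nmode L 0 0 t * p.[side_coord t]).
  by apply/funext => t; rewrite hornerMXaddC; ring.
by apply: sine_span_lin; [exact: sine_span_mode|exact: sine_span_side_coord].
Qed.

(** Clamping [a] to the closed side makes [ray_levelP] hold for all [a]. *)
Definition ray_level (a : R) : R := side_coord (Num.max (- (L / 2)) (Num.min a (L / 2))).

Lemma ray_levelP a t : side L t -> (t <= a) = (side_coord t <= ray_level a).
Proof.
rewrite /ray_level /side/= in_itv/= => /andP[t1 t2]; have p0 : 0 < pi / L by rewrite divr_gt0// pi_gt0.
have LL : - (L / 2) < L / 2 by lra.
set c := Num.max _ _; have [c1 c2] : - (L / 2) <= c /\ c <= L / 2.
  by rewrite /c le_max lexx ge_max (ltW LL) ge_min lexx orbT.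
have -> : (t <= a) = (t <= c) by rewrite /c le_max le_min (leNgt t (- _)) t1/= (ltW t2) andbT.
have hE s : - (L / 2) <= s -> s <= L / 2 -> pi / L * s \in `[ (- (pi / 2)), (pi / 2)].
  move=> s1 s2; rewrite in_itv/= (_ : pi / 2 = pi / L * (L / 2)); last by field; rewrite gt_eqF.
  by rewrite -mulrN !ler_pM2l// s1.
rewrite /side_coord !leNgt ltr_sin ?hE ?(ltW t1) ?(ltW t2)//.
by rewrite ltr_pM2l.
Qed.

Lemma nmode0_gt0 t : side L t -> 0 < nmode L 0 0 t.
Proof.
rewrite /side/= in_itv/= => /andP[t1 t2].
rewrite /nmode mulr_gt0 ?sqrtr_gt0 ?divr_gt0// modeE mul0r addr0.
have p0 := pi_gt0 R; rewrite sin_gt0_pi// /freq mul1r mulr_gt0 ?divr_gt0//=; last by lra.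
by rewrite -mulrA mulrC gtr_pMl// mulrC ltr_pdivrMr//; lra.
Qed.

End sine_algebra.

Section completeness.
Context {R : realType} {d : nat} (L : R).
Hypothesis L0 : 0 < L.
Local Notation mu_box := (@box_measure R d L).
Local Notation V := (LfunType (box_measure (d := d) L) (lee1n 2)).
Local Notation B := (L2_inner (box_measure (d := d) L)).
Local Notation idx := {ffun 'I_d -> nat}.
Implicit Types (f : 'I_d -> R -> R) (a : 'I_d -> R).

Section orthogonal.
Variable u : V.
Hypothesis uw : forall k : idx, B u (ewave L0 k (fun=> 0%N)) = 0.

(** Multilinearity: the factors are expanded into modes one by one, the
    induction running over the coordinates not yet reduced to a mode. *)
Lemma orthogonal_tens f : (forall i, sine_span L (f i)) ->
  exists2 h : L2box L (tens f), True & B u (toL2 h) = 0.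
Proof.
suff main (r : seq 'I_d) g : (forall i, i \in r -> sine_span L (g i)) ->
    (forall i, i \notin r -> exists m, g i = nmode L m 0) ->
    exists2 h : L2box L (tens g), True & B u (toL2 h) = 0.
  by move=> sf; apply: (main (index_enum _)) => // i; rewrite mem_index_enum.
elim: r g => [|j r IH] g sg mg.
  have {}mg i : exists m, g i = nmode L m 0 by exact: mg.
  have /choice[m gm] := mg.
  have -> : g = fun i => nmode L (m i) 0 by exact/funext.
  have -> : tens (fun i => nmode L (m i) 0) = wave L [ffun i => m i] (fun=> 0%N).
    by apply/funext => x; apply: eq_bigr => i _; rewrite ffunE.
  by exists (wave_L2 L0 _ _) => //; exact: uw.
have [s gs] := sg j (mem_head _ _).
have /choice[h hP] (p : R * nat) : exists v : V, v = tens (upd g j (nmode L p.2 0)) :> (_ -> _) /\ B u v = 0.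
  have [|i ir|h _ uh] := IH (upd g j (nmode L p.2 0)).
  - move=> i ir; rewrite /upd; case: eqP => [_|_]; first by exists [:: (1, p.2)]; apply/funext => t; rewrite big_seq1 mul1r.
    by apply: sg; rewrite inE ir orbT.
  - rewrite /upd; case: eqVneq => [_|ij]; first by exists p.2.
    by apply: mg; rewrite inE negb_or ij.
  by exists (toL2 h).
pose w : V := \sum_(p <- s) p.1 *: h p.
have wE : w = tens g :> (_ -> _).
  apply/funext => x; rewrite /w L2_sumE (tensD1 g j) gs mulr_suml; apply: eq_bigr => p _.
  by rewrite -mulrA -tens_upd -(hP p).1.
have hw : L2box L (tens g) by rewrite /L2box -wE; exact: LfunP.
exists hw => //; have -> : toL2 hw = w by apply/LfuneqP => x; rewrite wE.
by rewrite /w ip_sumr big1// => p _; rewrite ipZr (hP p).2 mulr0.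
Qed.

Definition orthant a : set 'rV[R]_d := [set x | forall i, x ord0 i <= a i].

Definition orthant_weight a : 'rV[R]_d -> R :=
  tens (fun i t => nmode L 0 0 t * (side_coord L t <= ray_level L (a i))%R%:R).

Lemma continuous_side_coord : continuous (side_coord L).
Proof.
move=> t; apply: (cvg_comp (fun t => pi / L * t) sin); last exact: continuous_sin.
by apply: cvgM; [exact: cvg_cst|exact: cvg_id].
Qed.

Lemma measurable_orthant_factor a i :
  measurable_fun setT (fun t => nmode L 0 0 t * ((side_coord L t <= ray_level L (a i))%R%:R : R)).
Proof.
apply: measurable_funM; first by apply: measurable_smooth1; exact: smooth1_nmode.
have -> : (fun t => (side_coord L t <= ray_level L (a i))%R%:R : R) =
   \1_[set t | side_coord L t <= ray_level L (a i)].
  apply/funext => t; rewrite indicE.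
  by suff -> : (t \in [set t | side_coord L t <= ray_level L (a i)]) = (side_coord L t <= ray_level L (a i)) by []; apply/idP/idP => [/set_mem|/mem_set].
apply: measurable_indic; rewrite -[X in measurable X]setTI.
have -> : [set t | side_coord L t <= ray_level L (a i)] = side_coord L @^-1` `]-oo, ray_level L (a i)].
  by apply/seteqP; split => t /=; rewrite in_itv.
by apply: (continuous_measurable_fun continuous_side_coord).
Qed.

Lemma measurable_orthant_weight a : measurable_fun setT (orthant_weight a).
Proof.
apply: measurable_prod => i _.
exact: (measurableT_comp (measurable_orthant_factor a i) (measurable_coord i)).
Qed.

(** The weight is the limit of products of polynomials in the [side_coord],
    to which [orthogonal_tens] applies. *)
Lemma orthogonal_orthant a : inner L u (orthant_weight a) = 0.
Proof.
have /choice[p pP] (n : nat) : exists q : 'I_d -> {poly R},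
    forall i w, (q i).[w] = kuhn n (ray_level L (a i)) w.
  have /choice[q qP] (i : 'I_d) := kuhn_poly n (ray_level L (a i)).
  by exists q.
have h n := orthogonal_tens (fun i => sine_span_poly L0 (p n i)).
pose F n : V := toL2 (projT1 (cid2 (h n))).
have FE n : F n = tens (fun i t => nmode L 0 0 t * (p n i).[side_coord L t]) :> (_ -> _) by [].
have uF n : B u (F n) = 0 by rewrite /F; case: cid2.
have a1 t : `|side_coord L t| <= 1 by exact: sin_max.
have l1 i : `|ray_level L (a i)| <= 1 by exact: sin_max.
have s0 := sqrtr_ge0 (2 / L).
have b01 (b : bool) : 0 <= (b%:R : R) <= 1 by case: b; rewrite ?lexx ?ler01.
have bnd (c : R) t : 0 <= c <= 1 -> `|nmode L 0 0 t * c| <= Num.sqrt (2 / L).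
  move=> /andP[c0 c1]; rewrite normrM -[leRHS]mulr1 ler_pM//; first exact: nmode_le.
  by rewrite ger0_norm.
have mw := measurable_orthant_weight a.
have hw : L2box L (orthant_weight a).
  apply: (bounded_L2box L0 (M := \prod_(i < d) Num.sqrt (2 / L))) => // x.
  by apply: tens_le => i t; exact: bnd (b01 _).
have cv : converges B F (toL2 hw).
  apply: (@tens_cvg_L2 R d L L0 (fun n i t => nmode L 0 0 t * (p n i).[side_coord L t])
    (fun i t => nmode L 0 0 t * (side_coord L t <= ray_level L (a i))%R%:R) (fun=> Num.sqrt (2 / L))).
  - move=> n i; apply: continuous_measurable_fun => t; apply: cvgM.
      by apply: smooth1_continuous; exact: smooth1_nmode.
    by apply: (cvg_comp (side_coord L) (horner (p n i))); [exact: continuous_side_coord|exact: continuous_horner].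
  - exact: measurable_orthant_factor.
  - by move=> n i t; rewrite pP; apply: bnd; exact: kuhn_itv.
  - by move=> i t; exact: bnd (b01 _).
  - move=> i t _; apply: cvgM; first exact: cvg_cst.
    by under eq_fun do rewrite pP; exact: kuhn_cvg.
have := converges_ipr (w := u) cv; under eq_fun do rewrite uF.
by move=> h'; apply: (cvg_unique _ h') => //; exact: cvg_cst.
Qed.

End orthogonal.

Lemma measurable_orthant a : measurable (orthant a).
Proof.
rewrite (_ : orthant a = \bigcap_(i in [set: 'I_d]) ((fun x : 'rV[R]_d => x ord0 i) @^-1` `]-oo, a i])).
  apply: fin_bigcap_measurable => // i _; rewrite -[X in measurable X]setTI.
  exact: measurable_coord.
by apply/seteqP; split=> [x xa i _|x xa i] /=; [rewrite in_itv/=; exact: xa|have := xa i I; rewrite /= in_itv].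
Qed.

Lemma orthant_generates : @measurable _ 'rV[R]_d = <<s range orthant >>.
Proof.
rewrite eqEsubset; split; last first.
  apply: smallest_sub; first exact: sigma_algebra_measurable.
  by move=> _ [a _ <-]; exact: measurable_orthant.
apply: smallest_sub; first exact: smallest_sigma_algebra.
rewrite -bigcup_seq => A [i _ [C mC <-]]; rewrite setTI.
pose F := [set C : set R | <<s range orthant >> ((fun x : 'rV[R]_d => x ord0 i) @^-1` C)].
have : (@ocitv R).-sigma.-measurable C by exact: mC.
rewrite RGenOInfty.measurableE => {}mC; apply: (mC F) => {C mC A}; split.
  split=> [|B FB|B FB]; rewrite /F /=.
  - by rewrite preimage_set0; exact: sigma_algebra0.
  - by rewrite setTD preimage_setC -setTD; exact: sigma_algebraCD.
  - by rewrite preimage_bigcup; exact: sigma_algebra_bigcup.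
move=> _ [a ->]; rewrite /F /=.
have -> : (fun x : 'rV[R]_d => x ord0 i) @^-1` `]a, +oo[ =
    setT `\` \bigcup_n orthant (fun j => if j == i then a else n%:R).
  apply/seteqP; split => [x /= |x [_ xn]].
    rewrite in_itv/= andbT => ax; split=> // -[n _ /(_ i)]; rewrite eqxx.
    by rewrite leNgt ax.
  rewrite /= in_itv/= andbT ltNge; apply: contra_notN xn => xa.
  pose m := \max_j (Num.truncn `|x ord0 j|).+1; exists m => // j.
  case: eqP => [->//|_]; apply: (le_trans (ler_norm _)); apply: ltW.
  apply: (lt_le_trans (truncnS_gt _)); rewrite ler_nat.
  by rewrite /m (bigD1 j)//= leq_max leqnn.
apply: sigma_algebraCD; apply: sigma_algebra_bigcup => n.
by apply: sub_sigma_algebra; eexists.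
Qed.

(** A function orthogonal to all waves, multiplied by the ground wave,
    integrates to 0 over every orthant, hence over every Borel set by Dynkin's
    lemma. So the product vanishes almost everywhere, and the ground wave is
    positive on the box. *)
Theorem wave_total : total B (fun k : idx => ewave L0 k (fun=> 0%N)).
Proof.
move=> u uw; apply/L2_nsq_eq0.
pose k0 : idx := [ffun=> 0%N].
pose h x := (u x * wave L k0 (fun=> 0%N) x)%:E.
have ih : mu_box.-integrable setT h by exact: (L2_integrable u (ewave L0 k0 (fun=> 0%N))).
have mu_h : measurable_fun setT h by case/integrableP: ih.
have hA (A : set 'rV[R]_d) : measurable A -> mu_box.-integrable A h.
  by move=> mA; exact: integrableS ih.
have wE x a : box L x -> u x * orthant_weight a x = if x \in orthant a then u x * wave L k0 (fun=> 0%N) x else 0.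
  move=> xb; have xs i : side L (x ord0 i) by rewrite /side/= in_itv; exact: xb.
  rewrite /orthant_weight /tens big_split/= /wave /tens; case: ifPn => [/set_mem xa|xa].
    rewrite [X in _ * (_ * X)]big1 ?mulr1; last by move=> i _; rewrite -ray_levelP ?xa.
    by congr (_ * _); apply: eq_bigr => i _; rewrite ffunE.
  have /existsNP[i /negP xi] : ~ orthant a x by move=> /mem_set; exact/negP.
  by rewrite [X in _ * (_ * X)](bigD1 i)//= -ray_levelP// (negPf xi) mul0r !mulr0.
have PG a : (\int[mu_box]_(x in orthant a) h x = (inner L u (orthant_weight a))%:E)%E.
  have mo : measurable (orthant a) by exact: measurable_orthant.
  have e : {ae mu_box, forall x, setT x -> (h \_ (orthant a)) x = (u x * orthant_weight a x)%:E}.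
    by apply: ae_boxP => x xb _; rewrite wE// patchE /h; case: ifPn.
  have hw : mu_box.-integrable setT (h \_ (orthant a)).
    by apply/(integrable_mkcond _ mo); exact: hA.
  have mw : measurable_fun setT (EFin \o (fun x => u x * orthant_weight a x)).
    by apply/measurable_EFinP; apply: measurable_funM; [exact: L2_measurable|exact: measurable_orthant_weight].
  have e' : (\int[mu_box]_x (h \_ (orthant a)) x = \int[mu_box]_x (u x * orthant_weight a x)%:E)%E.
    by apply: ae_eq_integral => //; exact: measurable_int hw.
  rewrite integral_mkcond /inner /Rintegral fineK -?e'//.
  exact: integrable_fin_num.
have {}PG a : (\int[mu_box]_(x in orthant a) h x = 0)%E by rewrite PG orthogonal_orthant.
have PT : (\int[mu_box]_x h x = 0)%E.
  rewrite -(PG (fun=> L / 2)) [RHS]integral_mkcond.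
  have mo : measurable (orthant (fun=> L / 2)) by exact: measurable_orthant.
  apply: ae_eq_integral => //.
    by apply/(measurable_restrictT _ mo); exact: measurable_funTS.
  apply: ae_boxP => x xb _; rewrite patchE mem_set// => i.
  by have /andP[_ /ltW] := xb i.
have main (A : set 'rV[R]_d) : measurable A -> (\int[mu_box]_(x in A) h x = 0)%E.
  rewrite orthant_generates.
  apply: (dynkin_induction (P := fun A => (\int[mu_box]_(x in A) h x = 0)%E)).
  - exact: orthant_generates.
  - move=> _ _ [a _ <-] [b _ <-]; exists (fun i => Num.min (a i) (b i)) => //.
    by apply/seteqP; split => x /=; [move=> xab; split => i; have := xab i; rewrite le_min => /andP[]
      |move=> [xa xb] i; rewrite le_min xa xb].
  - exact: PT.
  - by move=> _ [a _ <-]; exact: PG.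
  - move=> S mS PS; have := PT.
    have mSC := measurableC mS.
    rewrite -(setvU S) integral_setU//; last 2 first.
    - by rewrite setvU; exact: mu_h.
    - by rewrite disj_set2E setICl.
    by rewrite PS adde0.
  - move=> F mF tF PF; rewrite integral_bigcup//; first by rewrite eseries0// => n _; rewrite PF.
    by apply: hA; exact: bigcup_measurable.
have h0 : ae_eq mu_box setT h (cst 0%E).
  by apply: integral_ae_eq => // E _ mE; rewrite main// integral0.
have bx : {ae mu_box, forall x, box L x} by exact: ae_boxP.
move: h0 bx; apply: filterS2 => x /(_ I) + xb; rewrite /h => -[] /eqP.
rewrite mulf_eq0 => /orP[/eqP//|]; rewrite gt_eqF// /wave /tens.
apply: prodr_gt0 => i _; rewrite ffunE; apply: nmode0_gt0 => //.
by rewrite /side/= in_itv; exact: xb.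
Qed.

End completeness.

(** * The Dirichlet Laplacian in the basis of sine waves *)

Lemma cvg_sum0 (R : realType) (I : Type) (r : seq I) (f : nat -> I -> R) :
  (forall i, f n i @[n --> \oo] --> (0 : R)) ->
  \sum_(i <- r) f n i @[n --> \oo] --> (0 : R).
Proof.
move=> f0; elim: r => [|i r IH].
  by under eq_fun do rewrite big_nil; exact: cvg_cst.
rewrite (_ : (fun n => _) = fun n => f n i + \sum_(j <- r) f n j); last first.
  by apply/funext => n; rewrite big_cons.
by rewrite -[X in _ --> X]addr0; exact: cvgD.
Qed.

Section dirichlet_laplacian.
Context {R : realType} {d : nat} (L : R).
Hypothesis L0 : 0 < L.
Local Notation mu_box := (@box_measure R d L).
Local Notation V := (LfunType (box_measure (d := d) L) (lee1n 2)).
Local Notation B := (L2_inner (box_measure (d := d) L)).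
Local Notation idx := {ffun 'I_d -> nat}.
Local Notation c0 := (fun=> 0%N : nat).
Implicit Types (k l : idx) (c : 'I_d -> nat) (u w : V) (i j : 'I_d) (phi : 'rV[R]_d -> R).

Lemma test_function_L2 phi : test_function L phi -> L2box L phi.
Proof.
move=> tp; have [M hM] := test_function_bounded tp.
by apply: (bounded_L2box L0 _ hM); apply: continuous_measurable; apply: smooth_continuous; case: tp.
Qed.

Definition testL2 phi (h : test_function L phi) : V := toL2 (test_function_L2 h).

Lemma test_bounded_C1 i phi : test_function L phi -> bounded_C1 i phi.
Proof.
move=> tp; have [sp _ _] := tp; split.
- by move=> x; exact: smooth_derivable.
- exact: smooth_continuous.
- by apply: smooth_continuous; exact: smooth_partial.
- exact: test_function_bounded tp.
- exact: test_function_bounded (test_function_partial i tp).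
Qed.

Lemma wave_bounded_C1 i k c : bounded_C1 i (wave L k c).
Proof.
have sw := @smooth_wave R d L k c; split.
- by move=> x; exact: smooth_derivable.
- exact: smooth_continuous.
- by apply: smooth_continuous; exact: smooth_partial.
- by eexists => x; exact: wave_le.
- exists (`|freq L (k i)| * \prod_(i < d) Num.sqrt (2 / L)) => x.
  by rewrite partial_wave normrM ler_wpM2l//; exact: wave_le.
Qed.

Lemma ip_wave_partial i k c phi (h : test_function L phi) :
  B (ewave L0 k c) (testL2 (test_function_partial i h)) =
  - (freq L (k i) * B (ewave L0 k (turn c i)) (testL2 h)).
Proof.
have := integration_by_parts L0 (test_bounded_C1 i h) (wave_bounded_C1 i k c)
  (fun x => test_function_outside h).
rewrite partial_wave => e.
rewrite -ipZl (ipC B (ewave L0 k c)) (ipC B (_ *: _)).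
apply/eqP; rewrite -eqr_oppLR; apply/eqP; exact: (esym e).
Qed.

Definition freq_coef i (a : idx -> R) k := freq L (k i) * a k.

Definition wave_series c (a : idx -> R) N : V := lincomb (fun k => ewave L0 k c) (wave_box N) a.

(** Integration by parts holds for the partial sums, and both sides are
    continuous in [L^2]. *)
Lemma weak_partial_series i c a u w : converges B (wave_series c a) u ->
  converges B (wave_series (turn c i) (freq_coef i a)) w -> weak_partial L i u w.
Proof.
move=> cu cw; split; [exact: LfunP|exact: LfunP|move=> phi h].
have h1 := converges_ipl (w := testL2 (test_function_partial i h)) cu.
have h2 := converges_ipl (w := testL2 h) cw.
apply: (cvg_unique _ h1) => //.
suff -> : (fun N => B (wave_series c a N) (testL2 (test_function_partial i h))) =
    (fun N => - B (wave_series (turn c i) (freq_coef i a) N) (testL2 h)) by exact: cvgN.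
apply/funext => N; rewrite /wave_series /lincomb !ip_suml -sumrN; apply: eq_bigr => k _.
by rewrite !ipZl ip_wave_partial /freq_coef; ring.
Qed.

Definition h1_dist (u : 'rV[R]_d -> R) (g : 'I_d -> 'rV[R]_d -> R) phi : R :=
  inner L (u \- phi) (u \- phi) +
  \sum_(i < d) inner L (g i \- partial i phi) (g i \- partial i phi).

(** The approximation property required of a function and its weak gradient in
    the definition of [H10]. *)
Definition h1_approx (u : 'rV[R]_d -> R) (g : 'I_d -> 'rV[R]_d -> R) :=
  forall eps : R, 0 < eps -> exists2 phi, test_function L phi & h1_dist u g phi < eps.

Lemma h1_distE u (g : 'I_d -> V) phi (h : test_function L phi) :
  h1_dist u (fun i => g i) phi =
  nsq B (u - testL2 h) + \sum_(i < d) nsq B (g i - testL2 (test_function_partial i h)).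
Proof. by []. Qed.

Lemma h1_approx_lin a u u' (g g' : 'I_d -> V) :
  h1_approx u (fun i => g i) -> h1_approx u' (fun i => g' i) ->
  h1_approx (a *: u + u' : V) (fun i => (a *: g i + g' i : V)).
Proof.
move=> hu hu' eps e0; have a0 := sqr_ge0 a.
have c1 : 0 < a ^+ 2 + 1 by lra.
have bnd : 2 * a ^+ 2 * (eps / (4 * (a ^+ 2 + 1))) + 2 * (eps / 4) < eps.
  have -> : 2 * a ^+ 2 * (eps / (4 * (a ^+ 2 + 1))) = eps / 2 * (a ^+ 2 / (a ^+ 2 + 1)).
    by rewrite invfM; move: (a ^+ 2 + 1)^-1 => ci; field.
  have : a ^+ 2 / (a ^+ 2 + 1) < 1 by rewrite ltr_pdivrMr//; lra.
  by move: (a ^+ 2 / _) => r r1; nra.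
have [|phi tp dp] := hu (eps / (4 * (a ^+ 2 + 1))); first by rewrite divr_gt0//; nra.
have [|psi tq dq] := hu' (eps / 4); first by lra.
have tpq := test_function_lin a tp tq.
exists (fun x => a * phi x + psi x) => //.
have e1 : testL2 tpq = a *: testL2 tp + testL2 tq by apply/LfuneqP.
have e2 i : testL2 (test_function_partial i tpq) =
    a *: testL2 (test_function_partial i tp) + testL2 (test_function_partial i tq).
  have [sp _ _] := tp; have [sq _ _] := tq.
  by apply/LfuneqP => x; rewrite /= partial_lin.
have key (x x' y y' : V) : nsq B (a *: x + x' - (a *: y + y')) <=
    2 * a ^+ 2 * nsq B (x - y) + 2 * nsq B (x' - y').
  rewrite opprD addrACA -scalerBr; apply: (le_trans (nsqD_le _ _ _)).
  by rewrite nsqZ mulrA.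
rewrite (h1_distE _ _ tpq); rewrite (h1_distE _ _ tp) in dp; rewrite (h1_distE _ _ tq) in dq.
apply: le_lt_trans bnd.
apply: (@le_trans _ _ (2 * a ^+ 2 * (nsq B (u - testL2 tp) +
   \sum_(i < d) nsq B (g i - testL2 (test_function_partial i tp))) +
   2 * (nsq B (u' - testL2 tq) +
   \sum_(i < d) nsq B (g' i - testL2 (test_function_partial i tq))))); last first.
  apply: lerD; last by rewrite ler_pM2l// ltW.
  by apply: ler_wpM2l; [exact: mulr_ge0|exact: ltW].
rewrite !mulrDr addrACA; apply: lerD; first by rewrite e1.
by rewrite !mulr_sumr -big_split; apply: ler_sum => i _; rewrite e2; exact: key.
Qed.

Lemma h1_approx_lim (s : nat -> V) (t : nat -> 'I_d -> V) u (g : 'I_d -> V) :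
  (forall n, h1_approx (s n) (fun i => t n i)) -> converges B s u ->
  (forall i, converges B (t ^~ i) (g i)) -> h1_approx u (fun i => g i).
Proof.
move=> hs cs ct eps e0.
have c : nsq B (s n - u) + \sum_(i < d) nsq B (t n i - g i) @[n --> \oo] --> (0 : R).
  rewrite -[X in _ --> X]addr0; apply: cvgD; first exact: cs.
  by apply: cvg_sum0 => i; exact: ct.
have e4 : 0 < eps / 4 by lra.
have [N _ /(_ N (leqnn N)) hN'] := cvgr_lt 0 c _ e4.
have hN : nsq B (s N - u) + \sum_(i < d) nsq B (t N i - g i) < eps / 4 := hN'.
have [phi tp dp] := hs N _ e4.
have key (x y z : V) : nsq B (x - y) <= 2 * nsq B (z - x) + 2 * nsq B (z - y).
  by rewrite (nsqB_sym B z x); exact: nsq_triangle.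
exists phi => //; rewrite (h1_distE _ _ tp); rewrite (h1_distE _ _ tp) in dp.
apply: (@le_lt_trans _ _ (2 * (nsq B (s N - u) + \sum_(i < d) nsq B (t N i - g i)) +
  2 * (nsq B (s N - testL2 tp) + \sum_(i < d) nsq B (t N i - testL2 (test_function_partial i tp))))).
  rewrite !mulrDr addrACA; apply: lerD.
    exact: key.
  rewrite !mulr_sumr -big_split/=; apply: ler_sum => i _.
  exact: key.
by lra.
Qed.

Lemma h1_approx_wave k :
  h1_approx (ewave L0 k c0) (fun i => (freq L (k i) *: ewave L0 k (turn c0 i) : V)).
Proof.
pose D n := h1_dist (ewave L0 k c0) (fun i => (freq L (k i) *: ewave L0 k (turn c0 i) : V)) (cutwave L n k c0).
have sym (f g : 'rV[R]_d -> R) : inner L (f \- g) (f \- g) = inner L (g \- f) (g \- f).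
  by apply: eq_Rintegral => x _; rewrite /=; ring.
have cD : D n @[n --> \oo] --> (0 : R).
  rewrite -[X in _ --> X]addr0; apply: cvgD.
    by under eq_fun do rewrite sym; exact: cutwave_cvg.
  apply: cvg_sum0 => i.
  under eq_fun do rewrite sym.
  have e : (freq L (k i) *: ewave L0 k (turn c0 i) : V) = partial i (wave L k c0) :> (_ -> _).
    by rewrite partial_wave.
  by rewrite e; exact: partial_cutwave_cvg.
move=> eps e0; have [N _ /(_ N (leqnn N)) /= hN] := cvgr_lt 0 cD _ e0.
by exists (cutwave L N k c0) => //; exact: test_function_cutwave.
Qed.

Lemma h1_approx_series a N :
  h1_approx (wave_series c0 a N) (fun i => wave_series (turn c0 i) (freq_coef i a) N).
Proof.
rewrite /wave_series /lincomb; elim: (wave_box N) => [|k r IH].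
  have e : h1_dist (0 : V) (fun i => (0 : V)) (fun=> 0) = 0.
    rewrite (h1_distE _ _ (test_function0 L)).
    have z phi (h : test_function L phi) : phi = (fun=> 0) -> testL2 h = 0.
      by move=> p0; apply/LfuneqP => x; rewrite /= p0.
    rewrite z// subr0 /nsq ip0l add0r big1// => i _.
    rewrite z ?subr0 ?ip0l//; apply/funext => x; apply: partialE; exact: is_derive_cst.
  move=> eps e0; exists (fun=> 0); first exact: test_function0.
  have -> : (fun i => (\sum_(k <- [::]) freq_coef i a k *: ewave L0 k (turn c0 i) : V) : 'rV[R]_d -> R) =
      (fun i => (0 : V)) by apply/funext => i; rewrite big_nil.
  by rewrite big_nil e.
have := h1_approx_lin (a k) (h1_approx_wave k) IH.
rewrite big_cons; congr (h1_approx _ _); apply/funext => i.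
by rewrite big_cons scalerA /freq_coef mulrC.
Qed.

Section regularity.
Hypothesis tB : total B (fun k => ewave L0 k c0).
Local Notation e := (fun k => ewave L0 k c0).
Local Notation mu := (wave_energy L).

Variables (u z : V).
Hypothesis uz : graph B e mu u z.

Let a k := B u (e k).

Let zE k : B z (e k) = mu k * a k. Proof. exact: uz. Qed.

Let freq_sq_le i k : 0 <= freq L (k i) ^+ 2 <= mu k.
Proof.
rewrite sqr_ge0/= /wave_energy (bigD1 i)//= lerDl.
by apply: sumr_ge0 => j _; exact: sqr_ge0.
Qed.

Let bessel_le v N : \sum_(k <- wave_box N) B v (e k) ^+ 2 <= nsq B v.
Proof.
apply: bessel; first exact: wave_orthonormal.
by have [] := @wave_box_exhaustion d.
Qed.

Let grad_ex i : exists g : V, converges B (wave_series (turn c0 i) (freq_coef i a)) g.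
Proof.
apply: (riesz_fischer (wave_orthonormal L0 _) (@wave_box_exhaustion d) (C := nsq B u + nsq B z)).
  exact: L2_complete.
move=> N; apply: le_trans (lerD (bessel_le u N) (bessel_le z N)).
rewrite -big_split; apply: ler_sum => k _ /=.
have /andP[f0 f1] := freq_sq_le i k; have := sqr_ge0 (a k).
rewrite -/(L2_ip u (e k)) -[L2_ip u _]/(a k) -[L2_ip z _]/(B z (e k)) zE (exprMn _ (freq L _)) (exprMn _ (mu k)).
have := sqr_ge0 (mu k - 1); set m := mu k in f1 *; set f := freq L _ ^+ 2 in f0 f1 *.
by set x := a k ^+ 2; nra.
Qed.

Let hess_ex i j : exists h : V, converges B (wave_series (turn (turn c0 i) j) (freq_coef j (freq_coef i a))) h.
Proof.
apply: (riesz_fischer (wave_orthonormal L0 _) (@wave_box_exhaustion d) (C := nsq B z)).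
  exact: L2_complete.
move=> N; apply: le_trans (bessel_le z N).
apply: ler_sum => k _ /=.
rewrite -[L2_ip z _]/(B z (e k)) zE (exprMn _ (freq L _)) (exprMn _ (freq L _)) (exprMn _ (mu k)) mulrA.
apply: ler_wpM2r; first exact: sqr_ge0.
have /andP[f0 f1] := freq_sq_le i k; have /andP[g0 g1] := freq_sq_le j k.
by rewrite (expr2 (mu k)); exact: ler_pM.
Qed.

(** As [u] and [mu k * u_k] are square summable, so are the coefficients
    multiplied by one or two frequencies. The corresponding series of turned
    waves are the weak gradient and the Hessian of [u]. The boundary condition
    holds because the partial sums are limits of test functions in [H^1]. *)
Lemma graph_H10_H2 : H10 L u /\ exists2 H, H2_with_hessian L u H &
  {ae mu_box, forall x, z x = - (\sum_(i < d) H i i x)}.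
Proof.
have /choice[g cg] := grad_ex.
have /choice[h' ch'] (p : 'I_d * 'I_d) := hess_ex p.1 p.2.
pose h i j := h' (i, j); have ch i j := ch' (i, j).
have cu : converges B (wave_series c0 a) u.
  apply: (expansion (wave_orthonormal L0 _) (@wave_box_exhaustion d)) => //.
  exact: L2_complete.
have wg : weak_gradient L u (fun i => g i) by move=> i; exact: weak_partial_series cu (cg i).
split.
  split; first exact: LfunP.
  exists (fun i => g i) => //.
  exact: (h1_approx_lim (h1_approx_series a) cu cg).
exists (fun i j => h i j).
  split; first exact: LfunP.
  exists (fun i => g i) => // i j.
  exact: weak_partial_series (cg i) (ch i j).
suff : nsq B (z + \sum_(i < d) h i i) = 0.
  move=> /L2_nsq_eq0; apply: filterS => x zx; apply/eqP; rewrite -addr_eq0; apply/eqP.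
  by rewrite -[RHS]zx [RHS](_ : _ = z x + (\sum_(i < d) h i i : V) x)// L2_sumE.
apply: tB => k; rewrite ipDl zE ip_suml.
have hk i : B (h i i) (e k) = - (freq L (k i) ^+ 2 * a k).
  have c : converges B (wave_series c0 (fun k => freq L (k i) ^+ 2 * a k)) (- h i i).
    apply: eq_cvgn (ch i i) => N.
    have -> : wave_series (turn (turn c0 i) i) (freq_coef i (freq_coef i a)) N =
        - wave_series c0 (fun k => freq L (k i) ^+ 2 * a k) N.
      rewrite /wave_series /lincomb -sumrN; apply: eq_bigr => l _; apply/LfuneqP => x.
      rewrite [LHS](_ : _ = freq_coef i (freq_coef i a) l * wave L l (turn (turn c0 i) i) x)//.
      rewrite [RHS](_ : _ = - (freq L (l i) ^+ 2 * a l * wave L l c0 x))//.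
      by rewrite wave_turn2 /freq_coef; ring.
    by rewrite nsqB_sym !opprK addrC.
  have := lincomb_coef (wave_orthonormal L0 _) (@wave_box_exhaustion d) c k.
  by rewrite ipNl => <-; rewrite opprK.
by under eq_bigr do rewrite hk; rewrite sumrN -mulr_suml subrr.
Qed.

End regularity.

Section weak_solutions.
Local Notation e := (fun k => ewave L0 k c0).
Local Notation mu := (wave_energy L).

Let cut n k c : V := testL2 (test_function_cutwave L0 n k c).

Let cut_wave k c : converges B (fun n => cut n k c) (ewave L0 k c).
Proof. exact: cutwave_cvg. Qed.

Let dcut n k i : V := testL2 (test_function_partial i (test_function_cutwave L0 n k c0)).

Let dcut_wave k i : converges B (fun n => dcut n k i) (freq L (k i) *: ewave L0 k (turn c0 i)).
Proof.
apply: eq_cvgn (partial_cutwave_cvg L0 k i) => n.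
by rewrite (partial_wave L k c0 i).
Qed.

(** The waves are not test functions, but limits of such in [H^1]. *)
Let weak_wave i (g h : V) k : weak_partial L i g h ->
  B h (e k) = - (freq L (k i) * B g (ewave L0 k (turn c0 i))).
Proof.
move=> [_ _ gh]; rewrite -ipZr.
apply: (cvg_unique _ (converges_ipr (w := h) (cut_wave k c0))) => //.
suff -> : (fun n => B h (cut n k c0)) = (fun n => - B g (dcut n k i)).
  by apply: cvgN; exact: (converges_ipr (dcut_wave k i)).
apply/funext => n; apply/eqP; rewrite -eqr_oppLR; apply/eqP; apply/esym.
exact: (gh _ (test_function_cutwave L0 n k c0)).
Qed.

Let weak_unique i (u g g' : V) k c : weak_partial L i u g -> weak_partial L i u g' ->
  B g (ewave L0 k c) = B g' (ewave L0 k c).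
Proof.
move=> [_ _ ug] [_ _ ug'].
apply: (cvg_unique _ (converges_ipr (w := g) (cut_wave k c))) => //.
suff -> : (fun n => B g (cut n k c)) = (fun n => B g' (cut n k c)) by exact: converges_ipr.
apply/funext => n; apply: oppr_inj.
have h1 := ug _ (test_function_cutwave L0 n k c).
have h2 := ug' _ (test_function_cutwave L0 n k c).
exact: (etrans (esym h1) h2).
Qed.

(** This is where the boundary condition on [u] enters. The turned wave does not
    vanish on the boundary, so the integration by parts is done on the test
    functions that approximate [u]. *)
Let h10_wave (u : V) (g : 'I_d -> V) i k : h1_approx u (fun i => g i) ->
  B (g i) (ewave L0 k (turn c0 i)) = freq L (k i) * B u (e k).
Proof.
move=> ap.
have /choice[phi pP] (n : nat) : exists phi, test_function L phi /\ h1_dist u (fun i => g i) phi < n.+1%:R^-1.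
  by have [|phi] := ap n.+1%:R^-1; first by []; exists phi.
pose f n : V := testL2 (pP n).1.
pose df n : V := testL2 (test_function_partial i (pP n).1).
have c0' : n.+1%:R^-1 @[n --> \oo] --> (0 : R) by exact: cvg_harmonic.
have dist n : nsq B (f n - u) <= n.+1%:R^-1 /\ nsq B (df n - g i) <= n.+1%:R^-1.
  have /ltW := (pP n).2; rewrite (h1_distE _ _ (pP n).1) (bigD1 i)//.
  set S := \sum_(_ | _) _.
  rewrite (nsqB_sym B (f n)) (nsqB_sym B (df n)) => h.
  have {}h : nsq B (u - f n) + (nsq B (g i - df n) + S) <= n.+1%:R^-1 := h.
  have h1 : 0 <= nsq B (u - f n) by exact: nsq_ge0.
  have h2 : 0 <= nsq B (g i - df n) by exact: nsq_ge0.
  have h3 : 0 <= S.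
    by apply: sumr_ge0 => j _; exact: nsq_ge0.
  by move: (n.+1%:R^-1) h h1 h2 h3 => eps h h1 h2 h3; split; lra.
have cf : converges B f u by apply: (converges_le (fun n => (dist n).1)).
have cdf : converges B df (g i) by apply: (converges_le (fun n => (dist n).2)).
have h1 := converges_ipl (w := ewave L0 k (turn c0 i)) cdf.
have h2 := converges_ipl (w := e k) cf.
apply: (cvg_unique _ h1) => //.
suff -> : (fun n => B (df n) (ewave L0 k (turn c0 i))) = (fun n => freq L (k i) * B (f n) (e k)).
  by apply: cvgM => //; exact: cvg_cst.
apply/funext => n; rewrite (ipC B (df n)) ip_wave_partial.
suff -> : ewave L0 k (turn (turn c0 i) i) = - ewave L0 k c0 by rewrite ipNl mulrN opprK (ipC B _ (f n)).
by apply/LfuneqP => x; rewrite /= wave_turn2.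
Qed.

(** Integrating by parts twice against a wave. The gradient that is
    differentiated again and the gradient of the boundary condition may be
    different representatives; [weak_unique] reconciles them. *)
Lemma H10_H2_graph (u z : V) H : H10 L u -> H2_with_hessian L u H ->
  {ae mu_box, forall x, z x = - (\sum_(i < d) H i i x)} -> graph B e mu u z.
Proof.
move=> [_ [g wg ap]] [_ [g' wg' wH]] zH k.
have LH i : L2box L (H i i) by have [] := wH i i.
have Lg i : L2box L (g i) by have [] := wg i.
have Lg' i : L2box L (g' i) by have [] := wg' i.
have -> : B z (e k) = - \sum_(i < d) B (toL2 (LH i)) (e k).
  rewrite -ip_suml; apply/eqP; rewrite -addr_eq0 -ipDl.
  have n0 : nsq B (z + \sum_(i < d) toL2 (LH i)) = 0.
    apply/L2_nsq_eq0; apply: filterS zH => x zx.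
    rewrite [LHS](_ : _ = z x + (\sum_(i < d) toL2 (LH i) : V) x)// L2_sumE.
    by rewrite zx addNr.
  have := cauchy_schwarz B (z + \sum_(i < d) toL2 (LH i)) (e k).
  by rewrite n0 mul0r => h; rewrite -sqrf_eq0 eq_le h sqr_ge0.
rewrite /wave_energy mulr_suml -sumrN; apply: eq_bigr => i _.
rewrite (weak_wave (g := toL2 (Lg' i)) (h := toL2 (LH i)) k (wH i i)) opprK.
rewrite (weak_unique (u := u) (g := toL2 (Lg' i)) (g' := toL2 (Lg i)) _ _ (wg' i) (wg i)).
by rewrite (h10_wave (u := u) (g := fun i => toL2 (Lg i)))// expr2 mulrA.
Qed.

End weak_solutions.

End dirichlet_laplacian.

(** * Eigenvalues of the Schroedinger operator *)

Section clamp.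
Context {R : realType} {d : nat} (v : 'rV[R]_d -> R).
Hypothesis voo : v \in Lfun (lebesgue_rV d) +oo%E.
Hypothesis v0 : {ae lebesgue_rV d, forall x, 0 <= v x}.

Lemma measurable_Lfun_oo : measurable_fun setT v.
Proof. by move: voo; rewrite inE => /andP[]; rewrite inE. Qed.

Lemma Lfun_oo_ae_bound : exists C : R, {ae lebesgue_rV d, forall x, v x <= C}.
Proof.
move: voo; rewrite inE => /andP[_]; rewrite inE /= /finite_norm unlock /Lnorm.
case: ifPn => [mu0|]; last first.
  rewrite -leNgt => mu0 _; exists 0; exists setT; split => //.
  by apply/eqP; rewrite eq_le mu0 measure_ge0.
move=> h.
have : ess_sup (lebesgue_rV d) (abse \o (EFin \o v)) \is a fin_num.
  rewrite ge0_fin_numE//; apply: ess_sup_gee => //; apply: aeW => x; exact: abse_ge0.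
move=> /fineK e; exists (fine (ess_sup (lebesgue_rV d) (abse \o (EFin \o v)))).
have := ess_sup_ge (lebesgue_rV d) (abse \o (EFin \o v)).
by apply: filterS => x; rewrite -e /= lee_fin; apply: le_trans; exact: ler_norm.
Qed.

(** A representative that is bounded everywhere, so that multiplication by it
    acts on functions and not only on classes. *)
Lemma clamp_potential : exists vt : 'rV[R]_d -> R, exists C : R,
  [/\ measurable_fun setT vt, forall x, 0 <= vt x <= C, forall x, vt x <= `|v x| &
   {ae lebesgue_rV d, forall x, vt x = v x}].
Proof.
have [C vC] := Lfun_oo_ae_bound.
exists (fun x => Num.min (Num.max 0 C) (Num.max 0 (v x))), (Num.max 0 C); split.
- apply: measurable_minr => //; apply: measurable_maxr => //.
  exact: measurable_Lfun_oo.
- move=> x; apply/andP; split; last by rewrite ge_min lexx.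
  by rewrite le_min !le_max !lexx.
- by move=> x; rewrite ge_min !ge_max normr_ge0/= ler_norm orbT.
- move: vC v0; apply: filterS2 => x vC v0x.
  by rewrite (max_r v0x) (max_r (le_trans v0x vC)) (min_r vC).
Qed.

End clamp.

Lemma ae_mrestr d (T : measurableType d) (R : realType) (mu : {measure set T -> \bar R})
    (D : set T) (mD : measurable D) (P : T -> Prop) :
  {ae mu, forall x, P x} -> {ae mrestr mu mD, forall x, P x}.
Proof.
move=> [N [mN N0 hN]]; exists N; split => //.
apply/eqP; rewrite eq_le measure_ge0 andbT -N0 /= /mrestr.
by apply: le_measure; rewrite ?inE//; exact: measurableI.
Qed.

Section potential.
Context {R : realType} {d : nat} (L : R).
Hypothesis L0 : 0 < L.
Local Notation mu_box := (@box_measure R d L).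
Local Notation V := (LfunType (box_measure (d := d) L) (lee1n 2)).
Local Notation B := (L2_inner (box_measure (d := d) L)).
Local Notation idx := {ffun 'I_d -> nat}.
Local Notation c0 := (fun=> 0%N : nat).
Local Notation e := (fun k => ewave L0 k c0).
Local Notation mu := (wave_energy L).

Variables (v vt : 'rV[R]_d -> R) (C : R).
Hypotheses (mvt : measurable_fun setT vt) (vtC : forall x, 0 <= vt x <= C).
Hypothesis vtE : {ae mu_box, forall x, vt x = v x}.

Let mul_L2 (u : V) : L2box L (fun x => vt x * u x).
Proof.
have mu_ := L2_measurable u.
apply: Lfun2P; first exact: measurable_funM.
apply: (@le_lt_trans _ _ (\int[mu_box]_x ((C ^+ 2)%:E * (u x ^+ 2)%:E))%E).
  apply: ge0_le_integral => //.
  - by move=> x _; rewrite lee_fin sqr_ge0.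
  - by apply/measurable_EFinP; apply: measurable_funX; exact: measurable_funM.
  - by apply/measurable_EFinP; apply: measurable_funM => //; exact: measurable_funX.
  - move=> x _; rewrite lee_fin exprMn ler_wpM2r ?sqr_ge0//.
    by have /andP[h1 h2] := vtC x; rewrite lerXn2r// nnegrE (le_trans h1).
rewrite ge0_integralZl//; last 3 first.
- by apply/measurable_EFinP; exact: measurable_funX.
- by move=> x _; rewrite lee_fin sqr_ge0.
- by rewrite lee_fin sqr_ge0.
by rewrite -L2_nsqE -EFinM ltry.
Qed.

Definition potential (u : V) : V := toL2 (mul_L2 u).

Lemma potential_lin a u w : potential (a *: u + w) = a *: potential u + potential w.
Proof.
apply/LfuneqP => x; rewrite [LHS](_ : _ = vt x * (a * u x + w x))//.
by rewrite [RHS](_ : _ = a * (vt x * u x) + vt x * w x)//; ring.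
Qed.

Lemma potential_sym u w : B (potential u) w = B u (potential w).
Proof. by apply: eq_Rintegral => x _ /=; ring. Qed.

Lemma potential_ge0 u : 0 <= B (potential u) u.
Proof.
apply: Rintegral_ge0 => x _; rewrite [leRHS](_ : _ = vt x * u x ^+ 2).
  by have /andP[h _] := vtC x; rewrite mulr_ge0 ?sqr_ge0.
by rewrite expr2 mulrA.
Qed.

Hypothesis tB : total B e.

Lemma eigenspaceP E (u : V) : Defs.eigenspace v L E u <-> eigvec B e mu potential E u.
Proof.
split.
  move=> [h10 [H h2 Ev]]; apply: H10_H2_graph h10 h2 _.
  move: Ev vtE; apply: filterS2 => x Ev vx.
  by rewrite [LHS](_ : _ = E * u x - vt x * u x)// Ev vx addrK.
move=> h; have [h10 [H h2 Ev]] := graph_H10_H2 tB h; split => //; exists H => //.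
move: Ev vtE; apply: filterS2 => x; rewrite [X in X = _ -> _](_ : _ = E * u x - vt x * u x)//.
by move=> h1 vx; rewrite -h1 vx subrK.
Qed.

Lemma lin_indepP n (u : 'I_n -> V) : lin_indep L (fun j => u j) <->
  forall a : 'I_n -> R, nsq B (\sum_(j < n) a j *: u j) = 0 -> forall j, a j = 0.
Proof.
have aeE (a : 'I_n -> R) : nsq B (\sum_(j < n) a j *: u j) = 0 <->
    {ae mu_box, forall x, \sum_(j < n) a j * u j x = 0}.
  split=> [/L2_nsq_eq0|h].
    by apply: filterS => x h; rewrite -[RHS]h L2_sumE.
  by apply/L2_nsq_eq0; apply: filterS h => x h; rewrite -[RHS]h L2_sumE.
by split=> h a /aeE; exact: h.
Qed.

Section two_eigenvalues.
Variables (k0 k1 : idx).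
Hypothesis k01 : k0 != k1.
Hypothesis gap01 : forall k, k != k0 -> mu k1 <= mu k.
Local Notation t k := (B (potential (e k)) (e k)).

Let eo : orthonormal B e := wave_orthonormal L0 c0.
Let se : exhaustion (@wave_box d) := @wave_box_exhaustion d.
Let cB : hilbert B := @L2_complete _ _ R mu_box.

Let level k := [set E | exists e : 'I_k.+1 -> R, exists u : 'I_k.+1 -> 'rV[R]_d -> R,
  [/\ forall j, e j <= E, forall j, Defs.eigenspace v L (e j) (u j) & lin_indep L u]].

Let toV k (u : 'I_k -> 'rV[R]_d -> R) (E : 'I_k -> R) : (forall j, Defs.eigenspace v L (E j) (u j)) ->
  exists U : 'I_k -> V, forall j, U j = u j :> (_ -> _).
Proof.
by move=> h; have uL j : L2box L (u j) := (h j).1.1; exists (fun j => toL2 (uL j)).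
Qed.

Let level_ge0 k E : level k E -> 0 <= E.
Proof.
move=> [en [u [enE eu iu]]]; have [U Uu] := toV eu.
have uU : u = (fun j => U j) by apply/funext => j.
rewrite uU in eu iu.
move/lin_indepP : iu => iu.
apply: le_trans (enE ord0).
apply: (eigvec_ge0 eo se cB tB (wave_energy_ge0 L) potential_ge0 ((eigenspaceP _ _).1 (eu ord0))).
apply/eqP => U0; have := iu (fun j => (j == ord0)%:R).
rewrite (bigD1 ord0)//= scale1r big1 ?addr0; last by move=> j /negPf ->; rewrite scale0r.
by move=> /(_ U0 ord0) /eqP; rewrite eqxx oner_eq0.
Qed.

Let level1_ge E : level 1 E -> mu k1 <= E.
Proof.
move=> [en [u [enE eu iu]]]; have [U Uu] := toV eu.
have uU : u = (fun j => U j) by apply/funext => j.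
rewrite uU in eu iu.
move/lin_indepP : iu => iu.
pose j1 : 'I_2 := ord_max.
have g0 := (eigenspaceP _ _).1 (eu ord0); have g1 := (eigenspaceP _ _).1 (eu j1).
have H := two_eigvec_ge eo se cB tB potential_lin potential_sym potential_ge0
  gap01 (enE ord0) (enE j1) g0 g1.
apply: H.
move=> a b ab.
have := iu (fun j => if j == ord0 then a else b).
rewrite !big_ord_recl big_ord0 addr0 /= => h.
have hj : lift ord0 ord0 = j1 by exact/val_inj.
by rewrite hj in h; have h' := h ab; split; [exact: (h' ord0)|exact: (h' j1)].
Qed.

(** Min-max for the first two eigenvalues, with the Laplacian as the lower bound
    and the two lowest waves as trial functions. *)
Lemma eigenvalue_bounds :
  [/\ 0 <= Defs.eigenvalue v L 0, Defs.eigenvalue v L 0 <= mu k0 + t k0,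
   mu k1 <= Defs.eigenvalue v L 1 &
   Defs.eigenvalue v L 1 <= mu k0 + mu k1 + 2 * t k0 + 2 * t k1].
Proof.
have [u0 [E0 [u1 [E1 [[n0 n1 u01] [g0 g1 le0 le1]]]]]] :=
  two_eigvec eo se cB tB (wave_energy_ge0 L) (wave_energy_oo L0) potential_lin potential_sym
    potential_ge0 k01.
have lb k : has_lbound (level k) by exists 0 => E; exact: level_ge0.
have S0 : level 0 E0.
  exists (fun=> E0), (fun=> ((u0 : V) : 'rV[R]_d -> R)); split => // [j|]; first exact/eigenspaceP.
  apply/lin_indepP => a; rewrite big_ord_recl big_ord0 addr0 nsqZ n0 mulr1.
  by move=> /eqP; rewrite sqrf_eq0 => /eqP a0 j; rewrite (ord1 j).
have m0 := wave_energy_ge0 L k0; have m1 := wave_energy_ge0 L k1.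
have t0 := potential_ge0 (e k0); have t1 := potential_ge0 (e k1).
have S1 : level 1 (mu k0 + mu k1 + 2 * t k0 + 2 * t k1).
  exists (fun j => if j == ord0 then E0 else E1), (fun j => ((if j == ord0 then u0 else u1) : V) : 'rV[R]_d -> R); split.
  - by move=> j; case: eqP => _ //; apply: (le_trans le0); lra.
  - by move=> j; case: eqP => _; exact/eigenspaceP.
  - apply/lin_indepP => a; rewrite !big_ord_recl big_ord0 addr0.
    set w := (X in nsq B X); have -> : w = a ord0 *: u0 + a (lift ord0 ord0) *: u1 by [].
    rewrite /nsq !(ipDl, ipDr, ipZl, ipZr) -!/(nsq B _) n0 n1 (ipC B u1) u01.
    set x := a ord0; set y := a _ => h.
    have x2 := sqr_ge0 x; have y2 := sqr_ge0 y.
    have x0 : x ^+ 2 = 0 by nra.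
    have y0 : y ^+ 2 = 0 by nra.
    move=> j; have [->|j0] := eqVneq j ord0.
      by apply/eqP; rewrite -sqrf_eq0 -/x x0.
    have -> : j = lift ord0 ord0.
      by apply/val_inj; case: j j0 => -[|[|]].
    by apply/eqP; rewrite -sqrf_eq0 -/y y0.
split.
- by apply: lb_le_inf; [exists E0|move=> E; exact: level_ge0].
- by apply: le_trans le0; exact: (ge_inf (lb 0%N) S0).
- by apply: lb_le_inf; [eexists; exact: S1|move=> E; exact: level1_ge].
- exact: (ge_inf (lb 1%N) S1).
Qed.

End two_eigenvalues.

(** Waves are bounded by [(2 / L) ^ (d / 2)], so a low energy wave hardly meets
    an integrable potential in a large box. *)
Lemma potential_wave_le (k : idx) (A : R) : (\int[mu_box]_x (vt x)%:E <= A%:E)%E ->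
  B (potential (e k)) (e k) <= (2 / L) ^+ d * A.
Proof.
move=> hA.
have L2 : 0 <= 2 / L by rewrite divr_ge0// ltW.
have w2 x : wave L k c0 x ^+ 2 <= (2 / L) ^+ d.
  rewrite -[leRHS](_ : (\prod_(i < d) Num.sqrt (2 / L)) ^+ 2 = _).
    by rewrite -real_normK ?num_real// lerXn2r ?nnegrE ?prodr_ge0//; exact: wave_le.
  by rewrite prodr_const card_ord -exprM mulnC exprM sqr_sqrtr.
have m1 : measurable_fun setT (fun x => vt x * wave L k c0 x ^+ 2).
  by apply: measurable_funM => //; apply: measurable_funX; exact: measurable_wave.
rewrite -lee_fin.
have -> : (B (potential (e k)) (e k))%:E = (\int[mu_box]_x (vt x * wave L k c0 x ^+ 2)%:E)%E.
  rewrite /= /L2_ip /Rintegral fineK; last first.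
    exact: (integrable_fin_num measurableT (L2_integrable (potential (e k)) (e k))).
  by apply: eq_integral => x _; rewrite expr2 mulrA.
apply: (@le_trans _ _ (\int[mu_box]_x (((2 / L) ^+ d)%:E * (vt x)%:E))%E).
  apply: ge0_le_integral => //.
  - by move=> x _; rewrite lee_fin mulr_ge0 ?sqr_ge0//; have /andP[] := vtC x.
  - exact/measurable_EFinP.
  - by apply/measurable_EFinP; exact: measurable_funM.
  - by move=> x _; rewrite -EFinM lee_fin mulrC ler_wpM2r//; have /andP[] := vtC x.
rewrite ge0_integralZl//; last 3 first.
- exact/measurable_EFinP.
- by move=> x _; rewrite lee_fin; have /andP[] := vtC x.
- by rewrite lee_fin exprn_ge0.
by rewrite EFinM lee_wpmul2l// lee_fin exprn_ge0.
Qed.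

End potential.

(** * The spectral gap *)

Section lowest_energies.
Context {R : realType} {d : nat} (L : R).
Local Notation idx := {ffun 'I_d -> nat}.

Definition ground_idx : idx := [ffun=> 0%N].
Definition excited_idx (i0 : 'I_d) : idx := [ffun i => nat_of_bool (i == i0)].

Lemma freqE (m : nat) : freq L m ^+ 2 = (m.+1 ^ 2)%:R * (pi ^+ 2 / L ^+ 2).
Proof. by rewrite /freq -mulrA exprMn expr_div_n natrX. Qed.

Lemma wave_energyE (k : idx) :
  wave_energy L k = (\sum_(i < d) ((k i).+1 ^ 2))%:R * (pi ^+ 2 / L ^+ 2).
Proof.
rewrite /wave_energy natr_sum mulr_suml; apply: eq_bigr => i _; exact: freqE.
Qed.

Lemma ground_energy : wave_energy L ground_idx = d%:R * (pi ^+ 2 / L ^+ 2).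
Proof.
rewrite wave_energyE; congr (_%:R * _); under eq_bigr do rewrite ffunE.
by rewrite sum_nat_const card_ord muln1.
Qed.

Lemma excited_energy i0 : wave_energy L (excited_idx i0) = d.+3%:R * (pi ^+ 2 / L ^+ 2).
Proof.
rewrite wave_energyE; congr (_%:R * _).
rewrite (bigD1 i0)//= ffunE eqxx (eq_bigr (fun=> 1%N)); last first.
  by move=> i /negPf ii0; rewrite ffunE ii0.
have := cardC1 i0; rewrite sum1_card card_ord => ->.
have d0 : (0 < d)%N := leq_ltn_trans (leq0n i0) (ltn_ord i0).
by case: (d) d0.
Qed.

Lemma excited_energy_le i0 k : k != ground_idx ->
  wave_energy L (excited_idx i0) <= wave_energy L k.
Proof.
move=> kg; rewrite excited_energy wave_energyE ler_wpM2r//.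
  by rewrite divr_ge0 ?sqr_ge0.
have [i ki] : exists i, (0 < k i)%N.
  apply: contra_notP (elimN eqP kg) => h; apply/ffunP => i; rewrite ffunE.
  by apply/eqP; rewrite -leqn0 leqNgt; apply/negP => ki; apply: h; exists i.
rewrite ler_nat (bigD1 i)//=.
have h1 : (4 <= (k i).+1 ^ 2)%N by rewrite (@leq_exp2r 2 _ 2).
have h2 : (d.-1 <= \sum_(j < d | j != i) (k j).+1 ^ 2)%N.
  apply: (@leq_trans (\sum_(j < d | j != i) 1)).
    by rewrite sum1_card cardC1 card_ord.
  by apply: leq_sum => j _; rewrite expn_gt0.
apply: leq_trans (leq_add h1 h2).
have d0 : (0 < d)%N := leq_ltn_trans (leq0n i0) (ltn_ord i0).
by case: (d) d0.
Qed.

End lowest_energies.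

(** For the upper bound the lowest eigenvalue is simply replaced by 0. *)
Lemma spectral_gap_bounds (R : realType) (d : nat) (v : 'rV[R]_d -> R) (i0 : 'I_d)
    (A L : R) : 0 < L -> v \in Lfun (lebesgue_rV d) +oo%E ->
  {ae lebesgue_rV d, forall x, 0 <= v x} ->
  (\int[lebesgue_rV d]_x `|(v x)%:E| = A%:E)%E ->
  3 * (pi ^+ 2 / L ^+ 2) - (2 / L) ^+ d * A <= spectral_gap v L <=
  d.*2.+3%:R * (pi ^+ 2 / L ^+ 2) + 4 * ((2 / L) ^+ d * A).
Proof.
move=> L0 voo v0 vA; have [vt [C [mvt vtC vtv vtE]]] := clamp_potential voo v0.
have vtE' : {ae box_measure L, forall x, vt x = v x} by exact: ae_mrestr.
have hA : (\int[box_measure L]_x (vt x)%:E <= A%:E)%E.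
  have mv : measurable_fun setT (fun x => `|(v x)%:E|%E).
    by apply: measurableT_comp => //; apply/measurable_EFinP; exact: measurable_Lfun_oo.
  rewrite integral_mrestr; last exact/measurable_EFinP.
  apply: (@le_trans _ _ (\int[lebesgue_rV d]_(x in box L) `|(v x)%:E|)%E).
    apply: ge0_le_integral => //.
    - exact: measurable_box.
    - by move=> x _; rewrite lee_fin; have /andP[] := vtC x.
    - by apply: measurable_funTS; exact/measurable_EFinP.
    - exact: measurable_funTS.
    - by move=> x _; rewrite /= lee_fin.
  rewrite -vA; apply: ge0_subset_integral => //; first exact: measurable_box.
have kk : ground_idx != excited_idx i0.
  by apply/eqP => /ffunP /(_ i0); rewrite !ffunE eqxx.
have [l0 l1 l2 l3] := eigenvalue_bounds mvt vtC vtE' (@wave_total _ _ _ L0) kk (@excited_energy_le _ _ L i0).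
have t0 := potential_wave_le L0 mvt vtC ground_idx hA.
have t1 := potential_wave_le L0 mvt vtC (excited_idx i0) hA.
move: l1 l2 l3 t0 t1; rewrite ground_energy excited_energy /spectral_gap.
have -> : d.*2.+3%:R = 2 * d%:R + 3 :> R by rewrite -addn3 natrD -mul2n natrM.
have -> : d.+3%:R = d%:R + 3 :> R by rewrite -addn3 natrD.
move: (pi ^+ 2 / L ^+ 2) ((2 / L) ^+ d * A) => q r.
set x0 := L2_inner _ _ _; set x1 := L2_inner _ _ _.
by move: (d%:R) => dd l1 l2 l3 t0 t1; apply/andP; split; lra.
Qed.

Theorem theorem9 (R : realType) (d : nat) (hd : (3 <= d)%N)
  (v : 'rV[R]_d -> R)
  (v1 : v \in Lfun (lebesgue_rV d) 1%:E)
  (voo : v \in Lfun (lebesgue_rV d) +oo%E)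
  (v0 : {ae lebesgue_rV d, forall x, 0 <= v x}) :
  exists alpha beta L0 : R, [/\ 0 < alpha, 0 < beta, 0 < L0 &
    forall L : R, L0 <= L ->
      alpha / L ^+ 2 <= spectral_gap v L <= beta / L ^+ 2].
Proof.
have d0 : (0 < d)%N by exact: leq_trans hd.
have pi2 : 2 <= pi :> R by exact: pi_ge2.
have iv := (Lfun1_integrable _ v).1 v1.
pose A := fine (\int[lebesgue_rV d]_x `|(v x)%:E|).
have vA : (\int[lebesgue_rV d]_x `|(v x)%:E| = A%:E)%E.
  by rewrite /A fineK//; move/integrable_abse : iv => /(integrable_fin_num measurableT).
have A0 : 0 <= A by rewrite /A fine_ge0// integral_ge0.
exists (pi ^+ 2), ((d.*2.+3 + 8)%:R * pi ^+ 2), (2 + 4 * A); split.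
- by rewrite exprn_gt0//; lra.
- by rewrite mulr_gt0// exprn_gt0//; lra.
- by lra.
(* As [d >= 3] and [L >= 2], [(2 / L) ^+ d * A <= 8 * A / L ^+ 3]; this is at most
   [2 * pi ^+ 2 / L ^+ 2] as soon as [4 * A <= L]. *)
move=> L hL; have L0 : 0 < L by lra.
have L2 : 0 < L ^+ 2 by rewrite exprn_gt0.
have small : (2 / L) ^+ d * A <= 2 * (pi ^+ 2 / L ^+ 2).
  apply: (@le_trans _ _ ((2 / L) ^+ 3 * A)).
    apply: ler_wpM2r => //; apply: ler_wiXn2l => //.
      by rewrite divr_ge0// ltW.
    by rewrite ler_pdivrMr//; lra.
  have -> : (2 / L) ^+ 3 * A = 2 * (4 * A / L / L ^+ 2) by field; rewrite gt_eqF.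
  rewrite ler_pM2l// ler_pM2r ?invr_gt0//.
  apply: (@le_trans _ _ 1); last by nra.
  by rewrite ler_pdivrMr//; lra.
have /andP[lo hi] := spectral_gap_bounds (Ordinal d0) L0 voo v0 vA.
have -> : (d.*2.+3 + 8)%:R * pi ^+ 2 / L ^+ 2 =
    d.*2.+3%:R * (pi ^+ 2 / L ^+ 2) + 8 * (pi ^+ 2 / L ^+ 2).
  by rewrite natrD -mulrDl mulrA.
by move: lo hi small; move: (pi ^+ 2 / _) => q lo hi small; apply/andP; split; lra.
Qed.
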